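(* Let $n,p$ be positive integers, let $B$ be the open unit ball of $\mathbb{R}^n$, let $\varphi\in\mathbb{R}$, and let $u$ be a polyharmonic function of order $p$ on $B$. Then $u$ has a holomorphic extension to the set $\{z\in\mathbb{C}^n: z=e^{i\psi}x,\ \psi\in\mathbb{R},\ x\in B\}$, and the restriction $u_\varphi$ of this extension to $e^{i\varphi}B$ is polyharmonic of order $p$ on $e^{i\varphi}B$.
   Context: Functions are complex-valued. For $G\subseteq\mathbb{R}^n$ and $\varphi\in\mathbb{R}$, $e^{i\varphi}G:=\{e^{i\varphi}x:x\in G\}\subset\mathbb{C}^n$. A function on an open set $G\subseteq\mathbb{R}^n$ is polyharmonic of order $p$ if it is real-analytic on $G$ and satisfies $\Delta_x^p u=0$ there, where $\Delta_x$ is the Laplacian in $\mathbb{R}^n$. A function $f$ on $e^{i\varphi}G$ is called analytic (respectively polyharmonic of order $p$) on $e^{i\varphi}G$ if the function $x\mapsto f(e^{i\varphi}x)$ is real-analytic (respectively polyharmonic of order $p$) on $G$. A holomorphic extension of $u$ to a set $E\subseteq\mathbb{C}^n$ with $B\subseteq E$ means a holomorphic function, defined on some open subset of $\mathbb{C}^n$ containing $E$, which coincides with $u$ on $B$. *)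

(* Defs.v *)
(* MathComp-Analysis; the complex numbers are R[i] with R : realType. *)
From HB Require Import structures.
From mathcomp Require Import all_boot all_order all_algebra finmap.
From mathcomp Require Import complex.
From mathcomp Require Import all_classical all_reals all_analysis.
From mathcomp Require summability.
Set Implicit Arguments.
Unset Strict Implicit.
Unset Printing Implicit Defensive.
Import Order.TTheory GRing.Theory Num.Theory.
Import numFieldNormedType.Exports.
Local Open Scope classical_set_scope.
Local Open Scope ring_scope.

(* The alias ^o gives R[i] its norm topology and makes it a normed module over
   itself; hence 'rV[Cplx R]_n is a normed module over R[i]. *)
Notation Cplx R := (R[i]^o).

Definition unit_ball (R : realType) (n : nat) : set 'rV[R]_n :=
  [set x | Num.sqrt (\sum_(i < n) x 0 i ^+ 2) < 1].
Arguments unit_ball : clear implicits.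

Definition toC (R : realType) (n : nat) (x : 'rV[R]_n) : 'rV[Cplx R]_n :=
  \row_i (x 0 i)%:C%C.

Definition expi (R : realType) (phi : R) : Cplx R := (cos phi +i* sin phi)%C.

Definition rotate (R : realType) (n : nat) (phi : R) (G : set 'rV[R]_n) :
    set 'rV[Cplx R]_n :=
  [set expi phi *: toC x | x in G].

Definition monomial (R : realType) (n : nat) (alpha : {ffun 'I_n -> nat})
    (x : 'rV[R]_n) : R :=
  \prod_(i < n) x 0 i ^+ alpha i.

(* The sum over the multi-indices alpha is unconditional (the limit of the sums
   over finite sets of multi-indices), equivalently absolutely convergent. *)
Definition real_analytic_on (R : realType) (n : nat) (G : set 'rV[R]_n)
    (u : 'rV[R]_n -> Cplx R) : Prop :=
  forall a, G a -> exists c : {ffun 'I_n -> nat} -> Cplx R,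
    \forall x \near a,
      summability.partial_sum
        (fun alpha => c alpha * (monomial alpha (x - a))%:C%C)
        @ summability.totally --> u x.

Definition partial (R : realType) (n : nat) (i : 'I_n)
    (u : 'rV[R]_n -> Cplx R) :
    'rV[R]_n -> Cplx R :=
  fun x => ('D_'e_i (fun y => complex.Re (u y)) x
            +i* 'D_'e_i (fun y => complex.Im (u y)) x)%C.

Definition laplacian (R : realType) (n : nat) (u : 'rV[R]_n -> Cplx R) :
    'rV[R]_n -> Cplx R :=
  fun x => \sum_(i < n) partial i (partial i u) x.

(* G is meant to be open: only the values of u on G then matter. *)
Definition polyharmonic_on (R : realType) (n p : nat) (G : set 'rV[R]_n)
    (u : 'rV[R]_n -> Cplx R) : Prop :=
  real_analytic_on G u /\ forall x, G x -> iter p (@laplacian R n) u x = 0.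

(* Polyharmonicity of f on rotate phi G. *)
Definition polyharmonic_on_rotate (R : realType) (n p : nat) (phi : R)
    (G : set 'rV[R]_n) (f : 'rV[Cplx R]_n -> Cplx R) : Prop :=
  polyharmonic_on p G (fun x => f (expi phi *: toC x)).

(* differentiable is Frechet differentiability over the scalars R[i]. *)
Definition holomorphic_on (R : realType) (n : nat) (U : set 'rV[Cplx R]_n)
    (f : 'rV[Cplx R]_n -> Cplx R) : Prop :=
  open U /\ forall z, U z -> differentiable f z.

Definition holomorphic_extension (R : realType) (n : nat) (B : set 'rV[R]_n)
    (u : 'rV[R]_n -> Cplx R) (E : set 'rV[Cplx R]_n)
    (f : 'rV[Cplx R]_n -> Cplx R) : Prop :=
  (exists U : set 'rV[Cplx R]_n, E `<=` U /\ holomorphic_on U f) /\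
  forall x, B x -> f (toC x) = u x.

(* Main.v *)
(* The function u, polyharmonic of order p, is the restriction to R^n of the
   harmonic function U(x, t) = sum_{j<p} (-1)^j t^{2j}/(2j)! Lap^j u(x), which is
   viewed as a function on R^{2n+2} independent of the remaining variables. Green's
   formula for the product of U with a radial cutoff represents u(x), for |x| < r,
   as an integral of |x - Y|^{-2n} against a bounded density supported in the
   annulus r <= |Y| <= 1 (the even dimension makes the Newton kernel a rational
   function). The integral is only used through linearity, boundedness and
   translation invariance, so that an ultrafilter limit of Riemann sums is enough.
   Replacing x by z in C^n gives a holomorphic function near every e^{i psi} x with
   |x| < r, because the complexified |z - Y|^2 has modulus at least (|Y| - |x|)^2
   there. These functions agree on real points, so they glue by the identity
   principle on a star-shaped domain V; on V the holomorphic function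
   (sum_i d^2/dz_i^2)^p f vanishes since it does so on real points, and restricted
   to e^{i phi} B it is, up to the factor e^{2 i p phi}, the iterated Laplacian. *)
Require Import Defs.
From HB Require Import structures.
From mathcomp Require Import all_boot all_order all_algebra finmap.
From mathcomp Require Import complex.
From mathcomp Require Import all_classical all_reals all_analysis.
From mathcomp Require Import ring lra zify.
From mathcomp Require summability.
Set Implicit Arguments.
Unset Strict Implicit.
Unset Printing Implicit Defensive.
Import Order.TTheory GRing.Theory Num.Theory.
Import numFieldNormedType.Exports.
Import ComplexField.Normc.
Local Open Scope classical_set_scope.
Local Open Scope ring_scope.

(** * Absolutely convergent sums and power series *)

(** The derivatives of U are controlled only inside the open unit ball, so the density must stay
    inside it and each potential reaches only a radius r < 1; hence the family of local extensions.
    Green's formula is applied to the kernel with e > 0 added to the squared distance. This kernel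
    is smooth everywhere, and its Laplacian is a multiple of a bump that concentrates at x as e
    tends to 0. The normalizing constant is not computed but characterized: the same potential
    formed with U = 1 is independent of the point, by translation invariance, and nonzero, by
    counting grid points in a small cube. Dividing by it gives the representation. Analyticity is
    carried by Taylor series with explicit geometric bounds on the coefficients. Dividing such a
    series by the kernel keeps the bounds uniform in Y, which lets a functional known only to be
    linear and bounded pass through the infinite sum. Each domain asks for a bound along the whole
    segment from 0 to z, so that the identity principle can propagate vanishing along that
    segment. *)

Section Modulus.
Variable R : realType.
Implicit Types z w : Cplx R.

Definition modulus z : R := normc z.

Lemma modulus_ge0 z : 0 <= modulus z.
Proof. by case: z => a b; exact: sqrtr_ge0. Qed.

Lemma modulusD z w : modulus (z + w) <= modulus z + modulus w.
Proof. exact: le_normcD. Qed.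

Lemma modulusM z w : modulus (z * w) = modulus z * modulus w.
Proof. exact: normcM. Qed.

Lemma modulusN z : modulus (- z) = modulus z.
Proof. exact: normcN. Qed.

Lemma modulusB z w : modulus (z - w) = modulus (w - z).
Proof. by rewrite -modulusN opprB. Qed.

Lemma modulus0 : modulus 0 = 0.
Proof. exact: normc0. Qed.

Lemma modulus1 : modulus 1 = 1.
Proof. exact: normc1. Qed.

Lemma modulus_eq0 z : modulus z = 0 -> z = 0.
Proof. exact: eq0_normc. Qed.

Lemma modulusX z k : modulus (z ^+ k) = modulus z ^+ k.
Proof.
by elim: k => [|k IH]; rewrite ?expr0 ?modulus1 // !exprS modulusM IH.
Qed.

Lemma modulus_real (x : R) : modulus (x%:C)%C = `|x|.
Proof. by rewrite /modulus /normc /= expr0n /= addr0 sqrtr_sqr. Qed.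

Lemma modulus_nat k : modulus (k%:R : Cplx R) = k%:R.
Proof. by rewrite -[RHS]ger0_norm // -modulus_real rmorph_nat. Qed.

Lemma norm_modulus z : `|z| = ((modulus z)%:C)%C.
Proof. by case: z. Qed.

Lemma Re_le_modulus z : `|complex.Re z| <= modulus z.
Proof.
case: z => a b; rewrite /modulus /normc /= -sqrtr_sqr ler_wsqrtr //.
by rewrite lerDl sqr_ge0.
Qed.

Lemma Im_le_modulus z : `|complex.Im z| <= modulus z.
Proof.
case: z => a b; rewrite /modulus /normc /= -sqrtr_sqr ler_wsqrtr //.
by rewrite lerDr sqr_ge0.
Qed.

Lemma modulus_le_ReIm z : modulus z <= `|complex.Re z| + `|complex.Im z|.
Proof.
case: z => a b; rewrite /modulus /normc /=.
have h0 : 0 <= `|a| + `|b| by rewrite addr_ge0.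
rewrite -[leRHS]ger0_norm // -sqrtr_sqr ler_wsqrtr // sqrrD.
by rewrite !real_normK ?num_real // -addrA lerD2l lerDr mulrn_wge0 ?mulr_ge0.
Qed.

Lemma modulus_sum (J : Type) (s : seq J) (P : pred J) (F : J -> Cplx R) :
  modulus (\sum_(j <- s | P j) F j) <= \sum_(j <- s | P j) modulus (F j).
Proof.
elim/big_ind2: _ => [|x y z w H1 H2|//]; first by rewrite modulus0.
exact: (le_trans (modulusD _ _) (lerD _ _)).
Qed.

Lemma modulus_prod (J : Type) (s : seq J) (P : pred J) (F : J -> Cplx R) :
  modulus (\prod_(j <- s | P j) F j) = \prod_(j <- s | P j) modulus (F j).
Proof.
by elim/big_ind2: _ => [|x y z w <- <-|//]; rewrite ?modulus1 ?modulusM.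
Qed.

Lemma ReD z w : complex.Re (z + w) = complex.Re z + complex.Re w.
Proof. by case: z; case: w. Qed.
Lemma ImD z w : complex.Im (z + w) = complex.Im z + complex.Im w.
Proof. by case: z; case: w. Qed.
Lemma ReN z : complex.Re (- z) = - complex.Re z.
Proof. by case: z. Qed.
Lemma ImN z : complex.Im (- z) = - complex.Im z.
Proof. by case: z. Qed.

Lemma Re_sum (J : Type) (s : seq J) (P : pred J) (F : J -> Cplx R) :
  complex.Re (\sum_(j <- s | P j) F j) = \sum_(j <- s | P j) complex.Re (F j).
Proof. by elim/big_ind2: _ => // x y z w <- <-; rewrite ReD. Qed.

Lemma Im_sum (J : Type) (s : seq J) (P : pred J) (F : J -> Cplx R) :
  complex.Im (\sum_(j <- s | P j) F j) = \sum_(j <- s | P j) complex.Im (F j).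
Proof. by elim/big_ind2: _ => // x y z w <- <-; rewrite ImD. Qed.

Lemma ReM_real (x : R) z : complex.Re (x%:C%C * z) = x * complex.Re z.
Proof. by case: z => a b /=; rewrite mul0r subr0. Qed.
Lemma ImM_real (x : R) z : complex.Im (x%:C%C * z) = x * complex.Im z.
Proof. by case: z => a b /=; rewrite mul0r addr0. Qed.

End Modulus.

#[local] Existing Instance summability.totally_filter.

(** * Unconditional sums of complex families *)

Section UnconditionalSums.
Variables (R : realType) (I : choiceType).
Implicit Types (a b : I -> Cplx R) (v w : Cplx R) (A B : {fset I}).

(** The norm of [R[i]] takes its values in [R[i]]; errors are measured by the real-valued [modulus]
    so that all estimates are inequalities in [R]. *)
Definition has_sum a v := forall e : R, 0 < e ->
  exists A0 : {fset I}, forall A, (A0 `<=` A)%fset ->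
    modulus (\sum_(i <- A) a i - v) < e.

Lemma partial_sumE a A : summability.partial_sum a A = \sum_(i <- A) a i.
Proof. by rewrite /summability.partial_sum (big_seq_fsetE _ _ xpredT a). Qed.

Lemma has_sum_totally a v : has_sum a v <->
  summability.partial_sum a @ summability.totally --> v.
Proof.
split=> [H|H].
  apply/cvgrPdist_lt => e e0.
  have e0' : 0 < complex.Re e by move: e0; rewrite ltcE /= => /andP[].
  have [A0 HA0] := H _ e0'.
  exists A0 => // A /= sA; rewrite partial_sumE distrC norm_modulus (_ : e = ((complex.Re e)%:C)%C) ?ltcR; first exact: HA0.
  by move: e0; rewrite ltcE /= => /andP[/eqP]; case: (e) => x y /= ->.
move=> e e0; move/cvgrPdist_lt : H => /(_ (e%:C)%C).
rewrite ltcR => /(_ e0) [A0 _ HA0]; exists A0 => A sA.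
have := HA0 A sA; by rewrite partial_sumE distrC norm_modulus ltcR.
Qed.

Lemma has_sum_uniq a v w : has_sum a v -> has_sum a w -> v = w.
Proof.
move=> Hv Hw; apply/eqP; rewrite -subr_eq0; apply/eqP/modulus_eq0/eqP.
rewrite eq_le modulus_ge0 andbT; apply/ler_addgt0Pr => e e0; rewrite add0r.
have e20 : 0 < e / 2 by rewrite divr_gt0.
have [A HA] := Hv _ e20; have [B HB] := Hw _ e20.
have := HA _ (fsubsetUl A B); have := HB _ (fsubsetUr A B).
set S := \sum_(_ <- _) _ => h1 h2.
have -> : v - w = (v - S) + (S - w) by ring.
by have := modulusD (v - S) (S - w); rewrite (modulusB v); lra.
Qed.

Lemma eq_has_sum a b v : (forall i, a i = b i) -> has_sum a v -> has_sum b v.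
Proof. by move=> ab; rewrite (_ : a = b) //; apply/funext. Qed.

Lemma has_sumD a b v w :
  has_sum a v -> has_sum b w -> has_sum (fun i => a i + b i) (v + w).
Proof.
move=> Hv Hw e e0; have e20 : 0 < e / 2 by rewrite divr_gt0.
have [A HA] := Hv _ e20; have [B HB] := Hw _ e20.
exists (A `|` B)%fset => D; rewrite fsubUset => /andP[/HA h1 /HB h2].
rewrite big_split /= (_ : _ + _ - _ = (\sum_(i <- D) a i - v) + (\sum_(i <- D) b i - w)).
  by apply: (le_lt_trans (modulusD _ _)); lra.
by ring.
Qed.

Lemma has_sumZ a v (k : Cplx R) : has_sum a v -> has_sum (fun i => k * a i) (k * v).
Proof.
move=> Hv e e0; have k0 : 0 < modulus k + 1 by have := modulus_ge0 k; lra.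
have e0' : 0 < e / (modulus k + 1) by rewrite divr_gt0.
have [A HA] := Hv _ e0'; exists A => B /HA.
rewrite -mulr_sumr -mulrBr modulusM ltr_pdivlMr // mulrC => h.
by apply: le_lt_trans h; rewrite ler_wpM2r ?modulus_ge0 //; lra.
Qed.

Lemma has_sum_sum (J : finType) (a : J -> I -> Cplx R) (v : J -> Cplx R) :
  (forall j, has_sum (a j) (v j)) ->
  has_sum (fun i => \sum_j a j i) (\sum_j v j).
Proof.
move=> H; elim: (index_enum J) => [|j s IH].
  move=> e e0; exists fset0 => A _; rewrite big_nil subr0.
  rewrite big1 ?modulus0 // => i _; exact: big_nil.
by rewrite big_cons; apply: eq_has_sum (has_sumD (H j) IH) => i; rewrite big_cons.
Qed.

Lemma has_sum_le a v (K : R) :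
  has_sum a v -> (forall A, modulus (\sum_(i <- A) a i) <= K) -> modulus v <= K.
Proof.
move=> H HK; apply/ler_addgt0Pr => e e0; have [A HA] := H _ e0.
have := HA A (fsubset_refl A); have := HK A; set S := \sum_(_ <- _) _.
have := modulusD S (v - S); rewrite (modulusB v) addrC subrK; lra.
Qed.

Lemma has_sum_fin a A : (forall i, i \notin A -> a i = 0) ->
  has_sum a (\sum_(i <- A) a i).
Proof.
move=> H e e0; exists A => B AB.
rewrite (big_fsetID _ (mem A)) /= [X in _ + X - _]big1_fset ?addr0.
  rewrite (_ : [fset x in B | x \in A]%fset = A) ?subrr ?modulus0 //.
  apply/fsetP => x; rewrite !inE /= andbC.
  by case xA: (x \in A) => //=; apply: (fsubsetP AB).
by move=> i; rewrite !inE /= => /andP[_ /H].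
Qed.

(** A nonnegative family sums to the supremum of its finite sums. A real family [b] dominated by
    [modulus (a i)] is the difference of the nonnegative families [modulus (a i) + b i] and
    [modulus (a i)]; this is applied to real and imaginary parts. *)
Lemma abs_has_sum a (K : R) :
  (forall A, \sum_(i <- A) modulus (a i) <= K) -> exists v, has_sum a v.
Proof.
have pos (b : I -> R) (K' : R) : (forall i, 0 <= b i) ->
    (forall A, \sum_(i <- A) b i <= K') ->
    exists s : R, forall e, 0 < e -> exists A0 : {fset I}, forall A,
      (A0 `<=` A)%fset -> `|\sum_(i <- A) b i - s| < e.
  move=> b0 HK'; pose E := [set x | exists A, x = \sum_(i <- A) b i].
  have hE : has_sup E.
    by split; [exists (\sum_(i <- fset0) b i), fset0 | exists K' => _ [A ->]].
  exists (sup E) => e e0; have [_ [A0 ->] HA0] := sup_adherent e0 hE.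
  exists A0 => A sA.
  have le1 : \sum_(i <- A) b i <= sup E by apply: sup_upper_bound => //; exists A.
  have le2 : \sum_(i <- A0) b i <= \sum_(i <- A) b i.
    rewrite [leRHS](big_fsetID _ (mem A0)) /=.
    rewrite (_ : [fset x in A | x \in A0]%fset = A0).
      by rewrite lerDl sumr_ge0.
    apply/fsetP => x; rewrite !inE /= andbC.
    by case xA: (x \in A0) => //=; apply: (fsubsetP sA).
  rewrite distrC ger0_norm; lra.
have sgn (b : I -> R) : (forall i, `|b i| <= modulus (a i)) ->
    (forall A, \sum_(i <- A) modulus (a i) <= K) ->
    exists s : R, forall e, 0 < e -> exists A0 : {fset I}, forall A,
      (A0 `<=` A)%fset -> `|\sum_(i <- A) b i - s| < e.
  move=> ba HK.
  have [s1 H1] := pos (fun i => modulus (a i)) K (fun i => modulus_ge0 _) HK.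
  have [||s2 H2] := pos (fun i => modulus (a i) + b i) (K + K).
  - by move=> i; have := ba i; rewrite ler_norml => /andP[]; lra.
  - move=> A; rewrite big_split /=; apply: lerD (HK A) _.
    by apply: le_trans (HK A); apply: ler_sum => i _; apply: le_trans (ba i); exact: ler_norm.
  exists (s2 - s1) => e e0; have e20 : 0 < e / 2 by rewrite divr_gt0.
  have [A1 h1] := H1 _ e20; have [A2 h2] := H2 _ e20.
  exists (A1 `|` A2)%fset => D; rewrite fsubUset => /andP[/h1 {}h1 /h2 {}h2].
  move: h1 h2; rewrite big_split /= !ltr_norml; lra.
move=> HK.
have [s1 H1] := sgn (fun i => complex.Re (a i)) (fun i => Re_le_modulus _) HK.
have [s2 H2] := sgn (fun i => complex.Im (a i)) (fun i => Im_le_modulus _) HK.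
exists (s1 +i* s2)%C => e e0; have e20 : 0 < e / 2 by rewrite divr_gt0.
have [A1 h1] := H1 _ e20; have [A2 h2] := H2 _ e20.
exists (A1 `|` A2)%fset => D; rewrite fsubUset => /andP[/h1 {}h1 /h2 {}h2].
apply: le_lt_trans (modulus_le_ReIm _) _.
by rewrite ReD ImD ReN ImN Re_sum Im_sum /=; lra.
Qed.

(** Outside [A0] a term is the difference of two finite sums, each within 1 of [v]. The bound later
    yields the geometric estimate of Taylor coefficients. *)
Lemma has_sum_bounded a v : has_sum a v -> exists K : R, forall i, modulus (a i) <= K.
Proof.
move=> H; have [A0 HA] := H 1 ltr01.
exists (2 + \sum_(i <- A0) modulus (a i)) => i.
have s0 : 0 <= \sum_(i <- A0) modulus (a i) by apply: sumr_ge0 => j _; exact: modulus_ge0.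
have [iA|iA] := boolP (i \in A0).
  rewrite (big_fsetD1 _ iA) /=.
  have : 0 <= \sum_(i <- (A0 `\ i)%fset) modulus (a i).
    by apply: sumr_ge0 => j _; exact: modulus_ge0.
  by lra.
have := HA _ (fsubset_refl A0); have := HA _ (fsubsetU1 i A0).
rewrite big_fsetU1 //=; set S := \sum_(_ <- _) _ => h1 h2.
have := modulusD (a i + S - v) (v - S); rewrite (modulusB v).
by rewrite (_ : a i + S - v + (v - S) = a i); [lra | ring].
Qed.

End UnconditionalSums.

(** Serves to shift multi-indices by one: [s] is then the increment in one coordinate, whose image
    is the set of indices with a positive entry there. *)
Lemma has_sum_reindex (R : realType) (I J : choiceType) (s : I -> J) (t : J -> I)
    (P : pred J) (b : J -> Cplx R) v :
  cancel s t -> (forall i, P (s i)) -> (forall j, P j -> s (t j) = j) ->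
  (forall j, ~~ P j -> b j = 0) ->
  has_sum (b \o s) v -> has_sum b v.
Proof.
move=> sK Ps tK b0 H e e0; have [A0 HA] := H _ e0.
exists (s @` A0)%fset => B sB.
pose A := (t @` [fset j in B | P j])%fset.
have /HA : (A0 `<=` A)%fset.
  apply/fsubsetP => i iA; apply/imfsetP; exists (s i); last by rewrite sK.
  by rewrite !inE /= Ps andbT; apply: (fsubsetP sB); exact: in_imfset.
rewrite (big_fsetID _ P) /= [X in _ + X - _]big1_fset ?addr0; last first.
  by move=> j; rewrite !inE /= => /andP[_ /b0].
rewrite /A big_imfset /=; last first.
  move=> x y; rewrite !inE /= => /andP[_ /tK {2}<-] /andP[_ /tK {2}<-] -> //.
rewrite (_ : \sum_(i <- _) b (s (t i)) = \sum_(i <- [fset x | x in B & P x]%fset) b i) //.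
by apply: eq_fbigr => // j; rewrite !inE /= => /andP[_ /tK ->].
Qed.

Lemma ler_sum_subset (R : numDomainType) (T : eqType) (s1 s2 : seq T) (F : T -> R) :
  (forall x, 0 <= F x) -> uniq s1 -> {subset s1 <= s2} ->
  \sum_(x <- s1) F x <= \sum_(x <- s2) F x.
Proof.
move=> F0; elim: s1 s2 => [|x s1 IH] s2 /= => [_ _|/andP[xs1 us1] sub].
  by rewrite big_nil sumr_ge0.
have xs2 : x \in s2 by apply: sub; rewrite mem_head.
rewrite big_cons (big_rem _ xs2) /= lerD2l; apply: IH => // y ys1.
have ys2 : y \in s2 by apply: sub; rewrite inE ys1 orbT.
have : y \in x :: rem x s2 by rewrite -(perm_mem (perm_to_rem xs2)).
by rewrite inE => /orP[/eqP yx|//]; rewrite -yx ys1 in xs1.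
Qed.

(** * Power series in several variables with geometric coefficient bounds *)

Section PowerSeries.
Variables (R : realType) (n : nat).
Local Notation mi := {ffun 'I_n -> nat}.
Implicit Types (al be : mi) (c : mi -> Cplx R) (w : 'rV[Cplx R]_n).

Definition mdeg al := (\sum_i al i)%N.

Definition cmono al w : Cplx R := \prod_i w 0 i ^+ al i.

Definition psum c w v := has_sum (fun al => c al * cmono al w) v.

(** These bounds are carried explicitly because they survive differentiation and division by a
    quadratic polynomial, up to new constants, and can be made uniform in a parameter. *)
Definition coef_bound c (C M : R) := forall al, modulus (c al) <= C * M ^+ mdeg al.

Definition mincr i al : mi := [ffun j => al j + (j == i)]%N.
Definition mdecr i al : mi := [ffun j => al j - (j == i)]%N.

Definition mderiv i c : mi -> Cplx R := fun al => (al i).+1%:R * c (mincr i al).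

Lemma mdeg_incr i al : mdeg (mincr i al) = (mdeg al).+1.
Proof.
rewrite /mdeg (eq_bigr (fun j => (al j + (j == i))%N)); last by move=> j _; rewrite ffunE.
rewrite big_split /= -addn1; congr (_ + _)%N.
by rewrite (bigD1 i) //= eqxx big1 // => j /negPf ->.
Qed.

Lemma mincrK i : cancel (mincr i) (mdecr i).
Proof. by move=> al; apply/ffunP => j; rewrite !ffunE addnK. Qed.

Lemma mdecrK i al : (0 < al i)%N -> mincr i (mdecr i al) = al.
Proof.
move=> h; apply/ffunP => j; rewrite !ffunE.
by case: (eqVneq j i) => [->|_]; rewrite ?subnK // subn0 addn0.
Qed.

(** A finite set of multi-indices lies in a box, over which the sum factors into [n] finite
    geometric sums. *)
Lemma sum_geometric (t : R) (A : {fset mi}) : 0 <= t -> t < 1 ->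
  \sum_(al <- A) t ^+ mdeg al <= ((1 - t)^-1) ^+ n.
Proof.
move=> t0 t1.
pose M := (\max_(al <- A) \max_i al i)%N.
pose emb (f : {ffun 'I_n -> 'I_M.+1}) : mi := [ffun i => nat_of_ord (f i)].
have sub : {subset (A : seq mi) <= [seq emb f | f <- enum {: {ffun 'I_n -> 'I_M.+1}}]}.
  move=> al alA; apply/mapP; exists [ffun i => inord (al i)]; first by rewrite mem_enum.
  apply/ffunP => i; rewrite !ffunE inordK // ltnS.
  apply: (leq_trans (leq_bigmax (F := fun j => al j) i)).
  by apply: (leq_bigmax_seq (F := fun be : mi => \max_i be i)%N).
apply: (le_trans (ler_sum_subset _ _ sub)); first by move=> al; exact: exprn_ge0.
  exact: fset_uniq.
rewrite big_map big_enum /=.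
rewrite (eq_bigr (fun f : {ffun 'I_n -> 'I_M.+1} => \prod_i t ^+ f i)); last first.
  by move=> f _; rewrite /mdeg expr_sum; apply: eq_bigr => i _; rewrite ffunE.
rewrite -(bigA_distr_bigA (fun (i : 'I_n) (k : 'I_M.+1) => t ^+ k)) /=.
rewrite prodr_const card_ord; apply: lerXn2r; rewrite ?nnegrE ?sumr_ge0 //.
- by move=> k _; exact: exprn_ge0.
- by rewrite invr_ge0; lra.
have t1' : 0 < 1 - t by lra.
rewrite -[leRHS]mul1r ler_pdivlMr // mulrC.
rewrite -(big_mkord xpredT (fun k => t ^+ k)).
elim: M.+1 => [|k IH]; first by rewrite big_geq // mulr0.
suff -> : (1 - t) * \sum_(0 <= i < k.+1) t ^+ i = 1 - t ^+ k.+1.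
  by rewrite gerBl exprn_ge0.
elim: (k) => [|m IHm]; first by rewrite big_nat1 expr0 expr1 mulr1.
by rewrite big_nat_recr //= mulrDr IHm [in RHS]exprS; ring.
Qed.

Lemma geometric_has_sum (a : mi -> Cplx R) (C t : R) : 0 <= C -> 0 <= t -> t < 1 ->
  (forall al, modulus (a al) <= C * t ^+ mdeg al) ->
  exists2 v, has_sum a v & modulus v <= C * ((1 - t)^-1) ^+ n.
Proof.
move=> C0 t0 t1 H.
have HA (A : {fset mi}) : \sum_(al <- A) modulus (a al) <= C * ((1 - t)^-1) ^+ n.
  apply: (le_trans (ler_sum _ (fun al _ => H al))).
  by rewrite -mulr_sumr; apply: ler_wpM2l => //; exact: sum_geometric.
have [v Hv] := abs_has_sum HA; exists v => //.
by apply: has_sum_le Hv _ => A; apply: le_trans (HA A); exact: modulus_sum.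
Qed.

Lemma modulus_cmono al w (eta : R) : (forall i, modulus (w 0 i) <= eta) ->
  modulus (cmono al w) <= eta ^+ mdeg al.
Proof.
move=> H; rewrite /cmono modulus_prod /mdeg expr_sum; apply: ler_prod => i _.
by rewrite modulusX exprn_ge0 ?modulus_ge0 //= lerXn2r ?nnegrE ?modulus_ge0 // (le_trans _ (H i)) ?modulus_ge0.
Qed.

Lemma psum_exists c C M eta w : 0 <= C -> 0 <= M -> 0 <= eta -> M * eta < 1 ->
  coef_bound c C M -> (forall i, modulus (w 0 i) <= eta) ->
  exists v, psum c w v.
Proof.
move=> C0 M0 e0 h1 Hc Hw.
have [] := @geometric_has_sum (fun al => c al * cmono al w) C (M * eta) C0.
- exact: mulr_ge0.
- by [].
- move=> al; rewrite modulusM exprMn mulrA ler_pM ?modulus_ge0 //.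
  exact: modulus_cmono.
by move=> v Hv _; exists v.
Qed.

(** The factor [al i + 1] is at most [2 ^+ mdeg al], so doubling [M] absorbs it; the derived series
    reads a coefficient of degree one higher, whence [C * M]. *)
Lemma coef_bound_deriv i c C M : 0 <= C -> 0 <= M -> coef_bound c C M ->
  coef_bound (mderiv i c) (C * M) (2 * M).
Proof.
move=> C0 M0 H al; rewrite /mderiv modulusM.
rewrite modulus_nat.
have h1 : (al i).+1%:R <= (2 : R) ^+ mdeg al.
  rewrite -natrX ler_nat; apply: (@leq_trans (mdeg al).+1); last exact: ltn_expl.
  by rewrite ltnS /mdeg (bigD1 i) //= leq_addr.
have h2 := H (mincr i al); rewrite mdeg_incr exprS in h2.
have -> : C * M * (2 * M) ^+ mdeg al = 2 ^+ mdeg al * (C * (M * M ^+ mdeg al)) by rewrite exprMn; ring.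
by apply: ler_pM => //; exact: modulus_ge0.
Qed.

(** Both sides carry a square so that the exponent [m - 2] never appears. For [t = h = eta] there is
    equality, which is the origin of [2 ^+ m - 1 - m]. *)
Lemma power_taylor (t h : Cplx R) (eta : R) m : 0 < eta ->
  modulus t <= eta -> modulus h <= eta ->
  modulus ((t + h) ^+ m - t ^+ m - h * (m%:R * t ^+ m.-1)) * eta ^+ 2
    <= modulus h ^+ 2 * (eta ^+ m * (2 ^+ m - 1 - m%:R)).
Proof.
move=> e0 Ht Hh; elim: m => [|m IH].
  by rewrite !expr0 mul0r mulr0 subrr subr0 modulus0 mul0r subrr subr0 !mulr0.
set E := _ - _ - _ in IH.
have -> : (t + h) ^+ m.+1 - t ^+ m.+1 - h * (m.+1%:R * t ^+ m) =
          (t + h) * E + h ^+ 2 * (m%:R * t ^+ m.-1).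
  rewrite /E; case: (m) => [|k] /=; first by rewrite !expr0 expr1; ring.
  by rewrite !exprS -[k.+2%:R]natr1; ring.
have h1 : modulus (t + h) <= 2 * eta by apply: (le_trans (modulusD _ _)); lra.
have h2 : modulus (m%:R * t ^+ m.-1) * eta <= m%:R * eta ^+ m.
  case: (m) => [|k]; first by rewrite !mul0r modulus0 mul0r.
  rewrite modulusM modulusX modulus_nat exprSr mulrA; apply: ler_wpM2r; first exact: ltW.
  by apply: ler_wpM2l => //=; apply: lerXn2r; rewrite ?nnegrE ?modulus_ge0 // ltW.
set a := m%:R * t ^+ m.-1 in h2 *.
have h3 := modulusD ((t + h) * E) (h ^+ 2 * a).
rewrite (modulusM (t + h) E) (modulusM (h ^+ 2) a) modulusX in h3.
have hh := modulus_ge0 h.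
have mE := modulus_ge0 E.
apply: le_trans (ler_wpM2r (sqr_ge0 eta) h3) _.
have h4 : modulus (t + h) * (modulus E * eta ^+ 2) <=
   2 * eta * (modulus h ^+ 2 * (eta ^+ m * (2 ^+ m - 1 - m%:R))).
  by apply: ler_pM => //; rewrite ?modulus_ge0 // mulr_ge0 // sqr_ge0.
have h5 : modulus h ^+ 2 * eta * (modulus a * eta) <=
   modulus h ^+ 2 * eta * (m%:R * eta ^+ m).
  by apply: ler_wpM2l h2; rewrite mulr_ge0 ?sqr_ge0 // ltW.
rewrite (exprS eta m) (exprS 2 m) -natr1.
by move: h4 h5; rewrite !expr2; lra.
Qed.

Lemma cmonoE al w i :
  cmono al w = w 0 i ^+ al i * \prod_(j | j != i) w 0 j ^+ al j.
Proof. by rewrite /cmono (bigD1 i). Qed.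

Lemma psum_deriv_reindex i c w d : psum (mderiv i c) w d ->
  has_sum (fun al => c al * ((al i)%:R * w 0 i ^+ (al i).-1 *
                              \prod_(j | j != i) w 0 j ^+ al j)) d.
Proof.
move=> H; apply: (has_sum_reindex (s := mincr i) (t := mdecr i)
  (P := fun al => (0 < al i)%N)).
- exact: mincrK.
- by move=> al; rewrite ffunE eqxx addn1.
- by move=> al; exact: mdecrK.
- by move=> al; rewrite lt0n negbK => /eqP ->; rewrite !mul0r mulr0.
apply: eq_has_sum H => al; rewrite /mderiv /= (cmonoE _ _ i) ffunE eqxx addn1 /=.
rewrite (eq_bigr (fun j => w 0 j ^+ (mincr i al) j)); last first.
  by move=> j /negPf ji; rewrite ffunE ji addn0.
by ring.
Qed.

(** Term by term, [power_taylor] bounds the remainder by [|h|^2] times a geometric family of ratio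
    [2 eta M]. The smallness condition makes this ratio at most 1/2, whence the factor [2 ^+ n]. *)
Lemma psum_deriv i c C M eta w h v v' d :
  0 <= C -> 0 <= M -> 0 < eta -> 4 * (eta * M) <= 1 -> coef_bound c C M ->
  (forall j, modulus (w 0 j) <= eta) -> modulus h <= eta ->
  psum c w v -> psum c (w + h *: 'e_i) v' -> psum (mderiv i c) w d ->
  modulus (v' - v - h * d) <= modulus h ^+ 2 * (C * 2 ^+ n / eta ^+ 2).
Proof.
move=> C0 M0 e0 small Hc Hw Hh Hv Hv' /psum_deriv_reindex Hd.
have S := has_sumD Hv' (has_sumD (has_sumZ (-1) Hv) (has_sumZ (- h) Hd)).
have E : v' + (-1 * v + - h * d) = v' - v - h * d by ring.
rewrite E {E} in S.
set T := (X in has_sum X) in S.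
pose K := modulus h ^+ 2 / eta ^+ 2 * C.
have K0 : 0 <= K by rewrite mulr_ge0 // divr_ge0 // sqr_ge0.
have HT al : modulus (T al) <= K * (2 * (eta * M)) ^+ mdeg al.
  pose P := \prod_(j | j != i) w 0 j ^+ al j.
  pose m := al i.
  have -> : T al = c al * (P * ((w 0 i + h) ^+ m - w 0 i ^+ m - h * (m%:R * w 0 i ^+ m.-1))).
    rewrite /T !(cmonoE _ _ i) !mxE !eqxx /= mulr1 -/m -/P.
    rewrite (eq_bigr (fun j => w 0 j ^+ al j)); last first.
      by move=> j /negPf ji; rewrite !mxE ji /= ?andbF mulr0 addr0.
    by rewrite -/P; ring.
  set E := (_ - _ - _).
  have HE := power_taylor m e0 (Hw i) Hh; rewrite -/E in HE.
  have HP : modulus P * eta ^+ m <= eta ^+ mdeg al.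
    rewrite /mdeg (bigD1 i) //= exprD mulrC; apply: ler_wpM2l; first by rewrite exprn_ge0 ?ltW.
    rewrite modulus_prod expr_sum; apply: ler_prod => j _.
    rewrite modulusX exprn_ge0 ?modulus_ge0 //= lerXn2r ?nnegrE ?modulus_ge0 //.
    exact: ltW.
  have h2 : (2 : R) ^+ m - 1 - m%:R <= 2 ^+ mdeg al.
    have : (2 : R) ^+ m <= 2 ^+ mdeg al.
      by rewrite ler_weXn2l ?ler1n // /mdeg (bigD1 i) //= leq_addr.
    by have : 0 <= m%:R :> R by []; lra.
  have HPE : modulus (P * E) <= modulus h ^+ 2 / eta ^+ 2 * (2 * eta) ^+ mdeg al.
    rewrite mulrAC ler_pdivlMr ?exprn_gt0 // modulusM -mulrA.
    apply: (le_trans (ler_wpM2l (modulus_ge0 P) HE)).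
    rewrite mulrCA ler_wpM2l ?sqr_ge0 // mulrA exprMn mulrC.
    apply: (@le_trans _ _ (2 ^+ mdeg al * (modulus P * eta ^+ m))).
      by apply: ler_wpM2r h2; rewrite mulr_ge0 ?modulus_ge0 // exprn_ge0 // ltW.
    by rewrite ler_wpM2l // exprn_ge0.
  rewrite modulusM; apply: le_trans (ler_pM (modulus_ge0 _) (modulus_ge0 _) (Hc al) HPE) _.
  by rewrite le_eqVlt /K !exprMn; apply/orP; left; apply/eqP; ring.
have t0 : 0 <= 2 * (eta * M) by rewrite mulr_ge0 // mulr_ge0 // ltW.
have t1 : 2 * (eta * M) < 1 by lra.
have [v0 Hv0 Hle] := geometric_has_sum K0 t0 t1 HT.
rewrite (has_sum_uniq S Hv0); apply: (le_trans Hle).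
have -> : modulus h ^+ 2 * (C * 2 ^+ n / eta ^+ 2) = K * 2 ^+ n by rewrite /K; ring.
apply: ler_wpM2l => //; apply: lerXn2r; rewrite ?nnegrE ?invr_ge0 //; first by lra.
by rewrite -[leRHS]invrK lef_pV2 ?posrE ?invr_gt0 //; lra.
Qed.

End PowerSeries.

(** * Analytic functions and the identity principle *)

Section Expansions.
Variables (R : realType) (n : nat).
Local Notation mi := {ffun 'I_n -> nat}.
Local Notation cvec := 'rV[Cplx R]_n.
Implicit Types (al be : mi) (c : mi -> Cplx R) (w z : cvec) (f g : cvec -> Cplx R).

Definition small_vec w (d : R) := forall i, modulus (w 0 i) < d.

Definition expansion f z c := exists C M d : R,
  [/\ 0 <= C, 0 <= M, 0 < d, coef_bound c C M &
      forall w, small_vec w d -> psum c w (f (z + w))].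

Definition mzero : mi := [ffun=> 0%N].
Definition munit i : mi := mincr i mzero.

Lemma mdeg0 : mdeg mzero = 0%N.
Proof. by rewrite /mdeg big1 // => i _; rewrite ffunE. Qed.

Lemma mdeg_eq0 al : mdeg al = 0%N -> al = mzero.
Proof.
move=> /eqP; rewrite /mdeg sum_nat_eq0 => /forallP h; apply/ffunP => i.
by rewrite ffunE; apply/eqP; have := h i.
Qed.

Lemma mdeg_gt0 al : (0 < mdeg al)%N -> exists i, (0 < al i)%N.
Proof.
rewrite lt0n => h; apply/existsP; apply: contraNT h; rewrite negb_exists => /forallP h.
by rewrite /mdeg sum_nat_eq0; apply/forallP => i; have := h i; rewrite lt0n negbK.
Qed.

Lemma mdeg_decr i al : (0 < al i)%N -> (mdeg (mdecr i al)).+1 = mdeg al.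
Proof. by move=> h; rewrite -(mdeg_incr i) mdecrK. Qed.

Lemma munit_eq0 i : (munit i == mzero) = false.
Proof. by apply/eqP => h; have := mdeg_incr i mzero; rewrite -/(munit i) h mdeg0. Qed.

Lemma munit_eq i j : (munit i == munit j) = (i == j).
Proof.
apply/eqP/eqP => [/ffunP /(_ i)|->//]; rewrite !ffunE eqxx.
by case: (i =P j).
Qed.

Lemma cmono_mzero w : cmono mzero w = 1.
Proof. by rewrite /cmono big1 // => i _; rewrite ffunE expr0. Qed.

Lemma cmono0 al : cmono al (0 : cvec) = (al == mzero)%:R.
Proof.
have [->|h] := eqVneq al mzero; first exact: cmono_mzero.
have [|i hi] := @mdeg_gt0 al.
  by rewrite lt0n; apply: contraNneq h => /mdeg_eq0 ->.
by rewrite (cmonoE _ _ i) mxE expr0n eqn0Ngt hi mul0r.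
Qed.

Lemma cmono_munit i w : cmono (munit i) w = w 0 i.
Proof.
rewrite (cmonoE _ _ i) !ffunE eqxx add0n expr1 big1 ?mulr1 // => j /negPf ji.
by rewrite !ffunE ji expr0.
Qed.

Lemma has_sum_delta (be : mi) (k : Cplx R) :
  has_sum (fun al : mi => if al == be then k else 0) k.
Proof.
have := @has_sum_fin R mi (fun al : mi => if al == be then k else 0) [fset be]%fset.
rewrite big_seq_fset1 eqxx; apply => al; rewrite inE => /negPf -> //.
Qed.

Lemma psum0 c : psum c (0 : cvec) (c mzero).
Proof.
apply: eq_has_sum (has_sum_delta mzero (c mzero)) => al; rewrite cmono0.
by case: eqP => [->|_]; rewrite ?mulr1 ?mulr0.
Qed.

Lemma expansion_value f z c : expansion f z c -> c mzero = f z.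
Proof.
move=> [C [M [d [_ _ d0 _ H]]]]; have := H 0; rewrite addr0 => Hz.
by apply: has_sum_uniq (psum0 c) (Hz _) => i; rewrite mxE modulus0.
Qed.

(** Leaves room to move from [z] by [w] and then by an increment of size [d], with the ratios [M d]
    and [2 M d] of the geometric series far below 1. *)
Lemma expansion_radius f z c : expansion f z c -> exists C M d : R,
  [/\ 0 <= C, 0 <= M, 0 < d, coef_bound c C M & 16 * (d * M) <= 1 /\
      forall w, small_vec w (4 * d) -> psum c w (f (z + w))].
Proof.
move=> [C [M [d [C0 M0 d0 Hc H]]]].
have p : 0 < 16 * (M + 1) by lra.
pose d' := Num.min (d / 4) (16 * (M + 1))^-1.
have d'0 : 0 < d' by rewrite lt_min invr_gt0 p andbT; lra.
exists C, M, d'; split => //; split.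
  have h1 : d' <= (16 * (M + 1))^-1 by rewrite ge_min lexx orbT.
  have h2 : d' * (16 * (M + 1)) <= 1 by rewrite -ler_pdivlMr // mul1r.
  by nra.
move=> w Hw; apply: H => i; apply: lt_le_trans (Hw i) _.
have : d' <= d / 4 by rewrite ge_min lexx.
by lra.
Qed.

(** A quadratic error is what the Taylor series gives directly, and it determines [d]. *)
Definition deriv_at f i z d := exists K e : R, 0 < e /\
  forall h : Cplx R, modulus h <= e ->
    modulus (f (z + h *: 'e_i) - f z - h * d) <= modulus h ^+ 2 * K.

Lemma deriv_at_uniq f i z d d' : deriv_at f i z d -> deriv_at f i z d' -> d = d'.
Proof.
move=> [K [e [e0 H]]] [K' [e' [e'0 H']]].
apply/eqP; rewrite -subr_eq0; apply/eqP/modulus_eq0/eqP.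
rewrite eq_le modulus_ge0 andbT; apply/ler_addgt0Pr => r r0; rewrite add0r.
pose k := `|K| + `|K'| + 1.
have k0 : 0 < k by rewrite ltr_wpDl // addr_ge0.
pose t := Num.min (Num.min e e') (r / k).
have t0 : 0 < t by rewrite !lt_min e0 e'0 divr_gt0.
have tE : modulus (t%:C%C : Cplx R) = t by rewrite modulus_real ger0_norm // ltW.
have te : t <= e by rewrite !ge_min lexx.
have te' : t <= e' by rewrite !ge_min lexx orbT.
have tr : t * k <= r by rewrite -ler_pdivlMr // !ge_min lexx !orbT.
have := H (t%:C)%C; have := H' (t%:C)%C; rewrite !tE => /(_ te') h1 /(_ te) h2.
set a := f (_ + _) in h1 h2.
have : t * modulus (d - d') <= t ^+ 2 * (`|K| + `|K'|).
  rewrite -[X in X * _]tE -modulusM.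
  have -> : (t%:C)%C * (d - d') = (a - f z - (t%:C)%C * d') - (a - f z - (t%:C)%C * d) by ring.
  apply: (le_trans (modulusD _ _)); rewrite modulusN mulrDr addrC.
  apply: lerD; first by apply: (le_trans h2); rewrite ler_wpM2l ?sqr_ge0 ?ler_norm.
  by apply: (le_trans h1); rewrite ler_wpM2l ?sqr_ge0 ?ler_norm.
rewrite expr2 -mulrA ler_pM2l // => h.
by apply: (le_trans h); apply: le_trans tr; rewrite ler_wpM2l ?ltW // /k ltrDl.
Qed.

Lemma expansion_deriv f z c i : expansion f z c -> exists C M d : R,
  [/\ 0 <= C, 0 <= M, 0 < d, coef_bound (mderiv i c) C M &
    forall w, small_vec w d -> exists2 v, psum (mderiv i c) w v & deriv_at f i (z + w) v].
Proof.
move=> /expansion_radius [C [M [d [C0 M0 d0 Hc [small H]]]]].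
have Hc' := coef_bound_deriv i C0 M0 Hc.
exists (C * M), (2 * M), d; split=> //; try exact: mulr_ge0.
move=> w Hw; have Hw' j : modulus (w 0 j) <= d by rewrite ltW.
have [||||||v Hv] := @psum_exists R n (mderiv i c) (C * M) (2 * M) d w => //.
- exact: mulr_ge0.
- exact: mulr_ge0.
- exact: ltW.
- by lra.
exists v => //; exists (C * 2 ^+ n / d ^+ 2), d; split=> // h Hh.
apply: (psum_deriv C0 M0 d0 _ Hc Hw' Hh _ _ Hv); first by lra.
  by apply: H => j; apply: lt_trans (Hw j) _; lra.
rewrite -addrA; apply: H => j; rewrite !mxE /=.
apply: le_lt_trans (modulusD _ _) _; rewrite modulusM.
have : modulus h * modulus ((j == i)%:R : Cplx R) <= d.
  by rewrite modulus_nat; case: (j == i); rewrite /= ?mulr1 ?mulr0 // ltW.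
by have := Hw j; lra.
Qed.

(** The terms of degree 0 and 1 are removed by adding families supported at single multi-indices;
    what is left has degree at least 2 and gives the factor [r ^+ 2]. *)
Lemma expansion_frechet f z c : expansion f z c -> exists K d : R, 0 < d /\
  forall w (r : R), (forall i, modulus (w 0 i) <= r) -> r <= d ->
    modulus (f (z + w) - f z - \sum_i c (munit i) * w 0 i) <= K * r ^+ 2.
Proof.
move=> E; have E0 := expansion_value E.
have /expansion_radius [C [M [d [C0 M0 d0 Hc [small H]]]]] := E.
have M1 : M * d < 1 by lra.
exists (C / d ^+ 2 * ((1 - M * d)^-1) ^+ n), d; split=> // w r Hw rd.
(* If [n = 0] the assumption on [w] says nothing about [r], which may be negative; that case falls
   under [w = 0]. *)
have [->|n0] := eqVneq w 0.
  rewrite addr0 subrr big1 ?subr0 ?modulus0; last by move=> i _; rewrite mxE mulr0.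
  by rewrite mulr_ge0 ?sqr_ge0 // mulr_ge0 ?divr_ge0 ?sqr_ge0 // exprn_ge0 // invr_ge0; lra.
have r0 : 0 <= r.
  have [i hi] : exists i, w 0 i != 0.
    apply/existsP; apply: contraNT n0; rewrite negb_exists => /forallP h.
    by apply/eqP/rowP => i; rewrite mxE; apply/eqP; have := h i; rewrite negbK.
  exact: le_trans (modulus_ge0 _) (Hw i).
have S1 : psum c w (f (z + w)) by apply: H => i; apply: le_lt_trans (Hw i) _; lra.
have S2 := has_sum_sum (fun i => has_sum_delta (munit i) (- (c (munit i) * w 0 i))).
have S := has_sumD S1 (has_sumD (has_sum_delta mzero (- c mzero)) S2).
have EE : f (z + w) + (- c mzero + \sum_i - (c (munit i) * w 0 i)) =
          f (z + w) - f z - \sum_i c (munit i) * w 0 i by rewrite E0 sumrN addrA.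
rewrite EE {EE S1 S2} in S.
set T := (X in has_sum X) in S.
pose K := C * (r ^+ 2 / d ^+ 2).
have K0 : 0 <= K by rewrite mulr_ge0 // divr_ge0 // sqr_ge0.
have d1 := ltW d0.
have Md0 : 0 <= M * d by exact: mulr_ge0.
have HT al : modulus (T al) <= K * (M * d) ^+ mdeg al.
  have rhs0 : 0 <= K * (M * d) ^+ mdeg al by rewrite mulr_ge0 // exprn_ge0.
  rewrite /T; case dE: (mdeg al) => [|[|k]].
  - have -> := mdeg_eq0 dE; rewrite eqxx cmono_mzero mulr1.
    rewrite big1 ?addr0 ?subrr ?modulus0 // => [|i _]; first by rewrite expr0 mulr1.
    by rewrite eq_sym munit_eq0.
  - have [|i hi] := @mdeg_gt0 al; first by rewrite dE.
    have dd : mdeg (mdecr i al) = 0%N by have := mdeg_decr hi; rewrite dE => -[].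
    have alE : al = munit i by rewrite -(mdecrK hi) (mdeg_eq0 dd).
    rewrite alE munit_eq0 cmono_munit add0r (bigD1 i) //= eqxx big1 => [|j /negPf ji].
      by rewrite addr0 subrr modulus0 -dE.
    by rewrite munit_eq eq_sym ji.
  rewrite -dE; have -> : (al == mzero) = false by apply/eqP => h; rewrite h mdeg0 in dE.
  rewrite big1 ?addr0 ?add0r => [|i _]; last first.
    by case: eqP => // h; move: dE; rewrite h /munit mdeg_incr mdeg0.
  rewrite modulusM; apply: le_trans (ler_pM (modulus_ge0 _) (modulus_ge0 _) (Hc al)
      (modulus_cmono al Hw)) _.
  rewrite /K exprMn dE (_ : r ^+ k.+2 = r ^+ 2 * r ^+ k); last by rewrite -exprD.
  rewrite (_ : d ^+ k.+2 = d ^+ 2 * d ^+ k); last by rewrite -exprD.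
  have -> : C * (r ^+ 2 / d ^+ 2) * (M ^+ k.+2 * (d ^+ 2 * d ^+ k)) =
            C * M ^+ k.+2 * (r ^+ 2 * d ^+ k).
    by field; rewrite gt_eqF.
  apply: ler_wpM2l; first by rewrite mulr_ge0 // exprn_ge0.
  by apply: ler_wpM2l; rewrite ?sqr_ge0 // lerXn2r ?nnegrE.
have [v0 Hv0 Hle] := geometric_has_sum K0 Md0 M1 HT.
rewrite (has_sum_uniq S Hv0); apply: (le_trans Hle).
by rewrite le_eqVlt /K; apply/orP; left; apply/eqP; ring.
Qed.

Lemma expansion_continuous f z c : expansion f z c -> forall e : R, 0 < e ->
  exists2 d : R, 0 < d & forall w, small_vec w d -> modulus (f (z + w) - f z) < e.
Proof.
move=> /expansion_frechet [K [d [d0 H]]] e e0.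
pose S := \sum_i modulus (c (munit i)).
have S0 : 0 <= S by apply: sumr_ge0 => i _; exact: modulus_ge0.
pose L := `|K| * d + S + 1.
have L0 : 0 < L by rewrite ltr_wpDl // addr_ge0 // mulr_ge0 // ltW.
pose r := Num.min d (e / (2 * L)).
have r0 : 0 < r by rewrite lt_min d0 divr_gt0 // mulr_gt0.
have rd : r <= d by rewrite ge_min lexx.
have rL : r * L < e.
  have : r * (2 * L) <= e by rewrite -ler_pdivlMr ?mulr_gt0 // ge_min lexx orbT.
  by have := mulr_gt0 r0 L0; lra.
exists r => // w Hw; have Hw' i : modulus (w 0 i) <= r by rewrite ltW.
have h1 := H w r Hw' rd.
have h2 : modulus (\sum_i c (munit i) * w 0 i) <= S * r.
  apply: (le_trans (modulus_sum _ _ _)); rewrite mulr_suml; apply: ler_sum => i _.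
  by rewrite modulusM; apply: ler_wpM2l => //; exact: modulus_ge0.
have := modulusD (f (z + w) - f z - \sum_i c (munit i) * w 0 i) (\sum_i c (munit i) * w 0 i).
rewrite subrK => h3.
have h4 : K * r ^+ 2 <= `|K| * d * r.
  rewrite expr2 mulrA; apply: ler_wpM2r; first exact: ltW.
  apply: (le_trans (ler_wpM2r (ltW r0) (ler_norm K))).
  exact: ler_wpM2l.
apply: le_lt_trans rL; rewrite /L; apply: (le_trans h3); lra.
Qed.

Definition coord_open (V : set cvec) :=
  forall z, V z -> exists2 d : R, 0 < d & forall w, small_vec w d -> V (z + w).

Definition analytic (V : set cvec) f := forall z, V z -> exists c, expansion f z c.

(** A relation, since [g] matters only on [V]. The first clause transports Taylor coefficients, for
    iteration; the second pins the values on [V]. *)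
Definition cpartial (V : set cvec) i f g :=
  (forall z c, V z -> expansion f z c -> expansion g z (mderiv i c)) /\
  (forall z, V z -> deriv_at f i z (g z)).

(** An expansion is chosen at each point, and [g] is the value there of its derived series. The
    derived series at [z] also gives the derivatives at nearby points, so uniqueness of derivatives
    identifies its sum with [g]. *)
Lemma analytic_cpartial V f i : coord_open V -> analytic V f -> exists g, cpartial V i f g.
Proof.
move=> oV aV.
have [cf Hcf] : {cf : cvec -> mi -> Cplx R & forall z, V z -> expansion f z (cf z)}.
  apply: (@choice _ _ (fun z c => V z -> expansion f z c)) => z.
  by have [Vz|nVz] := pselect (V z); [have [c Hc] := aV z Vz; exists c | exists (fun=> 0)].
pose g z := mderiv i (cf z) mzero.
have gd z : V z -> deriv_at f i z (g z).
  move=> /Hcf /(expansion_deriv i) [C [M [d [_ _ d0 _ H]]]].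
  have [|v Hv] := H 0; first by move=> j; rewrite mxE modulus0.
  by rewrite addr0 (has_sum_uniq Hv (psum0 _)).
exists g; split=> // z c Vz /(expansion_deriv i) [C [M [d [C0 M0 d0 Hc H]]]].
have [d' d'0 oV'] := oV z Vz.
exists C, M, (Num.min d d'); split=> //; first by rewrite lt_min d0.
move=> w Hw; have [|v Hv Dv] := H w.
  by move=> j; apply: lt_le_trans (Hw j) _; rewrite ge_min lexx.
rewrite (_ : g (z + w) = v) //; apply: deriv_at_uniq Dv; apply: gd; apply: oV'.
by move=> j; apply: lt_le_trans (Hw j) _; rewrite ge_min lexx orbT.
Qed.

Lemma cpartial_analytic V i f g : analytic V f -> cpartial V i f g -> analytic V g.
Proof. by move=> aV [H _] z Vz; have [c Hc] := aV z Vz; exists (mderiv i c); exact: H. Qed.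

(* A property stable under partial derivatives which forces the value at z to be
   0 makes every Taylor coefficient at z vanish. *)
Lemma expansion_vanish (V : set cvec) (Q : (cvec -> Cplx R) -> Prop) z :
  coord_open V -> V z ->
  (forall f g i, analytic V f -> Q f -> cpartial V i f g -> Q g) ->
  (forall f, analytic V f -> Q f -> f z = 0) ->
  forall f, analytic V f -> Q f ->
    exists2 d : R, 0 < d & forall w, small_vec w d -> f (z + w) = 0.
Proof.
move=> oV Vz Qd Q0.
have key k : forall f c al, analytic V f -> Q f -> expansion f z c -> mdeg al = k -> c al = 0.
  elim: k => [|k IH] f c al af Qf Ef dal.
    by rewrite (mdeg_eq0 dal) (expansion_value Ef) Q0.
  have [|i hi] := @mdeg_gt0 al; first by rewrite dal.
  have [g Hg] := analytic_cpartial i oV af.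
  have dd : mdeg (mdecr i al) = k by apply: succn_inj; rewrite mdeg_decr.
  have := IH g (mderiv i c) (mdecr i al) (cpartial_analytic af Hg) (Qd _ _ _ af Qf Hg)
    (proj1 Hg _ _ Vz Ef) dd.
  rewrite /mderiv mdecrK // => /eqP; rewrite mulf_eq0 pnatr_eq0 /= => /eqP //.
move=> f af Qf; have [c Ef] := af z Vz; have [C [M [d [_ _ d0 _ H]]]] := Ef.
exists d => // w /H Hw; apply: has_sum_uniq Hw _ => e e0.
exists fset0 => A _; rewrite big1 ?subr0 ?modulus0 // => al _.
by rewrite (key _ _ _ _ af Qf Ef (erefl _)) mul0r.
Qed.

(** A complex partial derivative can be computed with real increments, so vanishing at real points
    near 0 is inherited. Halving [d] leaves room for the increment. *)
Lemma cpartial_real V f g i : cpartial V i f g ->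
  (exists2 d : R, 0 < d & forall x : 'rV[R]_n, (forall j, `|x 0 j| < d) ->
     V (toC x) /\ f (toC x) = 0) ->
  exists2 d : R, 0 < d & forall x : 'rV[R]_n, (forall j, `|x 0 j| < d) ->
     V (toC x) /\ g (toC x) = 0.
Proof.
move=> [_ Dg] [d d0 H]; exists (d / 2); first by lra.
move=> x Hx; have [Vx fx] : V (toC x) /\ f (toC x) = 0.
  by apply: H => j; apply: lt_trans (Hx j) _; lra.
split=> //; have [K [e [e0 He]]] := Dg _ Vx.
pose K' := `|K| + 1.
have K'0 : 0 < K' by rewrite ltr_wpDl.
apply/modulus_eq0/eqP; rewrite eq_le modulus_ge0 andbT.
apply/ler_addgt0Pr => r r0; rewrite add0r.
pose t := Num.min (Num.min e (d / 2)) (r / K').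
have t0 : 0 < t by rewrite !lt_min e0 !divr_gt0.
have tE : modulus (t%:C%C : Cplx R) = t by rewrite modulus_real ger0_norm // ltW.
have te : t <= e by rewrite !ge_min lexx.
have td : t <= d / 2 by rewrite !ge_min lexx orbT.
have tr : t * K' <= r by rewrite -ler_pdivlMr // !ge_min lexx !orbT.
have := He (t%:C)%C; rewrite tE => /(_ te).
have -> : toC x + (t%:C)%C *: 'e_i = toC (x + t *: 'e_i).
  apply/rowP => j; rewrite !mxE rmorphD rmorphM /=; congr (_ + _ * _).
  by rewrite rmorph_nat.
have [_ ->] : V (toC (x + t *: 'e_i)) /\ f (toC (x + t *: 'e_i)) = 0.
  apply: H => j; rewrite !mxE; apply: le_lt_trans (ler_normD _ _) _.
  have : `|t * (true && (j == i))%:R| <= d / 2.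
    by case: (j == i); rewrite /= ?mulr1 ?mulr0 ?normr0 ?ger0_norm //; lra.
  by have := Hx j; rewrite eqxx; lra.
rewrite fx subrr sub0r modulusN modulusM tE expr2 -mulrA ler_pM2l // => h.
apply: (le_trans h); apply: le_trans tr; rewrite ler_wpM2l ?ltW //.
by have := ler_norm K; rewrite /K'; lra.
Qed.

Lemma cpartial_near0 V f g i z (d : R) : coord_open V -> cpartial V i f g -> V z -> 0 < d ->
  (forall w, small_vec w d -> f (z + w) = 0) ->
  exists2 d : R, 0 < d & forall w, small_vec w d -> g (z + w) = 0.
Proof.
move=> oV [_ Dg] Vz d0 H; have [d' d'0 oz] := oV _ Vz.
exists (Num.min d' (d / 2)); first by rewrite lt_min d'0; lra.
move=> w Hw; have Vw : V (z + w).
  by apply: oz => j; apply: lt_le_trans (Hw j) _; rewrite ge_min lexx.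
have Hw' : small_vec w (d / 2).
  by move=> j; apply: lt_le_trans (Hw j) _; rewrite ge_min lexx orbT.
apply: deriv_at_uniq (Dg _ Vw) _; exists 0, (d / 2); split=> [|h Hh]; first by lra.
rewrite mulr0 subr0 -addrA !H ?subrr ?modulus0 ?mulr0 // => j; rewrite ?mxE; last first.
  by apply: lt_trans (Hw' j) _; lra.
apply: le_lt_trans (modulusD _ _) _; rewrite modulusM eqxx modulus_nat.
have := Hw' j; have := modulus_ge0 h.
by case: (j == i); rewrite /= ?mulr1 ?mulr0; lra.
Qed.

(** Continuity method on the segment from 0 to [z]. Near 0 the Taylor coefficients vanish because
    all partial derivatives vanish at real points. At the supremum [T] of the good parameters,
    vanishing near every earlier point is inherited by the partial derivatives, so by continuity all
    their values at [T z] are 0. Thus [f] vanishes near [T z], which goes beyond [T] unless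
    [T = 1]. *)
Lemma identity_principle V f : coord_open V ->
  (forall z (t : R), V z -> 0 <= t -> t <= 1 -> V ((t%:C)%C *: z)) ->
  analytic V f ->
  (exists2 d : R, 0 < d & forall x : 'rV[R]_n, (forall j, `|x 0 j| < d) -> f (toC x) = 0) ->
  forall z, V z -> f z = 0.
Proof.
move=> oV star af Hreal z Vz.
have V0 : V 0 by have := star z 0 Vz (lexx _) ler01; rewrite scale0r.
pose near0 t f := exists2 d : R, 0 < d & forall w, small_vec w d -> f ((t%:C)%C *: z + w) = 0.
have base : near0 0 f.
  rewrite /near0 scale0r.
  pose Q f := exists2 d : R, 0 < d & forall x : 'rV[R]_n, (forall j, `|x 0 j| < d) ->
     V (toC x) /\ f (toC x) = 0.
  apply: (@expansion_vanish V Q) => //.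
  - by move=> ? ? i _ Qf pf; exact: cpartial_real pf Qf.
  - move=> h _ [d d0 /(_ 0)]; rewrite (_ : toC 0 = 0).
      by case=> // j; rewrite mxE normr0.
    by apply/rowP => j; rewrite !mxE.
  have [d d0 Hd] := Hreal; have [d' d'0 oz] := oV _ V0.
  exists (Num.min d d'); first by rewrite lt_min d0.
  move=> x Hx; split; last first.
    by apply: Hd => j; apply: lt_le_trans (Hx j) _; rewrite ge_min lexx.
  rewrite -[toC x]add0r; apply: oz => j; rewrite mxE modulus_real.
  by apply: lt_le_trans (Hx j) _; rewrite ge_min lexx orbT.
pose E := [set t : R | 0 <= t <= 1 /\ forall s, 0 <= s <= t -> near0 s f].
have E0 : E 0.
  by split; [rewrite lexx ler01 | move=> s /le_anti <-].
have hE : has_sup E by split; [exists 0 | exists 1 => t [/andP[]]].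
pose T := sup E.
have T0 : 0 <= T by exact: sup_upper_bound.
have T1 : T <= 1 by apply: sup_le_ub; [exists 0 | move=> t [/andP[]]].
have below s : 0 <= s -> s < T -> near0 s f.
  move=> s0 sT; have Ts : 0 < T - s by lra.
  have [t [_ Ht] lt] := sup_adherent Ts hE; apply: Ht; rewrite s0 /=.
  by move: lt; rewrite -/T; lra.
have modz j : modulus (z 0 j) <= \sum_j modulus (z 0 j).
  by rewrite (bigD1 j) //= lerDl sumr_ge0 // => k _; exact: modulus_ge0.
pose L := \sum_j modulus (z 0 j) + 1.
have L0 : 0 < L by rewrite ltr_wpDl // sumr_ge0 // => j _; exact: modulus_ge0.
have close s t d : 0 < d -> `|s - t| * L <= d ->
    small_vec ((s%:C)%C *: z - (t%:C)%C *: z) d \/ s = t.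
  move=> d0 st; have [->|nst] := eqVneq s t; [by right | left => j].
  rewrite !mxE -mulrBl -rmorphB modulusM modulus_real; apply: lt_le_trans st.
  rewrite ltr_pM2l ?normr_gt0 ?subr_eq0 //.
  by apply: le_lt_trans (modz j) _; rewrite /L ltrDl.
have atT : near0 T f.
  have [T0'|Tpos] := eqVneq T 0; first by rewrite T0'.
  have Tgt : 0 < T by rewrite lt_def Tpos.
  pose Q f := forall s, 0 <= s -> s < T -> near0 s f.
  apply: (@expansion_vanish V Q) => //; first exact: star.
  - move=> h g i _ Qh pg s s0 sT; have [d d0 Hd] := Qh s s0 sT.
    by apply: cpartial_near0 pg _ d0 Hd => //; apply: star => //; lra.
  - move=> h ah Qh; apply/modulus_eq0/eqP; rewrite eq_le modulus_ge0 andbT.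
    apply/ler_addgt0Pr => e e0; rewrite add0r.
    have [c Ec] := ah _ (star z T Vz T0 T1).
    have [d d0 Hd] := expansion_continuous Ec e0.
    pose s := Num.max 0 (T - d / L).
    have dL : 0 < d / L by exact: divr_gt0.
    have s0 : 0 <= s by rewrite le_max lexx.
    have sT : s < T by rewrite gt_max Tgt; lra.
    have hs : `|s - T| * L <= d.
      have : T - d / L <= s by rewrite le_max lexx orbT.
      by rewrite -ler_pdivlMr // ler0_norm; lra.
    have [close1|] := close s T d d0 hs; last by lra.
    have := Hd _ close1; rewrite (addrC (_ *: z)) subrK.
    have [r r0 /(_ 0)] := Qh s s0 sT; rewrite addr0 => -> => [|j]; last by rewrite mxE modulus0.
    by rewrite sub0r modulusN => /ltW.
suff T1' : T = 1.
  have [d d0 /(_ 0)] := atT; rewrite T1' scale1r addr0; apply => j.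
  by rewrite mxE modulus0.
apply/eqP; rewrite eq_le T1 leNgt; apply/negP => Tlt.
have [d d0 Hd] := atT.
pose t := Num.min 1 (T + d / (2 * L)).
have dL : 0 < d / (2 * L) by rewrite divr_gt0 // mulr_gt0.
have Tt : T < t by rewrite lt_min Tlt; lra.
have tT : t <= T + d / (2 * L) by rewrite ge_min lexx orbT.
suff : E t by move=> /(sup_upper_bound hE); rewrite -/T; lra.
split; first by rewrite ge_min lexx; lra.
move=> s /andP[s0 st]; have [sT|Ts] := ltP s T; first exact: below.
exists (d / 2); first by lra.
move=> w Hw; rewrite (_ : _ + w = (T%:C)%C *: z + ((s%:C)%C *: z - (T%:C)%C *: z + w)); last first.
  by rewrite addrA [_ + (_ - _)]addrC subrK.
apply: Hd => j; rewrite mxE; apply: le_lt_trans (modulusD _ _) _.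
have d20 : 0 < d / 2 by lra.
have hs : `|s - T| * L <= d / 2.
  rewrite ger0_norm ?subr_ge0 //; have : s - T <= d / (2 * L) by lra.
  by rewrite ler_pdivlMr ?mulr_gt0 //; lra.
have [h|->] := close s T (d / 2) d20 hs.
  by have := h j; have := Hw j; lra.
by rewrite subrr mxE modulus0; have := Hw j; lra.
Qed.

End Expansions.

(** * Potentials of powers of a quadratic kernel *)

Section QuadraticDivision.
Variables (R : realType) (n : nat).
Local Notation mi := {ffun 'I_n -> nat}.
Implicit Types (al : mi) (w : 'rV[Cplx R]_n).

Lemma psum_shift i (b : mi -> Cplx R) w v : psum b w v ->
  psum (fun al => if (0 < al i)%N then b (mdecr i al) else 0) w (w 0 i * v).
Proof.
move=> /(has_sumZ (w 0 i)) H; apply: (has_sum_reindex (s := mincr i) (t := mdecr i)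
  (P := fun al => (0 < al i)%N)).
- exact: mincrK.
- by move=> al; rewrite ffunE eqxx addn1.
- by move=> al; exact: mdecrK.
- by move=> al /negPf ->; rewrite mul0r.
apply: eq_has_sum H => al /=; rewrite mincrK !(cmonoE _ _ i) !ffunE eqxx addn1 /= exprS.
rewrite (eq_bigr (fun j => w 0 j ^+ (mincr i al) j)); last first.
  by move=> j /negPf ji; rewrite ffunE ji addn0.
by ring.
Qed.

(* Quotient of the power series c by [q + \sum_i l i * w_i + \sum_i w_i ^+ 2];
   the first argument is fuel bounding the degree. *)
Fixpoint quad_div_rec (k : nat) (q : Cplx R) (l : 'I_n -> Cplx R) (c : mi -> Cplx R) al :=
  if k is k'.+1 then
    (c al - \sum_i (if (0 < al i)%N then l i * quad_div_rec k' q l c (mdecr i al) else 0)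
          - \sum_i (if (0 < al i)%N then
                      if (0 < mdecr i al i)%N then
                         quad_div_rec k' q l c (mdecr i (mdecr i al)) else 0
                    else 0)) / q
  else 0.

Definition quad_div q l c al := quad_div_rec (mdeg al).+1 q l c al.

Lemma quad_div_rec_fuel q l c k al : (mdeg al < k)%N ->
  quad_div_rec k q l c al = quad_div q l c al.
Proof.
suff H : forall k k' al, (mdeg al < k)%N -> (mdeg al < k')%N ->
   quad_div_rec k q l c al = quad_div_rec k' q l c al by move=> h; apply: H.
elim=> [//|{}k IH] [//|k'] {}al; rewrite !ltnS => hk hk' /=.
congr (_ / _); congr (_ - _ - _); apply: eq_bigr => i _.
  case: ifP => // hi; have d1 := mdeg_decr hi; congr (_ * _); apply: IH; rewrite d1 //.
case: ifP => // hi; case: ifP => // hi'.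
have d1 := mdeg_decr hi; have d2 := mdeg_decr hi'.
by apply: IH; lia.
Qed.

Lemma quad_divE q l c al : q != 0 ->
  q * quad_div q l c al
  + \sum_i (if (0 < al i)%N then l i * quad_div q l c (mdecr i al) else 0)
  + \sum_i (if (0 < al i)%N then
              if (0 < mdecr i al i)%N then quad_div q l c (mdecr i (mdecr i al)) else 0
            else 0) = c al.
Proof.
move=> q0; rewrite {1}/quad_div /= mulrC divfK //.
rewrite (eq_bigr (fun i => if (0 < al i)%N then l i * quad_div q l c (mdecr i al) else 0)).
  rewrite [X in _ - _ - X](eq_bigr (fun i => if (0 < al i)%N then
              if (0 < mdecr i al i)%N then quad_div q l c (mdecr i (mdecr i al)) else 0
            else 0)); first by ring.
  move=> i _; case: ifP => // hi; case: ifP => // hi'.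
  rewrite quad_div_rec_fuel //.
  by have := mdeg_decr hi; have := mdeg_decr hi'; lia.
move=> i _; case: ifP => // hi; rewrite quad_div_rec_fuel //.
by have := mdeg_decr hi; lia.
Qed.

(** The divisor is a polynomial, so multiplying back amounts to linear combinations and coordinate
    shifts of one convergent series. *)
Lemma psum_quad_div q l c w v v' : q != 0 -> psum c w v -> psum (quad_div q l c) w v' ->
  (q + \sum_i l i * w 0 i + \sum_i w 0 i ^+ 2) * v' = v.
Proof.
move=> q0 Hv Hv'; apply: has_sum_uniq Hv.
have S1 := has_sum_sum (fun i => has_sumZ (l i) (psum_shift i Hv')).
have S2 := has_sum_sum (fun i => psum_shift i (psum_shift i Hv')).
have S := has_sumD (has_sumD (has_sumZ q Hv') S1) S2.
have -> : (q + \sum_i l i * w 0 i + \sum_i w 0 i ^+ 2) * v' =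
   q * v' + \sum_i l i * (w 0 i * v') + \sum_i w 0 i * (w 0 i * v').
  rewrite !mulrDl !mulr_suml; congr (_ + _ + _); apply: eq_bigr => i _; ring.
apply: eq_has_sum S => al; rewrite -(quad_divE l c al q0) !mulrDl !mulr_suml.
congr (_ + _ + _); first by rewrite mulrA.
by apply: eq_bigr => i _; case: ifP => _; [rewrite mulrA | rewrite mul0r mulr0].
Qed.

(** Induction on the degree: the recursion feeds back at most [n (L + 1)] times the bound one degree
    lower, and the condition on [M] makes this at most half of what is allowed. The other half is
    the contribution of [c], whence the factor 2. *)
Lemma quad_div_bound q l c (C M L d : R) : 0 <= C -> 0 <= L -> 0 < d -> d <= modulus q ->
  (forall i, modulus (l i) <= L) -> 1 <= M -> 2 * (n%:R * (L + 1)) <= d * M ->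
  coef_bound c C M -> coef_bound (quad_div q l c) (2 * C / d) M.
Proof.
move=> C0 L0 d0 dq Hl M1 HM Hc al.
have M0 : 0 < M by lra.
have q0 : q != 0.
  by apply/eqP => h; move: dq; rewrite h modulus0; lra.
have [k hk] := ubnP (mdeg al); elim: k al hk => [//|k IH] al; rewrite ltnS => hk.
have C'0 : 0 <= 2 * C / d by rewrite divr_ge0 ?mulr_ge0 // ltW.
set C' := 2 * C / d in IH C'0 *.
suff H : d * modulus (quad_div q l c al) <= (C + C' * d / 2) * M ^+ mdeg al.
  rewrite -(ler_pM2l d0); apply: (le_trans H).
  by rewrite le_eqVlt /C'; apply/orP; left; apply/eqP; field; rewrite gt_eqF.
apply: (@le_trans _ _ (modulus (q * quad_div q l c al))).
  by rewrite modulusM; apply: ler_wpM2r => //; exact: modulus_ge0.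
have := quad_divE l c al q0.
set S2 := \sum_i _; set S1 := \sum_i _ => E.
have -> : q * quad_div q l c al = c al + - S1 + - S2 by rewrite -E; ring.
have h1 := modulusD (c al + - S1) (- S2); have h2 := modulusD (c al) (- S1).
rewrite modulusN in h1; rewrite modulusN in h2.
have Mk0 j : 0 <= M ^+ j by rewrite exprn_ge0 // ltW.
pose T := C' * M ^+ mdeg al / M.
have T0 : 0 <= T by apply: divr_ge0; [exact: mulr_ge0 | exact: ltW].
have h3 : modulus S1 <= n%:R * (L * T).
  apply: (le_trans (modulus_sum _ _ _)).
  apply: (@le_trans _ _ (\sum_(i < n) L * T)); last by rewrite sumr_const card_ord mulr_natl.
  apply: ler_sum => i _; case: ifP => hi; last by rewrite modulus0 mulr_ge0.
  have dd := mdeg_decr hi.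
  rewrite modulusM; apply: ler_pM => //; try exact: modulus_ge0.
  apply: (le_trans (IH _ _)); first by lia.
  by rewrite /T -dd exprS le_eqVlt; apply/orP; left; apply/eqP; field; rewrite gt_eqF.
have h4 : modulus S2 <= n%:R * T.
  apply: (le_trans (modulus_sum _ _ _)).
  apply: (@le_trans _ _ (\sum_(i < n) T)); last by rewrite sumr_const card_ord mulr_natl.
  apply: ler_sum => i _; case: ifP => hi; last by rewrite modulus0.
  case: ifP => hi'; last by rewrite modulus0.
  have dd := mdeg_decr hi; have dd' := mdeg_decr hi'.
  apply: (le_trans (IH _ _)); first by lia.
  have -> : T = C' * (M * M ^+ mdeg (mdecr i (mdecr i al))).
    by rewrite /T -dd -dd' !exprS; field; rewrite gt_eqF.
  by apply: ler_wpM2l => //; rewrite ler_peMl.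
have h5 : n%:R * (L + 1) * T <= C' * d / 2 * M ^+ mdeg al.
  rewrite /T mulrA ler_pdivrMr //.
  have := ler_wpM2l (mulr_ge0 C'0 (Mk0 (mdeg al))) HM; lra.
by have := Hc al; lra.
Qed.

End QuadraticDivision.

Section KernelPotential.
Variables (R : realType) (n : nat) (T : Type) (S : set T).
Variables (p : T -> 'I_n -> Cplx R) (q : T -> Cplx R).
Local Notation mi := {ffun 'I_n -> nat}.
Local Notation cvec := 'rV[Cplx R]_n.

Definition kernel_quad (z : cvec) (y : T) : Cplx R := \sum_i (z 0 i - p y i) ^+ 2 + q y.

(* Asking for the whole segment [0, z] makes the domain star-shaped. *)
Definition kernel_domain : set cvec := [set z | exists2 d : R, 0 < d &
  forall (t : R) y, 0 <= t -> t <= 1 -> S y ->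
    d <= modulus (kernel_quad ((t%:C)%C *: z) y)].

(** Linearity is asked only for integrands bounded on [S], because the mean that will be used is a
    limit known to exist only for bounded functions. *)
Definition bounded_functional (J : (T -> Cplx R) -> Cplx R) (K : R) :=
  (forall k1 k2 (a : Cplx R),
     (exists C : R, forall y, S y -> modulus (k1 y) <= C) ->
     (exists C : R, forall y, S y -> modulus (k2 y) <= C) ->
     J (fun y => k1 y + a * k2 y) = J k1 + a * J k2) /\
  (forall k (C : R), (forall y, S y -> modulus (k y) <= C) -> modulus (J k) <= K * C).

Variables (J : (T -> Cplx R) -> Cplx R) (K : R).
Hypothesis HJ : bounded_functional J K.
Hypothesis K0 : 0 <= K.
Hypothesis Hp : forall y i, S y -> modulus (p y i) <= 1.

Lemma functional_sum (I : Type) (s : seq I) (k : I -> T -> Cplx R) (a : I -> Cplx R) :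
  (forall i, exists C : R, forall y, S y -> modulus (k i y) <= C) ->
  J (fun y => \sum_(i <- s) k i y * a i) = \sum_(i <- s) J (k i) * a i.
Proof.
move=> Hk; have Hs (s' : seq I) :
    exists C : R, forall y, S y -> modulus (\sum_(i <- s') k i y * a i) <= C.
  elim: s' => [|i s' [C HC]]; first by exists 0 => y _; rewrite big_nil modulus0.
  have [Ci HCi] := Hk i; exists (Ci * modulus (a i) + C) => y Sy.
  rewrite big_cons; apply: (le_trans (modulusD _ _)); rewrite modulusM.
  by apply: lerD (HC _ Sy); apply: ler_wpM2r (HCi _ Sy); exact: modulus_ge0.
elim: s => [|i s IH].
  rewrite big_nil; apply/modulus_eq0/eqP; rewrite eq_le modulus_ge0 andbT.
  rewrite -(mulr0 K); apply: (proj2 HJ) => y _.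
  by rewrite big_nil modulus0.
rewrite big_cons -IH addrC mulrC -(proj1 HJ) //.
by congr J; apply/funext => y; rewrite big_cons addrC mulrC.
Qed.

(** The bounds on [b y] are uniform in [y], so one numerical geometric series dominates all the
    expansions. A finite partial sum then approximates [f (z + w)] uniformly on [S], and boundedness
    of [J] exchanges it with the sum. *)
Lemma functional_expansion (f : cvec -> T -> Cplx R) z (b : T -> mi -> Cplx R) (C M d : R) :
  0 <= C -> 0 <= M -> 0 < d ->
  (forall y, S y -> coef_bound (b y) C M) ->
  (forall w y, S y -> small_vec w d -> psum (b y) w (f (z + w) y)) ->
  expansion (fun z => J (f z)) z (fun al => J (fun y => b y al)).
Proof.
move=> C0 M0 d0 Hb Hf; have M10 : 0 < M + 1 by lra.
pose d' := Num.min d (2 * (M + 1))^-1.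
have d'0 : 0 < d' by rewrite lt_min d0 invr_gt0 mulr_gt0.
have d'M : M * d' < 1.
  have : d' <= (2 * (M + 1))^-1 by rewrite ge_min lexx orbT.
  by rewrite -[X in _ <= X]mul1r ler_pdivlMr ?mulr_gt0 //; nra.
exists (K * C), M, d'; split=> //; first exact: mulr_ge0.
  by move=> al; rewrite -mulrA; apply: (proj2 HJ) => y Sy; exact: Hb.
move=> w Hw e e0.
have Md0 : 0 <= M * d' by rewrite mulr_ge0 // ltW.
pose m (al : mi) : R := C * (M * d') ^+ mdeg al.
have m0 al : 0 <= m al by rewrite mulr_ge0 // exprn_ge0.
have [||||v Hv _] := @geometric_has_sum R n (fun al => ((m al)%:C)%C) C (M * d') => //.
  by move=> al; rewrite modulus_real ger0_norm.
have K10 : 0 < K + 1 by rewrite ltr_wpDl.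
pose e' := e / (K + 1) / 4.
have e'0 : 0 < e' by rewrite !divr_gt0.
have [A0 HA0] := Hv _ e'0.
(* Both finite sums of the majorant are within [e'] of its total, so what lies between them is at
   most [2 * e']. *)
have tail (A B : {fset mi}) : (A0 `<=` A)%fset -> (A `<=` B)%fset ->
    \sum_(al <- [fset al in B | al \notin A]%fset) m al <= 2 * e'.
  move=> sA AB; have h1 := HA0 A sA; have h2 := HA0 B (fsubset_trans sA AB).
  have : modulus (\sum_(al <- B) ((m al)%:C)%C - \sum_(al <- A) ((m al)%:C)%C) <= 2 * e'.
    have -> : \sum_(al <- B) ((m al)%:C)%C - \sum_(al <- A) ((m al)%:C)%C =
      (\sum_(al <- B) ((m al)%:C)%C - v) + (v - \sum_(al <- A) ((m al)%:C)%C) by ring.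
    by apply: (le_trans (modulusD _ _)); rewrite (modulusB v); lra.
  rewrite [X in modulus (X - _)](big_fsetID _ (mem A)) /=.
  rewrite (_ : [fset x in B | x \in A]%fset = A).
    rewrite [X in modulus X]addrC addKr -rmorph_sum modulus_real ger0_norm ?sumr_ge0 //.
  apply/fsetP => x; rewrite !inE /= andbC.
  by case xA: (x \in A) => //=; apply: (fsubsetP AB).
exists A0 => A sA.
pose g y := \sum_(al <- A) b y al * cmono al w.
have wd al : modulus (cmono al w) <= d' ^+ mdeg al.
  by apply: modulus_cmono => i; exact: ltW.
have bm y al : S y -> modulus (b y al * cmono al w) <= m al.
  move=> Sy; rewrite modulusM /m exprMn mulrA; apply: ler_pM => //; try exact: modulus_ge0.
  exact: Hb.
have bb al : exists C' : R, forall y, S y -> modulus (b y al) <= C'.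
  by exists (C * M ^+ mdeg al) => y Sy; exact: Hb.
(* The index set [A1] that makes the expansion accurate depends on [y]; its surplus over [A] is paid
   for by the uniform tail. *)
have close y : S y -> modulus (g y - f (z + w) y) <= 3 * e'.
  move=> Sy; have Hw' : small_vec w d.
    by move=> i; apply: lt_le_trans (Hw i) _; rewrite ge_min lexx.
  have [A1 HA1] := Hf w y Sy Hw' _ e'0.
  have := HA1 _ (fsubsetUr A A1).
  rewrite (big_fsetID _ (mem A)) /= (_ : [fset x in (A `|` A1)%fset | x \in A]%fset = A); last first.
    by apply/fsetP => x; rewrite !inE /=; case: (x \in A); rewrite ?andbF ?andbT ?orbT.
  rewrite -/(g y); set r := \sum_(_ <- _) _ => h1.
  have h2 : modulus r <= 2 * e'.
    apply: (le_trans (modulus_sum _ _ _)); apply: le_trans (tail A _ sA (fsubsetUl A A1)).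
    by apply: ler_sum => al _; exact: bm.
  have -> : g y - f (z + w) y = (g y + r - f (z + w) y) + - r by ring.
  by apply: (le_trans (modulusD _ _)); rewrite modulusN; lra.
have gb : exists C' : R, forall y, S y -> modulus (g y) <= C'.
  exists (\sum_(al <- A) m al) => y Sy; apply: (le_trans (modulus_sum _ _ _)).
  by apply: ler_sum => al _; exact: bm.
have fb : exists C' : R, forall y, S y -> modulus (f (z + w) y) <= C'.
  have [C' HC'] := gb; exists (C' + 3 * e') => y Sy.
  have -> : f (z + w) y = g y + (f (z + w) y - g y) by ring.
  by apply: (le_trans (modulusD _ _)); rewrite (modulusB (f _ _)); apply: lerD (HC' _ Sy) (close _ Sy).
rewrite -functional_sum // -[J (f _)]mul1r -mulNr -(proj1 HJ) //.
apply: (@le_lt_trans _ _ (K * (3 * e'))).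
  by apply: (proj2 HJ) => y Sy; rewrite mulN1r; exact: close.
rewrite /e'; have : e / (K + 1) * (K + 1) = e by rewrite divfK // gt_eqF.
have : 0 < e / (K + 1) by exact: divr_gt0.
nra.
Qed.

Lemma kernel_domain_star z (t : R) :
  kernel_domain z -> 0 <= t -> t <= 1 -> kernel_domain ((t%:C)%C *: z).
Proof.
move=> [d d0 H] t0 t1; exists d => // s y s0 s1 Sy.
rewrite scalerA -rmorphM; apply: H => //; first exact: mulr_ge0.
by rewrite -[leRHS]mulr1; apply: ler_pM.
Qed.

Lemma kernel_quadD z w y : kernel_quad (z + w) y =
  kernel_quad z y + \sum_i (2 * (z 0 i - p y i)) * w 0 i + \sum_i w 0 i ^+ 2.
Proof.
rewrite /kernel_quad; have -> : \sum_i ((z + w) 0 i - p y i) ^+ 2 =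
    \sum_i (z 0 i - p y i) ^+ 2 + \sum_i (2 * (z 0 i - p y i)) * w 0 i + \sum_i w 0 i ^+ 2.
  by rewrite -!big_split; apply: eq_bigr => i _ /=; rewrite mxE; ring.
by ring.
Qed.

(** The kernel varies by at most [e * L] when the coordinates of [z] move by less than [e <= 1],
    uniformly in the segment parameter and in [y], because the entries of [p y] are bounded by 1. *)
Lemma kernel_domain_open : coord_open kernel_domain.
Proof.
move=> z [d d0 H].
pose Z := \sum_i modulus (z 0 i).
have Z0 : 0 <= Z by apply: sumr_ge0 => i _; exact: modulus_ge0.
have zZ i : modulus (z 0 i) <= Z.
  by rewrite /Z (bigD1 i) //= lerDl sumr_ge0 // => j _; exact: modulus_ge0.
pose L := n%:R * (2 * (Z + 1) + 1) + 1.
have nL : 0 <= n%:R * (2 * (Z + 1) + 1) :> R by rewrite mulr_ge0 //; lra.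
have L0 : 0 < L by rewrite /L; lra.
pose e := Num.min 1 (d / 2 / L).
have e0 : 0 < e by rewrite lt_min ltr01 !divr_gt0.
have e1 : e <= 1 by rewrite ge_min lexx.
have eL : e * L <= d / 2 by rewrite -ler_pdivlMr // ge_min lexx orbT.
exists e => // w Hw; exists (d / 2); first by lra.
move=> t y t0 t1 Sy; have := H t y t0 t1 Sy.
rewrite scalerDr kernel_quadD -addrA; set Q := kernel_quad _ y; set s := \sum_i _ + \sum_i _.
have hs : modulus s <= e * L.
  rewrite /s -big_split /=; apply: (le_trans (modulus_sum _ _ _)).
  apply: (@le_trans _ _ (\sum_(i < n) e * (2 * (Z + 1) + 1))).
    apply: ler_sum => i _; rewrite !mxE.
    have tE : modulus (t%:C)%C = t by rewrite modulus_real ger0_norm.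
    have h1 : modulus ((t%:C)%C * w 0 i) <= e.
      by rewrite modulusM tE; have := Hw i; have := modulus_ge0 (w 0 i); nra.
    have h2 : modulus ((t%:C)%C * z 0 i) <= Z.
      by rewrite modulusM tE; have := zZ i; have := modulus_ge0 (z 0 i); nra.
    have h3 := Hp i Sy.
    set a := (t%:C)%C * w 0 i in h1 *; set b := (t%:C)%C * z 0 i in h2 *.
    have -> : 2 * (b - p y i) * a + a ^+ 2 = a * (2 * (b - p y i) + a) by ring.
    rewrite modulusM; apply: ler_pM => //; try exact: modulus_ge0.
    apply: (le_trans (modulusD _ _)); rewrite modulusM (modulus_nat R 2).
    by have := modulusD b (- p y i); rewrite modulusN; lra.
  rewrite sumr_const card_ord (_ : _ *+ n = e * (L - 1)); last first.
    by rewrite -mulr_natl /L; ring.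
  by rewrite ler_pM2l //; lra.
have := modulusD (Q + s) (- s); rewrite addrK modulusN; lra.
Qed.

(** Dividing the constant series 1 by the quadratic polynomial [l] times gives the expansion of the
    [l]-th inverse power of the kernel, with coefficient bounds uniform over [S]. *)
Lemma kernel_potential_analytic l :
  analytic kernel_domain (fun z => J (fun y => (kernel_quad z y)^-1 ^+ l)).
Proof.
move=> z [d d0 H].
pose Z := \sum_i modulus (z 0 i).
have Z0 : 0 <= Z by apply: sumr_ge0 => i _; exact: modulus_ge0.
have zZ i : modulus (z 0 i) <= Z.
  by rewrite /Z (bigD1 i) //= lerDl sumr_ge0 // => j _; exact: modulus_ge0.
pose L := 2 * (Z + 1); have L0 : 0 <= L by rewrite /L; lra.
pose M := 1 + 2 * (n%:R * (L + 1)) / d.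
have nL : 0 <= 2 * (n%:R * (L + 1)) by rewrite mulr_ge0 // mulr_ge0 //; lra.
have M1 : 1 <= M by rewrite /M lerDl divr_ge0 // ltW.
have HM : 2 * (n%:R * (L + 1)) <= d * M.
  have -> : d * M = d + 2 * (n%:R * (L + 1)) by rewrite /M; field; rewrite gt_eqF.
  by lra.
pose lin y i : Cplx R := 2 * (z 0 i - p y i).
pose c0 : mi -> Cplx R := fun al => if al == mzero n then 1 else 0.
pose b l y := iter l (quad_div (kernel_quad z y) (lin y)) c0.
have qd y : S y -> d <= modulus (kernel_quad z y).
  by move=> Sy; have := H 1 y ler01 (lexx _) Sy; rewrite scale1r.
have q0 y : S y -> kernel_quad z y != 0.
  by move=> /qd h; apply/eqP => h0; move: h; rewrite h0 modulus0; lra.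
have C0 k : 0 <= (2 / d) ^+ k by rewrite exprn_ge0 // divr_ge0 // ltW.
have bound k y : S y -> coef_bound (b k y) ((2 / d) ^+ k) M.
  move=> Sy; elim: k => [|k IH].
    move=> al; rewrite /b /= /c0 expr0 mul1r.
    case: eqP => _; rewrite ?modulus1 ?modulus0; first by rewrite exprn_ege1.
    by rewrite exprn_ge0 //; lra.
  have -> : (2 / d) ^+ k.+1 = 2 * (2 / d) ^+ k / d by rewrite exprS; ring.
  apply: (quad_div_bound (L := L)) => //; first exact: qd.
  move=> i; rewrite /lin modulusM (modulus_nat R 2) /L ler_pM2l //.
  apply: (le_trans (modulusD _ _)); rewrite modulusN; apply: lerD (zZ i) (Hp i Sy).
pose r := (2 * M)^-1.
have M0 : 0 < M by lra.
have r0 : 0 < r by rewrite invr_gt0 mulr_gt0.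
have Mr : M * r < 1.
  by rewrite /r invfM mulrCA divff ?gt_eqF // mulr1; lra.
exists (fun al => J (fun y => b l y al)).
apply: (@functional_expansion (fun z y => (kernel_quad z y)^-1 ^+ l) z (b l)
  _ M r (C0 l) (ltW M0) r0 (fun y Sy => bound l y Sy)).
move=> w y Sy Hw.
have ex k : exists v, psum (b k y) w v.
  by apply: (psum_exists (C0 k) (ltW M0) (ltW r0) Mr (bound k y Sy)) => i; exact: ltW.
have step k v v' : psum (b k y) w v -> psum (b k.+1 y) w v' -> kernel_quad (z + w) y * v' = v.
  by move=> Hv Hv'; rewrite kernel_quadD; exact: (psum_quad_div (q0 y Sy) Hv Hv').
have base : psum (b 0%N y) w 1.
  apply: eq_has_sum (has_sum_delta (mzero n) 1) => al; rewrite /b /= /c0.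
  by case: eqP => [->|_]; rewrite ?mul0r // cmono_mzero mul1r.
(* The quotient series of 1 by the kernel converges at [w], and its product with the kernel is 1; so
   the kernel has no zero there. *)
have D0 : kernel_quad (z + w) y != 0.
  have [v Hv] := ex 1%N; apply/eqP => D0.
  by have := step 0%N _ _ base Hv; rewrite D0 mul0r => /eqP; rewrite eq_sym oner_eq0.
elim: l => [|k IH]; first by rewrite expr0.
have [v Hv] := ex k.+1; have := step _ _ _ IH Hv => E.
by rewrite exprS -E mulKf.
Qed.

End KernelPotential.

(** * A translation invariant functional *)

Section GridFunctional.
Variables (R : realType) (N : nat).
Local Notation rvec := 'rV[R]_N.
Implicit Types (H : rvec -> R) (y : rvec).

(** In each coordinate these are points of spacing [1 / (m + 1)] filling [[-3, 3[]. A function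
    supported in the unit cube and shifted by at most 1 stays supported well inside, so the edge of
    the grid is never felt. *)
Definition grid_index m := {ffun 'I_N -> 'I_(6 * m.+1)}.

Definition grid_point m (j : grid_index m) : rvec :=
  \row_i ((j i)%:R / m.+1%:R - 3).

Definition grid_sum m H : R := (\sum_(j : grid_index m) H (grid_point j)) / m.+1%:R ^+ N.

Definition grid_filter : set_system nat :=
  sval (cid (@ultraFilterLemma nat eventually _)).

Lemma grid_filter_ultra : UltraFilter grid_filter.
Proof. by rewrite /grid_filter; case: cid => F []. Qed.

Lemma grid_filterS : eventually `<=` grid_filter.
Proof. by rewrite /grid_filter; case: cid => F []. Qed.

#[local] Existing Instance grid_filter_ultra.

(* A translation invariant mean standing in for the Lebesgue integral over
   [-3, 3]^N: the limit of Riemann sums along an ultrafilter exists for every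
   bounded function. For an unbounded function [lim] is a junk value. *)
Definition grid_int H : R := lim (grid_sum ^~ H @ grid_filter).

Definition bounded_fun H := exists C : R, forall y, `|H y| <= C.

Let Np m : 0 < (m.+1%:R : R) ^+ N. Proof. by rewrite exprn_gt0. Qed.

Lemma grid_sum_le m H (C : R) : (forall y, `|H y| <= C) -> `|grid_sum m H| <= 6 ^+ N * C.
Proof.
move=> HC; rewrite /grid_sum normrM normfV (ger0_norm (ltW (Np m))) ler_pdivrMr //.
apply: (le_trans (ler_norm_sum _ _ _)); apply: (le_trans (ler_sum _ (fun j _ => HC _))).
rewrite sumr_const card_ffun !card_ord -[C *+ _]mulr_natl natrX natrM exprMn.
by rewrite le_eqVlt; apply/orP; left; apply/eqP; ring.
Qed.

(** The image of an ultrafilter is an ultrafilter, and one that contains a compact segment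
    converges. *)
Lemma grid_int_cvg H : bounded_fun H -> grid_sum ^~ H @ grid_filter --> grid_int H.
Proof.
move=> [C HC]; pose B := 6 ^+ N * C.
have HB m : `[- B, B]%classic (grid_sum m H).
  by rewrite /= in_itv /= -ler_norml; exact: grid_sum_le.
have UF : UltraFilter (grid_sum ^~ H @ grid_filter).
  apply: Build_UltraFilter => G PG sG; apply/seteqP; split=> // A GA.
  have [//|h] := in_ultra_setVsetC ((grid_sum ^~ H) @^-1` A) grid_filter_ultra.
  have GnA : G (~` A) by apply: sG.
  by have := filter_not_empty G; case; rewrite -(setICr A); exact: filterI.
have := @segment_compact R (- B) B; rewrite compact_ultra => /(_ _ UF).
case; first by apply: (@filterE _ grid_filter) => m; exact: HB.
by move=> l [_ Hl]; rewrite /grid_int (cvg_lim _ Hl).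
Qed.

Lemma grid_int_uniq H l : bounded_fun H ->
  grid_sum ^~ H @ grid_filter --> l -> grid_int H = l.
Proof. by move=> bH Hl; exact: cvg_lim Hl. Qed.

Lemma bounded_funD H1 H2 : bounded_fun H1 -> bounded_fun H2 ->
  bounded_fun (fun y => H1 y + H2 y).
Proof.
move=> [C1 h1] [C2 h2]; exists (C1 + C2) => y.
by apply: (le_trans (ler_normD _ _)); exact: lerD.
Qed.

Lemma bounded_funM H1 H2 : bounded_fun H1 -> bounded_fun H2 ->
  bounded_fun (fun y => H1 y * H2 y).
Proof.
by move=> [C1 h1] [C2 h2]; exists (C1 * C2) => y; rewrite normrM ler_pM.
Qed.

Lemma bounded_fun_cst (a : R) : bounded_fun (fun=> a).
Proof. by exists `|a|. Qed.

Lemma bounded_funZ (a : R) H : bounded_fun H -> bounded_fun (fun y => a * H y).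
Proof. by apply: bounded_funM; exact: bounded_fun_cst. Qed.

Lemma grid_intD H1 H2 : bounded_fun H1 -> bounded_fun H2 ->
  grid_int (fun y => H1 y + H2 y) = grid_int H1 + grid_int H2.
Proof.
move=> h1 h2; apply: grid_int_uniq; first exact: bounded_funD.
have -> : grid_sum ^~ (fun y => H1 y + H2 y) = (grid_sum ^~ H1) \+ (grid_sum ^~ H2).
  by apply/funext => m; rewrite /grid_sum big_split /= mulrDl.
by apply: cvgD; exact: grid_int_cvg.
Qed.

Lemma grid_intZ (a : R) H : bounded_fun H ->
  grid_int (fun y => a * H y) = a * grid_int H.
Proof.
move=> h; apply: grid_int_uniq; first exact: bounded_funZ.
have -> : grid_sum ^~ (fun y => a * H y) = (fun m => a * grid_sum m H).
  by apply/funext => m; rewrite /grid_sum -mulr_sumr mulrA.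
by apply: cvgMr; exact: grid_int_cvg.
Qed.

Lemma bounded_funN H : bounded_fun H -> bounded_fun (fun y => - H y).
Proof. by move=> [C HC]; exists C => y; rewrite normrN. Qed.

Lemma grid_sumN m H : grid_sum m (fun y => - H y) = - grid_sum m H.
Proof. by rewrite /grid_sum sumrN mulNr. Qed.

Lemma grid_intN H : bounded_fun H -> grid_int (fun y => - H y) = - grid_int H.
Proof.
move=> h; rewrite -mulN1r -grid_intZ //.
by congr grid_int; apply/funext => y; rewrite mulN1r.
Qed.

Lemma bounded_funB H1 H2 : bounded_fun H1 -> bounded_fun H2 ->
  bounded_fun (fun y => H1 y - H2 y).
Proof. by move=> h1 h2; apply: bounded_funD => //; exact: bounded_funN. Qed.

Lemma grid_intB H1 H2 : bounded_fun H1 -> bounded_fun H2 ->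
  grid_int (fun y => H1 y - H2 y) = grid_int H1 - grid_int H2.
Proof.
by move=> h1 h2; rewrite -grid_intN // -grid_intD //; exact: bounded_funN.
Qed.

Lemma grid_int_sum (I : Type) (s : seq I) (F : I -> rvec -> R) :
  (forall i, bounded_fun (F i)) ->
  bounded_fun (fun y => \sum_(i <- s) F i y) /\
  grid_int (fun y => \sum_(i <- s) F i y) = \sum_(i <- s) grid_int (F i).
Proof.
move=> bF; elim: s => [|i s [b IH]].
  split; first by exists 0 => y; rewrite big_nil normr0.
  rewrite big_nil -[RHS](mul0r (grid_int (fun=> 0))) -grid_intZ; last exact: bounded_fun_cst.
  by congr grid_int; apply/funext => y; rewrite big_nil mulr0.
have E : (fun y => \sum_(j <- i :: s) F j y) = (fun y => F i y + \sum_(j <- s) F j y).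
  by apply/funext => y; rewrite big_cons.
by rewrite E big_cons -IH grid_intD //; split=> //; exact: bounded_funD.
Qed.

Lemma grid_int_ge_near (C : R) H : bounded_fun H ->
  (\forall m \near \oo, C <= grid_sum m H) -> C <= grid_int H.
Proof.
move=> bH h; apply: (limr_ge (F := grid_filter)).
  by apply/cvg_ex; exists (grid_int H); exact: grid_int_cvg.
exact: grid_filterS.
Qed.

Lemma grid_int_norm_near (C : R) H : bounded_fun H ->
  (\forall m \near \oo, `|grid_sum m H| <= C) -> `|grid_int H| <= C.
Proof.
move=> bH h; rewrite ler_norml; apply/andP; split.
  by apply: grid_int_ge_near => //; apply: filterS h => m; rewrite ler_norml => /andP[].
rewrite -lerN2 -grid_intN //; apply: grid_int_ge_near; first exact: bounded_funN.
by apply: filterS h => m; rewrite ler_norml grid_sumN lerN2 => /andP[].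
Qed.

Lemma grid_int_norm H (C : R) : (forall y, `|H y| <= C) -> `|grid_int H| <= 6 ^+ N * C.
Proof.
move=> HC; apply: grid_int_norm_near; first by exists C.
by apply: nearW => m; exact: grid_sum_le.
Qed.

Lemma grid_int_le H1 H2 : bounded_fun H1 -> bounded_fun H2 ->
  (forall y, H1 y <= H2 y) -> grid_int H1 <= grid_int H2.
Proof.
move=> b1 b2 h; rewrite -subr_ge0 -grid_intB //; apply: grid_int_ge_near.
  exact: bounded_funB.
apply: nearW => m; apply: divr_ge0; last exact: ltW.
by apply: sumr_ge0 => j _; rewrite subr_ge0.
Qed.

Definition unit_supported H := forall y i, 1 <= `|y 0 i| -> H y = 0.

(** One grid step is a cyclic permutation of the indices. Only the wrapped index differs: it stands
    for the coordinate -3 on one side and 3 on the other, and [H] vanishes at both. *)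
Lemma grid_sum_step m i H :
  (forall y, 2 <= `|y 0 i| -> H y = 0) ->
  grid_sum m (fun y => H (y + (m.+1%:R^-1) *: 'e_i)) = grid_sum m H.
Proof.
move=> H0; rewrite /grid_sum; congr (_ / _).
pose s (j : grid_index m) : grid_index m := [ffun k => if k == i then ordS (j k) else j k].
have s_inj : injective s.
  move=> j k /ffunP h; apply/ffunP => l; have := h l; rewrite !ffunE.
  by case: eqP => // _ /ordS_inj.
rewrite [RHS](reindex_inj s_inj) /=; apply: eq_bigr => j _.
have m0 : (m.+1%:R : R) != 0 by rewrite pnatr_eq0.
have [jl|jl] := ltnP (j i).+1 (6 * m.+1).
  congr H; apply/rowP => k; rewrite !mxE ffunE eqxx /=.
  have [->|_] := eqVneq k i; last by rewrite mulr0 addr0.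
  by rewrite /= modn_small // mulr1 -[(j i).+1%:R]natr1 mulrDl mul1r addrAC.
have jE : (j i).+1 = (6 * m.+1)%N by apply/eqP; rewrite eqn_leq ltn_ord.
rewrite !H0 //.
  rewrite !mxE ffunE eqxx /= jE modnn mul0r sub0r normrN ger0_norm //.
  by rewrite ler_nat.
have jR : (j i)%:R = 6 * m.+1%:R - 1 :> R.
  have := congr1 (fun a : nat => a%:R : R) jE.
  by rewrite natrM -[(j i).+1%:R]natr1 => <-; rewrite addrK.
rewrite !mxE !eqxx /= mulr1 (_ : _ + _ = 3) ?ger0_norm //; first by rewrite ler_nat.
by rewrite jR; field.
Qed.

Lemma grid_sum_shift m i H k : unit_supported H -> k%:R <= (m.+1%:R : R) ->
  grid_sum m (fun y => H (y + (k%:R / m.+1%:R) *: 'e_i)) = grid_sum m H.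
Proof.
move=> H0; have m0 : 0 < (m.+1%:R : R) by [].
elim: k => [|k IH] hk.
  by congr grid_sum; apply/funext => y; rewrite mul0r scale0r addr0.
have hk' : k%:R <= (m.+1%:R : R) by apply: le_trans hk; rewrite ler_nat.
rewrite -IH // -(@grid_sum_step m i (fun y => H (y + (k%:R / m.+1%:R) *: 'e_i))).
  congr grid_sum; apply/funext => y; congr H.
  have -> : k.+1%:R / m.+1%:R = m.+1%:R^-1 + k%:R / m.+1%:R :> R.
    by rewrite -[k.+1%:R]natr1; ring.
  by rewrite scalerDl addrA.
(* A shift by at most 1 keeps the support inside [|y_i| < 2], as [grid_sum_step] asks. *)
move=> y hy; apply: (H0 _ i); rewrite !mxE !eqxx /= mulr1.
have h1 : 0 <= k%:R / (m.+1%:R : R) by rewrite divr_ge0.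
have h2 : k%:R / (m.+1%:R : R) <= 1 by rewrite ler_pdivrMr // mul1r.
move: h1 h2; set t := k%:R / _ => h1 h2.
have := lerB_normD (y 0 i) t; rewrite (ger0_norm h1); lra.
Qed.

Definition line_unif_continuous H := forall i (e : R), 0 < e ->
  exists2 d : R, 0 < d & forall y t, `|t| <= d -> `|H (y + t *: 'e_i) - H y| <= e.

(** Rounding [h] down to a multiple of the grid step makes the shift exact on the grid; uniform
    continuity controls the rounding error, which tends to 0 with the step. *)
Lemma grid_int_shift i H (h : R) : bounded_fun H -> unit_supported H ->
  line_unif_continuous H -> 0 <= h -> h <= 1 ->
  grid_int (fun y => H (y + h *: 'e_i)) = grid_int H.
Proof.
move=> bH sH uH h0 h1.
have bS : bounded_fun (fun y => H (y + h *: 'e_i)).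
  by have [C HC] := bH; exists C => y.
apply/eqP; rewrite -subr_eq0 -normr_le0; apply/ler_addgt0Pr => e e0; rewrite add0r.
pose e' := e / 6 ^+ N.
have e'0 : 0 < e' by rewrite divr_gt0 // exprn_gt0.
have [d d0 Hd] := uH i _ e'0.
have bD : bounded_fun (fun y => H (y + h *: 'e_i) - H y).
  exact: bounded_funB.
have near_le : \forall m \near \oo, `|grid_sum m (fun y => H (y + h *: 'e_i) - H y)| <= e.
  near=> m.
  have m0 : 0 < (m.+1%:R : R) by [].
  have md : m.+1%:R^-1 <= d.
    near: m; have := @near_infty_natSinv_lt R (PosNum d0); apply: filterS => m /ltW.
    by [].
  pose k := Num.truncn (h * m.+1%:R).
  have hm0 : 0 <= h * m.+1%:R by rewrite mulr_ge0 // ltW.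
  have /andP[k1 k2] := truncn_itv hm0.
  have E : grid_sum m (fun y => H (y + h *: 'e_i) - H y) =
    grid_sum m (fun y => H (y + h *: 'e_i) - H (y + (k%:R / m.+1%:R) *: 'e_i)).
    rewrite /grid_sum !sumrB !mulrBl; congr (_ - _).
    symmetry; apply: grid_sum_shift => //; apply: (le_trans k1).
    by rewrite -[leRHS]mul1r ler_wpM2r // ltW.
  rewrite E; have -> : e = 6 ^+ N * e' by rewrite /e' mulrC divfK // gt_eqF // exprn_gt0.
  apply: grid_sum_le => y.
  have -> : y + h *: 'e_i = (y + (k%:R / m.+1%:R) *: 'e_i) + (h - k%:R / m.+1%:R) *: 'e_i.
    by rewrite -addrA -scalerDl (addrC (k%:R / _)) subrK.
  apply: Hd; apply: le_trans md; rewrite -[leRHS]mul1r ler_pdivlMr //.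
  rewrite -{2}(ger0_norm (ltW m0)) -normrM mulrBl divfK ?gt_eqF //.
  rewrite ger0_norm ?subr_ge0 //; move: k2; rewrite -/k -[k.+1%:R]natr1.
  by set a := h * _; lra.
by rewrite -grid_intB //; exact: grid_int_norm_near.
Unshelve. all: by end_near. Qed.

(** Shift invariance makes the mean of [H (y + t e_i) - H y] vanish, so [t] times the mean of [dH]
    is at most a small multiple of [t]. This takes the place of integration by parts. *)
Lemma grid_int_deriv i H dH : bounded_fun H -> bounded_fun dH -> unit_supported H ->
  line_unif_continuous H ->
  (forall e : R, 0 < e -> exists2 d : R, 0 < d & forall y t, 0 < t -> t <= d ->
     `|H (y + t *: 'e_i) - H y - t * dH y| <= t * e) ->
  grid_int dH = 0.
Proof.
move=> bH bd sH uH HD; apply/eqP; rewrite -normr_le0; apply/ler_addgt0Pr => e e0; rewrite add0r.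
pose e' := e / 6 ^+ N.
have e'0 : 0 < e' by rewrite divr_gt0 // exprn_gt0.
have [d d0 Hd] := HD _ e'0.
pose t := Num.min d 1.
have t0 : 0 < t by rewrite lt_min d0 ltr01.
have td : t <= d by rewrite ge_min lexx.
have t1 : t <= 1 by rewrite ge_min lexx orbT.
have bS : bounded_fun (fun y => H (y + t *: 'e_i)).
  by have [C HC] := bH; exists C => y.
have E : grid_int (fun y => H (y + t *: 'e_i) - H y - t * dH y) = - (t * grid_int dH).
  rewrite grid_intB; last exact: bounded_funZ; last exact: bounded_funB.
  by rewrite grid_intB // grid_int_shift ?subrr ?sub0r ?grid_intZ // ltW.
have := grid_int_norm (fun y => Hd y t t0 td); rewrite E normrN normrM (ger0_norm (ltW t0)).
rewrite mulrCA ler_pM2l // /e' [6 ^+ N * _]mulrC divfK // gt_eqF // exprn_gt0 //.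
Qed.

Lemma grid_int_cube (d : R) H : 0 < d -> d <= 1 -> bounded_fun H ->
  (forall y, 0 <= H y) -> (forall y, (forall i, 0 <= y 0 i <= d) -> 1 <= H y) ->
  (d / 2) ^+ N <= grid_int H.
Proof.
move=> d0 d1 bH H0 H1.
have d20 : 0 < d / 2 by rewrite divr_gt0.
apply: grid_int_ge_near => //; near=> m.
have m0 : 0 < (m.+1%:R : R) by [].
have md : m.+1%:R^-1 <= d / 2.
  near: m; have := @near_infty_natSinv_lt R (PosNum d20); apply: filterS => m /ltW.
  by [].
rewrite /grid_sum ler_pdivlMr // -exprMn.
pose K := Num.truncn (d * m.+1%:R).
have dm0 : 0 <= d * m.+1%:R by rewrite mulr_ge0 // ltW.
have /andP[k1 k2] := truncn_itv dm0; rewrite -/K in k1 k2.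
have Km : (3 * m.+1 + K < 6 * m.+1)%N.
  have : (K <= m.+1)%N.
    rewrite -(ler_nat R); apply: (le_trans k1); rewrite -[leRHS]mul1r.
    by apply: ler_wpM2r => //; exact: ltW.
  by lia.
(* Index [3 (m + 1)] is the coordinate 0, so this one and the next [K] run through the grid points
   of [[0, d]]. *)
have hK (k : 'I_K.+1) : (3 * m.+1 + k < 6 * m.+1)%N.
  by apply: leq_ltn_trans Km; rewrite leq_add2l -ltnS.
pose emb (f : {ffun 'I_N -> 'I_K.+1}) : grid_index m := [ffun i => Ordinal (hK (f i))].
have emb_inj : injective emb.
  move=> f g /ffunP h; apply/ffunP => i; have := h i; rewrite !ffunE => /(congr1 val) /= /addnI.
  by move/val_inj.
apply: (@le_trans _ _ (\sum_(j <- [seq emb f | f <- enum {: {ffun 'I_N -> 'I_K.+1}}])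
    H (grid_point j))); last first.
  rewrite -[leRHS]big_enum /=; apply: ler_sum_subset => //.
    by rewrite map_inj_uniq // enum_uniq.
  by move=> j _; rewrite mem_enum.
rewrite big_map big_enum /=.
apply: (@le_trans _ _ (\sum_(f : {ffun 'I_N -> 'I_K.+1}) 1)).
  rewrite sumr_const card_ffun !card_ord natrX lerXn2r ?nnegrE ?mulr_ge0 // ?divr_ge0 ?ltW //.
  apply: le_lt_trans k2; apply: ler_wpM2r; first exact: ltW.
  lra.
apply: ler_sum => f _; apply: H1 => i; rewrite !mxE ffunE /= natrD natrM.
rewrite mulrDl mulfK ?gt_eqF // addrC addKr divr_ge0 //= ler_pdivrMr //.
by apply: le_trans k1; rewrite ler_nat -ltnS.
Unshelve. all: by end_near. Qed.

End GridFunctional.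

(** * Uniform continuity and the divergence theorem for the mean *)

Section UniformContinuity.
Variables (R : realType) (N : nat).
Local Notation rvec := 'rV[R]_N.
Implicit Types (H : rvec -> R) (y : rvec).

Let cube2 : set rvec := [set y | forall i, `[- 2, 2]%classic (y ord0 i)].

Let cube2_compact : compact cube2.
Proof. exact: (@rV_compact R N (fun=> `[- 2, 2]%classic) (fun=> @segment_compact _ _ _)). Qed.

Lemma continuous_bounded H : continuous H -> unit_supported H -> bounded_fun H.
Proof.
move=> cH sH; have /compact_near_coveringP := cube2_compact.
move=> /(_ R +oo (fun M y => `|H y| <= M) _) h.
have [|M [_ HM]] := h.
  move=> y _; near=> z M.
  have hz : `|H y - H z| < 1.
    by near: z; move/cvgrPdist_lt : (cH y) => /(_ 1 ltr01).
  apply: (@le_trans _ _ (`|H y| + 1)); first by have := ler_dist_dist (H y) (H z);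
    have := ler_normB (H y) (H y - H z); rewrite opprB addrC subrK; lra.
  by rewrite /=; near: M; exact: nbhs_pinfty_ge.
exists (`|M| + 1) => y; have [yc|yc] := pselect (cube2 y).
  by apply: HM => //; have := ler_norm M; lra.
have [i hi] : exists i, ~ (- 2 <= y 0 i <= 2).
  by apply: contrapT => hn; apply: yc => i /=; rewrite in_itv /=; apply: contrapT => h0; apply: hn; exists i.
rewrite (sH y i) ?normr0 ?addr_ge0 //; move/negP: hi; rewrite -ler_norml; lra.
Unshelve. all: by end_near. Qed.

(** Compactness of [[-2, 2]^N] gives a uniform [d]; outside that cube both [y] and its shift by at
    most 1 are off the support. *)
Lemma continuous_line_unif H : continuous H -> unit_supported H -> line_unif_continuous H.
Proof.
move=> cH sH i e e0; have /compact_near_coveringP := cube2_compact.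
move=> /(_ R (nbhs (0 : R)) (fun t y => `|H (y + t *: 'e_i) - H y| <= e) _) h.
have e20 : 0 < e / 2 by rewrite divr_gt0.
have [|d /= d0 Hd] := h.
  move=> y _.
  have c1 : \forall p \near (nbhs y, nbhs (0 : R)), `|H (y + 0 *: 'e_i) - H (p.1 + p.2 *: 'e_i)| < e / 2.
    have cc : (fun p : rvec * R => H (p.1 + p.2 *: 'e_i)) @ (y, (0 : R)) --> H (y + 0 *: 'e_i).
      apply: (@cvg_comp _ _ _ (fun p : rvec * R => p.1 + p.2 *: 'e_i) H _ (nbhs (y + 0 *: 'e_i))).
        by apply: cvgD; [exact: cvg_fst | apply: cvgZr_tmp; exact: cvg_snd].
      exact: cH.
    by move/cvgrPdist_lt : cc => /(_ _ e20).
  have c2 : \forall z \near y, `|H y - H z| < e / 2.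
    by move/cvgrPdist_lt : (cH y) => /(_ _ e20).
  case: c1 => -[A B] /= [nA nB] sAB.
  exists (A `&` [set z | `|H y - H z| < e / 2], B) => /=.
    by split=> //; exact: filterI.
  move=> [z t] /= [[Az Hz] Bt].
  have /= := sAB (z, t) (conj Az Bt); rewrite scale0r addr0 => h1.
  move: h1 Hz; rewrite !ltr_norml ler_norml; lra.
exists (Num.min (d / 2) 1); first by rewrite lt_min ltr01 divr_gt0.
move=> y t ht; have td : `|t| < d.
  by apply: le_lt_trans ht _; rewrite gt_min; apply/orP; left; lra.
have t1 : `|t| <= 1 by apply: le_trans ht _; rewrite ge_min lexx orbT.
have [yc|yc] := pselect (cube2 y).
  by apply: Hd => //=; rewrite sub0r normrN.
have [k hk] : exists k, ~ (- 2 <= y 0 k <= 2).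
  by apply: contrapT => hn; apply: yc => k /=; rewrite in_itv /=; apply: contrapT => h0; apply: hn; exists k.
have hk' : 2 < `|y 0 k| by move/negP: hk; rewrite -ler_norml; lra.
rewrite (sH y k) ?(sH (y + _) k) ?subrr ?normr0 ?ltW //; last by lra.
rewrite !mxE eqxx /=; have h2 : `|t * (k == i)%:R| <= 1.
  by case: (k == i); rewrite ?mulr1 ?mulr0 ?normr0.
by have := lerB_normD (y 0 k) (t * (k == i)%:R); lra.
Qed.

(** The mean value theorem along [e_i] turns uniform continuity of [dH] into the uniform first-order
    estimate that [grid_int_deriv] asks for. *)
Lemma grid_int_divergence i H dH : continuous H -> continuous dH ->
  unit_supported H -> unit_supported dH ->
  (forall y, is_derive y 'e_i H (dH y)) -> grid_int dH = 0.
Proof.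
move=> cH cd sH sd D; apply: (@grid_int_deriv _ _ i H).
- exact: continuous_bounded.
- exact: continuous_bounded.
- by [].
- exact: continuous_line_unif.
move=> e e0; have [d d0 Hd] := continuous_line_unif cd sd i e0.
exists d => // y t t0 td.
have D1 (s : R) : is_derive s 1 (fun s : R => H (y + s *: 'e_i)) (dH (y + s *: 'e_i)).
  have [Dd De] := D (y + s *: 'e_i).
  have E : (fun h : R => h^-1 *: (H (y + (h *: (1 : R) + s) *: 'e_i) - H (y + s *: 'e_i))) =
           (fun h : R => h^-1 *: (H (h *: 'e_i + (y + s *: 'e_i)) - H (y + s *: 'e_i))).
    apply/funext => h; congr (_ *: (H _ - _)).
    by rewrite scalerDl addrCA -[h *: (1 : R)]/(h * 1) mulr1.
  split; first by move: Dd; rewrite /derivable /= E.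
  by move: De; rewrite /derive /= E.
have c1 : {within `[0, t], continuous (fun s : R => H (y + s *: 'e_i))}.
  apply: continuous_subspaceT => s; apply: differentiable_continuous.
  by apply/derivable1_diffP; exact: ex_derive.
have [s] := MVT t0 (fun s _ => D1 s) c1.
rewrite in_itv /= => /andP[s0 st]; rewrite scale0r addr0 subr0 => ->.
rewrite mulrC -mulrBr normrM (ger0_norm (ltW t0)) ler_pM2l //.
by apply: Hd; rewrite ger0_norm ?ltW // (lt_le_trans st).
Qed.

End UniformContinuity.

(** * Cutoff functions *)

Section DirectionalCalculus.
Variables (R : realType) (V : normedModType R).
Implicit Types (f g : V -> R) (y v : V).

(** Common source of the derivatives of quadratic polynomials, of powers of the positive part and of
    power series, all of which come with quadratic remainders. *)
Lemma is_derive_quadratic f y v (d K e : R) : 0 < e ->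
  (forall h : R, `|h| <= e -> `|f (h *: v + y) - f y - h * d| <= K * h ^+ 2) ->
  is_derive y v f d.
Proof.
move=> e0 H.
have cv : (h^-1 *: ((f \o shift y) (h *: v) - f y) @[h --> 0^']) --> d.
  apply/cvgrPdist_le => r r0; near=> h.
  have h0 : h != 0 by near: h; exact: nbhs_dnbhs_neq.
  have he : `|h| <= e.
    by near: h; apply: dnbhs0_le.
  have hr : `|h| <= r / (`|K| + 1).
    by near: h; apply: dnbhs0_le; rewrite divr_gt0 // ltr_wpDl.
  have hp : 0 < `|h| by rewrite normr_gt0.
  rewrite -(ler_pM2l hp) -normrM mulrBr.
  have -> : h * (h^-1 *: ((f \o shift y) (h *: v) - f y)) = f (h *: v + y) - f y.
    by rewrite /= -[_ *: _]/(h^-1 * _) mulVKf.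
  rewrite distrC; apply: (le_trans (H h he)).
  have -> : h ^+ 2 = `|h| * `|h| by rewrite -normrM -expr2 ger0_norm // sqr_ge0.
  rewrite mulrCA; apply: ler_wpM2l; first exact: ltW.
  have K1 : 0 < `|K| + 1 by rewrite ltr_wpDl.
  have : `|h| * (`|K| + 1) <= r by rewrite -ler_pdivlMr.
  have := ler_wpM2r (ltW hp) (ler_norm K); lra.
split; first by apply/cvg_ex; exists d.
exact: cvg_lim cv.
Unshelve. all: by end_near. Qed.

Lemma is_derive_mul f g y v (df dg : R) : is_derive y v f df -> is_derive y v g dg ->
  is_derive y v (fun y => f y * g y) (df * g y + f y * dg).
Proof.
move=> Df Dg; have := is_deriveM Df Dg; rewrite -![_ *: _]/(_ * _) => D.
by apply: is_derive_eq D _; rewrite addrC mulrC.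
Qed.

Lemma is_derive_add f g y v (df dg : R) : is_derive y v f df -> is_derive y v g dg ->
  is_derive y v (fun y => f y + g y) (df + dg).
Proof. by move=> Df Dg; exact: is_deriveD. Qed.

Lemma is_derive_sub f g y v (df dg : R) : is_derive y v f df -> is_derive y v g dg ->
  is_derive y v (fun y => f y - g y) (df - dg).
Proof. by move=> Df Dg; exact: is_deriveB. Qed.

Lemma is_derive_const (a : R) y v : is_derive y v (fun=> a) 0.
Proof. exact: is_derive_cst. Qed.

(** Reduces the chain rule in [V] to the one-variable one. *)
Lemma is_derive_line f y v (d : R) :
  is_derive y v f d <-> is_derive (0 : R) 1 (fun h : R => f (h *: v + y)) d.
Proof.
have E : (fun h : R => h^-1 *: ((f \o shift y) (h *: v) - f y)) =
  (fun h : R => h^-1 *: (((fun h : R => f (h *: v + y)) \o shift 0) (h *: (1 : R)) - f (0 *: v + y))).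
  by apply/funext => h; rewrite /= scale0r add0r addr0 -[h *: 1]/(h * 1) mulr1.
split=> -[D1 D2]; split.
- by move: D1; rewrite /derivable E.
- by move: D2; rewrite /derive E.
- by move: D1; rewrite /derivable E.
- by move: D2; rewrite /derive E.
Qed.

Lemma is_derive_comp_real f (g : R -> R) y v (df dg : R) :
  is_derive y v f df -> is_derive (f y) 1 g dg ->
  is_derive y v (fun y => g (f y)) (dg * df).
Proof.
move=> /is_derive_line Df Dg; apply/is_derive_line.
by apply: (@is_derive1_comp R g (fun h : R => f (h *: v + y)) 0 dg df) => //; rewrite scale0r add0r.
Qed.

End DirectionalCalculus.

Section Cutoff.
Variable R : realType.
Implicit Types t : R.

Definition pos_part t : R := Num.max t 0.

Lemma pos_part_ge0 t : 0 <= pos_part t.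
Proof. by rewrite le_max lexx orbT. Qed.

Lemma pos_part_le0 t : t <= 0 -> pos_part t = 0.
Proof. by move=> h; apply/max_idPr. Qed.

Lemma pos_part_id t : 0 <= t -> pos_part t = t.
Proof. by move=> h; apply/max_idPl. Qed.

Lemma pos_part_lip t h : `|pos_part (t + h) - pos_part t| <= `|h|.
Proof.
have [t0|t0] := leP 0 t; have [th|th] := leP 0 (t + h).
- by rewrite !pos_part_id // addrAC subrr add0r.
- rewrite (pos_part_le0 (ltW th)) (pos_part_id t0) sub0r normrN ger0_norm //.
  by rewrite ltr0_norm; lra.
- rewrite (pos_part_id th) (pos_part_le0 (ltW t0)) subr0 ger0_norm //.
  by rewrite ger0_norm; lra.
by rewrite (pos_part_le0 (ltW th)) (pos_part_le0 (ltW t0)) subrr normr0.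
Qed.

Lemma pos_part_continuous : continuous pos_part.
Proof.
move=> t; apply/cvgrPdist_lt => e e0; near=> s.
have h : `|t - s| < e by near: s; exact: (@cvgr_dist_lt _ _ _ (nbhs t) _ id t).
by have := pos_part_lip s (t - s); rewrite (addrC s) subrK => /le_lt_trans; apply.
Unshelve. all: by end_near. Qed.

Lemma pos_part2_taylor t h :
  `|pos_part (t + h) ^+ 2 - pos_part t ^+ 2 - h * (2 * pos_part t)| <= 3 * h ^+ 2.
Proof.
have [t0|t0] := leP 0 t; last first.
  rewrite (pos_part_le0 (ltW t0)) !mulr0 expr0n /= !subr0 ger0_norm ?sqr_ge0 //.
  have := pos_part_lip t h; rewrite (pos_part_le0 (ltW t0)) subr0 ger0_norm ?pos_part_ge0 // => h1.
  have : pos_part (t + h) ^+ 2 <= `|h| ^+ 2 by rewrite lerXn2r ?nnegrE ?pos_part_ge0.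
  by rewrite real_normK ?num_real //; have := sqr_ge0 h; lra.
rewrite (pos_part_id t0); have [th|th] := leP 0 (t + h).
  rewrite (pos_part_id th) (_ : _ - _ - _ = h ^+ 2); last by ring.
  by rewrite ger0_norm ?sqr_ge0 //; have := sqr_ge0 h; lra.
rewrite (pos_part_le0 (ltW th)) ler_norml; apply/andP; split; nra.
Qed.

Lemma is_derive_pos_part2 t :
  is_derive t 1 (fun t => pos_part t ^+ 2) (2 * pos_part t).
Proof.
apply: (@is_derive_quadratic R R^o _ _ _ _ 3 1) => // h _.
by rewrite -[h *: (1 : R)]/(h * 1) mulr1 (addrC h); exact: pos_part2_taylor.
Qed.

Lemma is_derive_pos_part3 t :
  is_derive t 1 (fun t => pos_part t ^+ 3) (3 * pos_part t ^+ 2).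
Proof.
apply: (@is_derive_quadratic R R^o _ _ _ _ (6 * (pos_part t + 1)) 1) => // h h1.
rewrite -[h *: (1 : R)]/(h * 1) mulr1 (addrC h).
have h2 := pos_part2_taylor t h; have h3 := pos_part_lip t h.
set x := pos_part (t + h) in h2 h3 *; set y := pos_part t in h2 h3 *.
have y0 : 0 <= y by exact: pos_part_ge0.
(* The remainder of the cube is expressed through that of the square and the increment [x - y], both
   already bounded; no further case distinction on signs arises. *)
have -> : x ^+ 3 - y ^+ 3 - h * (3 * y ^+ 2) =
  (x - y) ^+ 3 + 3 * y * (x - y) ^+ 2 + (3 / 2) * (y * ((x ^+ 2 - y ^+ 2 - h * (2 * y)) - (x - y) ^+ 2)).
  by field.
set u := x - y in h3 *; set w := x ^+ 2 - _ - _ in h2 *.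
have u2 : u ^+ 2 <= h ^+ 2.
  by rewrite -(real_normK (num_real u)) -(real_normK (num_real h)) lerXn2r ?nnegrE.
have u20 := sqr_ge0 u.
have u3 : `|u ^+ 3| <= h ^+ 2.
  rewrite exprSr normrM (ger0_norm u20); apply: le_trans u2.
  by rewrite -[leRHS]mulr1; apply: ler_wpM2l => //; lra.
move: h2 u3; rewrite !ler_norml => /andP[w1 w2] /andP[u31 u32].
have yw1 : y * w <= y * (3 * h ^+ 2) by apply: ler_wpM2l.
have yw2 : y * (- (3 * h ^+ 2)) <= y * w by apply: ler_wpM2l.
have yu : y * u ^+ 2 <= y * h ^+ 2 by apply: ler_wpM2l.
have yu0 : 0 <= y * u ^+ 2 by exact: mulr_ge0.
have hh := sqr_ge0 h.
apply/andP; split; lra.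
Qed.

Variables a b : R.
Hypothesis ab : a < b.

Let scaled t := (t - a) / (b - a).

(* Cubing the positive part makes this C^2; it is 1 on ]-oo, a] and 0 on [b, +oo[. *)
Definition cutoff t := pos_part (1 - pos_part (scaled t) ^+ 3) ^+ 3.

Definition cutoff' t := 3 * pos_part (1 - pos_part (scaled t) ^+ 3) ^+ 2 *
  (- (3 * pos_part (scaled t) ^+ 2 / (b - a))).

Definition cutoff'' t :=
  (6 * pos_part (1 - pos_part (scaled t) ^+ 3) * (- (3 * pos_part (scaled t) ^+ 2 / (b - a)))) *
    (- (3 * pos_part (scaled t) ^+ 2 / (b - a))) +
  3 * pos_part (1 - pos_part (scaled t) ^+ 3) ^+ 2 *
    (- (6 * pos_part (scaled t) / (b - a) / (b - a))).

Let is_derive_scaled t : is_derive t 1 scaled (b - a)^-1.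
Proof.
apply: (@is_derive_quadratic R R^o _ _ _ _ 0 1) => // h _.
rewrite mul0r normr_le0 /scaled -[h *: (1 : R)]/(h * 1); apply/eqP; ring.
Qed.

Let D3 t : is_derive t 1 (fun t => pos_part (scaled t) ^+ 3) (3 * pos_part (scaled t) ^+ 2 / (b - a)).
Proof. exact: (is_derive_comp_real (is_derive_scaled t) (is_derive_pos_part3 _)). Qed.

Let D1 t : is_derive t 1 (fun t => 1 - pos_part (scaled t) ^+ 3)
  (- (3 * pos_part (scaled t) ^+ 2 / (b - a))).
Proof.
by have := is_derive_sub (is_derive_const 1 t 1) (D3 t); rewrite sub0r.
Qed.

Lemma is_derive_cutoff t : is_derive t 1 cutoff (cutoff' t).
Proof. exact: (is_derive_comp_real (D1 t) (is_derive_pos_part3 _)). Qed.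

Lemma is_derive_cutoff' t : is_derive t 1 cutoff' (cutoff'' t).
Proof.
have E2 := is_derive_comp_real (D1 t) (is_derive_pos_part2 _).
have S2 := is_derive_comp_real (is_derive_scaled t) (is_derive_pos_part2 _).
have H1 := is_derive_mul (is_derive_const 3 t 1) E2.
have H2 := is_derive_mul (is_derive_const (- (3 / (b - a))) t 1) S2.
have H := is_derive_mul H1 H2.
have -> : cutoff' = (fun t => 3 * pos_part (1 - pos_part (scaled t) ^+ 3) ^+ 2 *
   (- (3 / (b - a)) * pos_part (scaled t) ^+ 2)).
  by apply/funext => s; rewrite /cutoff'; ring.
by apply: is_derive_eq H _; rewrite /cutoff''; ring.
Qed.

Let ba : 0 < b - a. Proof. by rewrite subr_gt0. Qed.

Lemma cutoff_left t : t <= a -> [/\ cutoff t = 1, cutoff' t = 0 & cutoff'' t = 0].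
Proof.
move=> ta; have s0 : scaled t <= 0 by rewrite /scaled ler_pdivrMr // mul0r subr_le0.
rewrite /cutoff /cutoff' /cutoff'' (pos_part_le0 s0) !expr0n /= subr0 pos_part_id //.
by split; rewrite ?expr1n //; ring.
Qed.

Lemma cutoff_right t : b <= t -> [/\ cutoff t = 0, cutoff' t = 0 & cutoff'' t = 0].
Proof.
move=> tb; have s1 : 1 <= scaled t by rewrite /scaled ler_pdivlMr // mul1r lerB.
have s3 : 1 - pos_part (scaled t) ^+ 3 <= 0.
  by rewrite subr_le0 exprn_ege1 // pos_part_id //; lra.
rewrite /cutoff /cutoff' /cutoff'' (pos_part_le0 s3) !expr0n /=.
by split; ring.
Qed.

Lemma cutoff_ge0 t : 0 <= cutoff t.
Proof. by rewrite exprn_ge0 // pos_part_ge0. Qed.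

Lemma cutoff_le1 t : cutoff t <= 1.
Proof.
rewrite /cutoff exprn_ile1 ?pos_part_ge0 //.
have := pos_part_ge0 (scaled t) => h; have h3 : 0 <= pos_part (scaled t) ^+ 3 by rewrite exprn_ge0.
by rewrite ge_max ler01 andbT; lra.
Qed.

Let c1 : continuous (fun t => pos_part (scaled t)).
Proof.
move=> t; apply: (@continuous_comp _ _ _ scaled pos_part); last exact: pos_part_continuous.
by apply: differentiable_continuous; apply/derivable1_diffP; by have [] := is_derive_scaled t.
Qed.

Let c2 k : continuous (fun t => pos_part (scaled t) ^+ k).
Proof.
move=> t; apply: (@continuous_comp _ _ _ (fun t => pos_part (scaled t)) (fun x : R => x ^+ k)).
  exact: c1.
exact: exprn_continuous.
Qed.

Let c3 k : continuous (fun t => pos_part (1 - pos_part (scaled t) ^+ 3) ^+ k).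
Proof.
move=> t; apply: (@continuous_comp _ _ _ (fun t => pos_part (1 - pos_part (scaled t) ^+ 3)) (fun x : R => x ^+ k)).
  apply: (@continuous_comp _ _ _ (fun t => 1 - pos_part (scaled t) ^+ 3) pos_part); last exact: pos_part_continuous.
  by apply: cvgB; [exact: cvg_cst | exact: c2].
exact: exprn_continuous.
Qed.

Lemma cutoff_continuous : continuous cutoff.
Proof. exact: c3. Qed.

Lemma cutoff'_continuous : continuous cutoff'.
Proof.
move=> t; apply: cvgM; first by apply: cvgM; [exact: cvg_cst | exact: c3].
by apply: cvgN; apply: cvgM; [apply: cvgM; [exact: cvg_cst | exact: c2] | exact: cvg_cst].
Qed.

Lemma cutoff''_continuous : continuous cutoff''.
Proof.
have h : continuous (fun t => - (3 * pos_part (scaled t) ^+ 2 / (b - a))).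
  by move=> t; apply: cvgN; apply: cvgM; [apply: cvgM; [exact: cvg_cst | exact: c2] | exact: cvg_cst].
move=> t; apply: cvgD.
  apply: cvgM; last exact: h.
  apply: cvgM; last exact: h.
  by apply: cvgM; [exact: cvg_cst | exact: (@c3 1)].
apply: cvgM; first by apply: cvgM; [exact: cvg_cst | exact: c3].
apply: cvgN; apply: cvgM; last exact: cvg_cst.
by apply: cvgM; [apply: cvgM; [exact: cvg_cst | exact: c1] | exact: cvg_cst].
Qed.

End Cutoff.

(** * Newton's representation of harmonic functions *)

Section PointwiseContinuity.
Variables (R : realType) (T : topologicalType).
Implicit Types (F G : T -> R) (t : T).

Lemma cont_const (k : R) t : continuous_at t (fun=> k : R).
Proof. exact: cvg_cst. Qed.

Lemma cont_add F G t : continuous_at t F -> continuous_at t G ->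
  continuous_at t (fun s => F s + G s).
Proof. by move=> cF cG; apply: cvgD; [exact: cF | exact: cG]. Qed.

Lemma cont_sub F G t : continuous_at t F -> continuous_at t G ->
  continuous_at t (fun s => F s - G s).
Proof. by move=> cF cG; apply: cvgB; [exact: cF | exact: cG]. Qed.

Lemma cont_mul F G t : continuous_at t F -> continuous_at t G ->
  continuous_at t (fun s => F s * G s).
Proof. by move=> cF cG; apply: cvgM; [exact: cF | exact: cG]. Qed.

Lemma cont_exp F k t : continuous_at t F -> continuous_at t (fun s => F s ^+ k).
Proof.
move=> cF; elim: k => [|k IH]; first exact: cont_const.
rewrite (_ : (fun s => _) = fun s => F s * F s ^+ k); first exact: cont_mul.
by apply/funext => s; rewrite exprS.
Qed.

Lemma cont_inv F t : F t != 0 -> continuous_at t F -> continuous_at t (fun s => (F s)^-1).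
Proof. by move=> F0 cF; apply: cvgV. Qed.

Lemma cont_comp F (g : R -> R) t : continuous_at t F -> continuous_at (F t) g ->
  continuous_at t (fun s => g (F s)).
Proof. by move=> cF cg; exact: (@continuous_comp _ _ _ F g). Qed.

Lemma cont_sum (I : Type) (s : seq I) (F : I -> T -> R) t :
  (forall i, continuous_at t (F i)) -> continuous_at t (fun u => \sum_(i <- s) F i u).
Proof.
move=> H; elim: s => [|i s IH].
  rewrite (_ : (fun u => _) = fun=> 0); first exact: cont_const.
  by apply/funext => u; rewrite big_nil.
rewrite (_ : (fun u => _) = fun u => F i u + \sum_(j <- s) F j u); last first.
  by apply/funext => u; rewrite big_cons.
by apply: cont_add.
Qed.

Lemma cont_near_gt F (k : R) t : continuous_at t F -> k < F t ->
  \forall s \near t, k < F s.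
Proof.
move=> cF kF; have e0 : 0 < F t - k by rewrite subr_gt0.
move/cvgrPdist_lt : cF => /(_ _ e0); apply: filterS => s.
by move=> /(le_lt_trans (ler_norm _)); rewrite ltrD2l ltrN2.
Qed.

Lemma cont_near_const F (k : R) t : (\forall s \near t, F s = k) -> continuous_at t F.
Proof.
move=> h; have Ft := nbhs_singleton h; rewrite /continuous_at Ft.
by apply/cvgrPdist_lt => e e0; apply: filterS h => s ->; rewrite subrr normr0.
Qed.

End PointwiseContinuity.

(** * The squared Euclidean norm *)

Section EuclideanSquare.
Variables (R : realType) (N : nat).
Local Notation rvec := 'rV[R]_N.
Implicit Types (x y : rvec).

Definition sqnorm y : R := \sum_i y 0 i ^+ 2.

Lemma sqnorm_ge0 y : 0 <= sqnorm y.
Proof. by apply: sumr_ge0 => i _; exact: sqr_ge0. Qed.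

Lemma sqr_coord_le y i : y 0 i ^+ 2 <= sqnorm y.
Proof.
by rewrite /sqnorm (bigD1 i) //= lerDl; apply: sumr_ge0 => j _; exact: sqr_ge0.
Qed.

Lemma coord_ge1_sqnorm y i : 1 <= `|y 0 i| -> 1 <= sqnorm y.
Proof.
move=> h; apply: le_trans (sqr_coord_le y i).
by rewrite -real_normK ?num_real // exprn_ege1.
Qed.

Lemma sqnormB_scale x y (t : R) :
  sqnorm (y - t *: x) = sqnorm y - 2 * t * (\sum_i y 0 i * x 0 i) + t ^+ 2 * sqnorm x.
Proof.
rewrite /sqnorm !mulr_sumr -sumrB -big_split /=; apply: eq_bigr => i _.
by rewrite !mxE; ring.
Qed.

Lemma cauchy_schwarz x y : (\sum_i y 0 i * x 0 i) ^+ 2 <= sqnorm x * sqnorm y.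
Proof.
set p := \sum_i _; have x0 := sqnorm_ge0 x; have y0 := sqnorm_ge0 y.
have H t := sqnorm_ge0 (y - t *: x).
have [x00|xn0] := eqVneq (sqnorm x) 0.
  rewrite x00 mul0r /p big1 ?expr0n // => i _.
  have : x 0 i ^+ 2 <= 0 by rewrite -x00; exact: sqr_coord_le.
  by rewrite exprn_even_le0 //= => /eqP ->; rewrite mulr0.
have xp : 0 < sqnorm x by rewrite lt_def xn0.
have := H (p / sqnorm x); rewrite sqnormB_scale -/p.
have -> : sqnorm y - 2 * (p / sqnorm x) * p + (p / sqnorm x) ^+ 2 * sqnorm x =
  (sqnorm x * sqnorm y - p ^+ 2) / sqnorm x by field.
by rewrite pmulr_lge0 ?invr_gt0 // subr_ge0.
Qed.

(** Reverse triangle inequality in squared form; Cauchy-Schwarz enters through [p <= X * Y]. *)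
Lemma sqnormB_ge x y (s r : R) : 0 <= s -> s <= r -> sqnorm x <= s ^+ 2 -> r ^+ 2 <= sqnorm y ->
  (r - s) ^+ 2 <= sqnorm (y - x).
Proof.
move=> s0 sr xs ry.
have := sqnormB_scale x y 1; rewrite scale1r => ->; set p := \sum_i _.
have CS := cauchy_schwarz x y; rewrite -/p in CS.
pose X := Num.sqrt (sqnorm x); pose Y := Num.sqrt (sqnorm y).
have X0 : 0 <= X by exact: sqrtr_ge0.
have Y0 : 0 <= Y by exact: sqrtr_ge0.
have XE : X ^+ 2 = sqnorm x by rewrite sqr_sqrtr // sqnorm_ge0.
have YE : Y ^+ 2 = sqnorm y by rewrite sqr_sqrtr // sqnorm_ge0.
have Xs : X <= s by rewrite -(ler_pXn2r (n := 2)) ?nnegrE // XE.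
have rY : r <= Y by rewrite -(ler_pXn2r (n := 2)) ?nnegrE ?YE //; lra.
have pXY : p <= X * Y.
  rewrite leNgt; apply/negP => h; have : (X * Y) ^+ 2 < p ^+ 2.
    by rewrite ltrXn2r ?nnegrE ?mulr_ge0 //; apply: le_trans (ltW h); exact: mulr_ge0.
  by rewrite exprMn XE YE; lra.
rewrite -XE -YE; apply: (@le_trans _ _ ((Y - X) ^+ 2)).
  by rewrite lerXn2r ?nnegrE; lra.
by rewrite sqrrB; nra.
Qed.

Lemma coord_continuous_at i y : continuous_at y (fun y : rvec => y 0 i).
Proof. exact: coord_continuous. Qed.

Lemma sqnormB_continuous x : continuous (fun y => sqnorm (y - x)).
Proof.
move=> y; apply: cont_sum => i; apply: cont_exp.
rewrite (_ : (fun z => _) = fun z : rvec => z 0 i - x 0 i); last by apply/funext => z; rewrite !mxE.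
by apply: cont_sub; [exact: coord_continuous_at | exact: cont_const].
Qed.

Lemma sqnorm_continuous : continuous sqnorm.
Proof. by move=> y; apply: cont_sum => i; apply: cont_exp; exact: coord_continuous_at. Qed.

Lemma is_derive_coord i j y : is_derive y 'e_i (fun y : rvec => y 0 j) (j == i)%:R.
Proof.
apply: (@is_derive_quadratic R _ _ _ _ _ 0 1) => // h _.
by rewrite mul0r normr_le0 !mxE eqxx /= addrK subrr.
Qed.

Lemma is_derive_sqnormB x i y :
  is_derive y 'e_i (fun y => sqnorm (y - x)) (2 * (y 0 i - x 0 i)).
Proof.
apply: (@is_derive_quadratic R _ _ _ _ _ 1 1) => // h _.
have -> : sqnorm (h *: 'e_i + y - x) = sqnorm (y - x) + h * (2 * (y 0 i - x 0 i)) + h ^+ 2.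
  rewrite /sqnorm (bigD1 i) //= [in RHS](bigD1 i) //= !mxE !eqxx /=.
  rewrite (eq_bigr (fun j => (y - x) 0 j ^+ 2)); first by ring.
  by move=> j /negPf ji; rewrite !mxE ji /= ?andbF mulr0 add0r.
by rewrite (_ : _ - _ - _ = h ^+ 2) ?ger0_norm ?sqr_ge0 ?mul1r //; ring.
Qed.

Lemma is_derive_sqnorm i y : is_derive y 'e_i sqnorm (2 * y 0 i).
Proof.
have := is_derive_sqnormB 0 i y; rewrite mxE subr0 (_ : (fun y => _) = sqnorm) //.
by apply/funext => z; rewrite subr0.
Qed.

End EuclideanSquare.

(** * Green's formula, normalization and the representation *)

Section HarmonicRepresentation.
Variables (R : realType) (lam : nat).
Let N := (2 * lam).+2.
Local Notation rvec := 'rV[R]_N.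
Implicit Types (x y : rvec).

(** Derivatives are supplied as functions, with continuity, on the open unit ball only; the cutoff
    extends products with them by 0 to the whole space. *)
Definition harmonic_data (U : rvec -> R) (dU ddU : 'I_N -> rvec -> R) :=
  forall y, sqnorm y < 1 -> [/\ continuous_at y U,
    forall i, continuous_at y (dU i) /\ continuous_at y (ddU i),
    forall i, is_derive y 'e_i U (dU i y) /\ is_derive y 'e_i (dU i) (ddU i y) &
    \sum_i ddU i y = 0].

Variables a b : R.
Hypotheses (a0 : 0 < a) (ab : a < b) (b1 : b < 1).

(** The cutoff is composed with [sqnorm], so [a] and [b] are squares of radii. *)
Let c := cutoff a b.
Let c' := cutoff' a b.
Let c'' := cutoff'' a b.

(** Nothing is known of [F] outside the open unit ball, but [b < 1] makes the product 0 on a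
    neighbourhood of every point there. *)
Lemma cutoff_mul_continuous (g : R -> R) (F : rvec -> R) :
  continuous g -> (forall t, b <= t -> g t = 0) ->
  (forall y, sqnorm y < 1 -> continuous_at y F) ->
  continuous (fun y => g (sqnorm y) * F y).
Proof.
move=> cg g0 cF y; have [y1|y1] := ltP (sqnorm y) 1.
  apply: cont_mul; last exact: cF.
  by apply: (@cont_comp _ _ (@sqnorm R N) g); [exact: sqnorm_continuous | exact: cg].
have yb : b < sqnorm y by exact: lt_le_trans b1 y1.
have nz : \forall z \near y, b < sqnorm z.
  by apply: cont_near_gt => //; exact: sqnorm_continuous.
apply: (@cont_near_const _ _ _ 0); apply: filterS nz => z zb.
by rewrite (g0 _ (ltW zb)) mul0r.
Qed.

Lemma cutoff_mul_supported (g : R -> R) (F : rvec -> R) :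
  (forall t, b <= t -> g t = 0) -> unit_supported (fun y => g (sqnorm y) * F y).
Proof.
by move=> g0 y i /coord_ge1_sqnorm h; rewrite g0 ?mul0r //; exact: ltW (lt_le_trans b1 h).
Qed.

Section Localize.
Variables (U : rvec -> R) (dU ddU : 'I_N -> rvec -> R).
Hypothesis HU : harmonic_data U dU ddU.

Definition loc y := c (sqnorm y) * U y.
Definition dloc i y := c' (sqnorm y) * (2 * y 0 i * U y) + c (sqnorm y) * dU i y.
Definition ddloc i y := c'' (sqnorm y) * (4 * y 0 i ^+ 2 * U y)
  + c' (sqnorm y) * (2 * U y + 4 * y 0 i * dU i y) + c (sqnorm y) * ddU i y.
Definition laploc y := \sum_i ddloc i y.

Let cb t : b <= t -> c t = 0. Proof. by move=> /(cutoff_right ab) []. Qed.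
Let c'b t : b <= t -> c' t = 0. Proof. by move=> /(cutoff_right ab) []. Qed.
Let c''b t : b <= t -> c'' t = 0. Proof. by move=> /(cutoff_right ab) []. Qed.

Let coordM i (F : rvec -> R) (k : R) y : continuous_at y F ->
  continuous_at y (fun y => k * y 0 i * F y).
Proof.
move=> cF; apply: cont_mul => //; apply: cont_mul; first exact: cont_const.
exact: coord_continuous_at.
Qed.

Lemma loc_continuous : continuous loc.
Proof.
by apply: cutoff_mul_continuous => //; [exact: cutoff_continuous | move=> y /HU []].
Qed.

Lemma dloc_continuous i : continuous (dloc i).
Proof.
move=> y; rewrite /dloc; apply: cont_add; apply: cutoff_mul_continuous => //.
- exact: cutoff'_continuous.
- by move=> z /HU [cU _ _ _]; exact: coordM.
- exact: cutoff_continuous.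
- by move=> z /HU [_ /(_ i) [] ].
Qed.

Lemma ddloc_continuous i : continuous (ddloc i).
Proof.
move=> y; rewrite /ddloc; apply: cont_add; first apply: cont_add; apply: cutoff_mul_continuous => //.
- exact: cutoff''_continuous.
- move=> z /HU [cU _ _ _]; apply: cont_mul => //; apply: cont_mul; first exact: cont_const.
  by apply: cont_exp; exact: coord_continuous_at.
- exact: cutoff'_continuous.
- move=> z /HU [cU /(_ i) [cdU _] _ _]; apply: cont_add; last exact: coordM.
  by apply: cont_mul => //; exact: cont_const.
- exact: cutoff_continuous.
- by move=> z /HU [_ /(_ i) [] ].
Qed.

Lemma loc_supported : unit_supported loc.
Proof. exact: cutoff_mul_supported. Qed.

Lemma dloc_supported i : unit_supported (dloc i).
Proof.
move=> y j /coord_ge1_sqnorm h; have yb : b <= sqnorm y by exact: ltW (lt_le_trans b1 h).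
by rewrite /dloc cb // c'b // !mul0r addr0.
Qed.

Lemma ddloc_supported i : unit_supported (ddloc i).
Proof.
move=> y j /coord_ge1_sqnorm h; have yb : b <= sqnorm y by exact: ltW (lt_le_trans b1 h).
by rewrite /ddloc cb // c'b // c''b // !mul0r !addr0.
Qed.

Let far y (F : rvec -> R) v : b < sqnorm y -> (forall z, b < sqnorm z -> F z = 0) ->
  is_derive y v F 0.
Proof.
move=> yb F0; apply: near_eq_is_derive (is_derive_const 0 y v).
have : \forall z \near y, b < sqnorm z.
  by apply: cont_near_gt => //; exact: sqnorm_continuous.
by apply: filterS => z /F0.
Qed.

Let Dc i y : is_derive y 'e_i (fun y => c (sqnorm y)) (c' (sqnorm y) * (2 * y 0 i)).
Proof. exact: (is_derive_comp_real (is_derive_sqnorm i y) (is_derive_cutoff a b _)). Qed.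

Let Dc' i y : is_derive y 'e_i (fun y => c' (sqnorm y)) (c'' (sqnorm y) * (2 * y 0 i)).
Proof. exact: (is_derive_comp_real (is_derive_sqnorm i y) (is_derive_cutoff' a b _)). Qed.

Lemma is_derive_loc i y : is_derive y 'e_i loc (dloc i y).
Proof.
have [y1|y1] := ltP (sqnorm y) 1.
  have [_ _ /(_ i) [DU _] _] := HU y1.
  by apply: is_derive_eq (is_derive_mul (Dc i y) DU) _; rewrite /dloc; ring.
have yb : b < sqnorm y by exact: lt_le_trans b1 y1.
rewrite /dloc cb ?c'b ?ltW // !mul0r addr0; apply: far => // z zb.
by rewrite /loc cb ?mul0r ?ltW.
Qed.

Lemma is_derive_dloc i y : is_derive y 'e_i (dloc i) (ddloc i y).
Proof.
have [y1|y1] := ltP (sqnorm y) 1.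
  have [_ _ /(_ i) [DU DDU] _] := HU y1.
  have Dy := is_derive_mul (is_derive_const 2 y 'e_i) (is_derive_coord i i y).
  have := is_derive_add (is_derive_mul (Dc' i y) (is_derive_mul Dy DU))
                        (is_derive_mul (Dc i y) DDU).
  by rewrite eqxx /= mul0r add0r mulr1 => D; apply: is_derive_eq D _; rewrite /ddloc; ring.
have yb : b < sqnorm y by exact: lt_le_trans b1 y1.
rewrite /ddloc cb ?c'b ?c''b ?ltW // !mul0r !addr0; apply: far => // z zb.
by rewrite /dloc cb ?c'b ?ltW // !mul0r addr0.
Qed.

Lemma laploc_continuous : continuous laploc.
Proof. by move=> y; apply: cont_sum => i; exact: ddloc_continuous. Qed.

Lemma laploc_supported : unit_supported laploc.
Proof. by move=> y j h; rewrite /laploc big1 // => i _; exact: (@ddloc_supported i y j h). Qed.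

Lemma laploc_bounded : bounded_fun laploc.
Proof. exact: continuous_bounded laploc_continuous laploc_supported. Qed.

(** Inside, the cutoff is 1 and [U] is harmonic; outside, the cutoff and its derivatives are 0. Only
    the transition zone contributes. *)
Lemma laploc_annulus y : laploc y != 0 -> a <= sqnorm y /\ sqnorm y <= b.
Proof.
move=> h; split; rewrite leNgt; apply: contra_neqN h => hy; rewrite /laploc.
  have [c1 c1' c1''] := cutoff_left ab (ltW hy).
  have [_ _ _ E] := HU (lt_trans hy (lt_trans ab b1)).
  rewrite -[RHS]E; apply: eq_bigr => i _.
  by rewrite /ddloc /c /c' /c'' c1 c1' c1'' !mul0r !add0r mul1r.
by rewrite big1 // => i _; rewrite /ddloc cb ?c'b ?c''b ?ltW // !mul0r !addr0.
Qed.

(** The difference of the integrands is the divergence of the field [G * dloc i - loc * dG i], which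
    is supported in the unit cube. *)
Lemma green (G : rvec -> R) (dG ddG : 'I_N -> rvec -> R) :
  continuous G -> (forall i, continuous (dG i)) -> (forall i, continuous (ddG i)) ->
  (forall i y, is_derive y 'e_i G (dG i y)) ->
  (forall i y, is_derive y 'e_i (dG i) (ddG i y)) ->
  grid_int (fun y => G y * laploc y) = grid_int (fun y => loc y * \sum_i ddG i y).
Proof.
move=> cG cdG cddG DG DDG.
pose H i y := G y * dloc i y - loc y * dG i y.
pose dH i y := G y * ddloc i y - loc y * ddG i y.
have cH i : continuous (H i).
  move=> y; rewrite /H; apply: cont_sub; apply: cont_mul => //.
  - exact: dloc_continuous.
  - exact: loc_continuous.
have cdH i : continuous (dH i).
  move=> y; rewrite /dH; apply: cont_sub; apply: cont_mul => //.
  - exact: ddloc_continuous.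
  - exact: loc_continuous.
have sH i : unit_supported (H i).
  by move=> y j h; rewrite /H (@dloc_supported i y j h) (loc_supported h) mulr0 mul0r subr0.
have sdH i : unit_supported (dH i).
  by move=> y j h; rewrite /dH (@ddloc_supported i y j h) (loc_supported h) mulr0 mul0r subr0.
have DH i y : is_derive y 'e_i (H i) (dH i y).
  have := is_derive_sub (is_derive_mul (DG i y) (is_derive_dloc i y))
                        (is_derive_mul (is_derive_loc i y) (DDG i y)).
  by move=> D; apply: is_derive_eq D _; rewrite /dH; ring.
have I0 i := grid_int_divergence (cH i) (cdH i) (sH i) (sdH i) (DH i).
have bdH i := continuous_bounded (cdH i) (sdH i).
have [_ IS] := grid_int_sum (index_enum 'I_N) bdH.
have bG : bounded_fun (fun y => G y * laploc y).
  apply: continuous_bounded; first by move=> y; apply: cont_mul; [exact: cG | exact: laploc_continuous].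
  by move=> y j h; rewrite (laploc_supported h) mulr0.
have bL : bounded_fun (fun y => loc y * \sum_i ddG i y).
  apply: continuous_bounded.
    move=> y; apply: cont_mul; first exact: loc_continuous.
    by apply: cont_sum => i; exact: cddG.
  by move=> y j h; rewrite (loc_supported h) mul0r.
apply/eqP; rewrite -subr_eq0 -grid_intB //; apply/eqP.
rewrite -[RHS](_ : \sum_i grid_int (dH i) = 0); last by rewrite big1.
rewrite -IS; congr grid_int; apply/funext => y.
by rewrite /laploc !mulr_sumr -sumrB.
Qed.

End Localize.

(** * The regularized Newton kernel *)

Section NewtonKernel.
Variables (X : rvec) (e : R).
Hypothesis e0 : 0 < e.

Let s y := sqnorm (y - X) + e.

Let s_gt0 y : 0 < s y. Proof. by rewrite ltr_wpDl // sqnorm_ge0. Qed.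

(* Regularized by e > 0: as e tends to 0, [poisson_kernel] concentrates at X. *)
Definition newton y := (sqnorm (y - X) + e)^-1 ^+ lam.
Definition dnewton i y :=
  - (2 * lam%:R) * ((y 0 i - X 0 i) * (sqnorm (y - X) + e)^-1 ^+ lam.+1).
Definition ddnewton i y := - (2 * lam%:R) * (sqnorm (y - X) + e)^-1 ^+ lam.+1
  + 4 * lam%:R * lam.+1%:R * ((y 0 i - X 0 i) ^+ 2 * (sqnorm (y - X) + e)^-1 ^+ lam.+2).
Definition poisson_kernel y := e * (sqnorm (y - X) + e)^-1 ^+ lam.+2.

Let s_cont y : continuous_at y s.
Proof. by apply: cont_add; [exact: sqnormB_continuous | exact: cont_const]. Qed.

Let pow_cont k y : continuous_at y (fun y => (s y)^-1 ^+ k).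
Proof. by apply: cont_exp; apply: cont_inv; [rewrite gt_eqF | exact: s_cont]. Qed.

Let coordB_cont i y : continuous_at y (fun y : rvec => y 0 i - X 0 i).
Proof. by apply: cont_sub; [exact: coord_continuous_at | exact: cont_const]. Qed.

Lemma newton_continuous : continuous newton.
Proof. by move=> y; exact: pow_cont. Qed.

Lemma dnewton_continuous i : continuous (dnewton i).
Proof.
move=> y; rewrite /dnewton; apply: cont_mul; first exact: cont_const.
by apply: cont_mul; [exact: coordB_cont | exact: pow_cont].
Qed.

Lemma ddnewton_continuous i : continuous (ddnewton i).
Proof.
move=> y; rewrite /ddnewton; apply: cont_add; apply: cont_mul; try exact: cont_const.
  exact: pow_cont.
by apply: cont_mul; [apply: cont_exp; exact: coordB_cont | exact: pow_cont].
Qed.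

Lemma poisson_kernel_continuous : continuous poisson_kernel.
Proof. by move=> y; apply: cont_mul; [exact: cont_const | exact: pow_cont]. Qed.

Lemma poisson_kernel_ge0 y : 0 <= poisson_kernel y.
Proof. by rewrite mulr_ge0 ?exprn_ge0 ?invr_ge0 // ltW // s_gt0. Qed.

Let inv_pow_derive k (t : R) : t != 0 ->
  is_derive t 1 (fun t => t^-1 ^+ k) (- (k%:R * t^-1 ^+ k.+1)).
Proof.
move=> t0; have Di := @is_deriveV R id t 1 1 t0 (is_derive_id t 1).
have Dp := @is_deriveX R R^o id k t^-1 1 1 (is_derive_id _ _).
have D := is_derive_comp_real Di Dp.
have -> : (fun t : R => t^-1 ^+ k) = (fun t : R => (@id R ^+ k) t^-1).
  by apply/funext => u; rewrite exprfctE.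
apply: is_derive_eq D _.
rewrite /= -![_ *: _]/(_ * _) !mulr1; case: (k) => [|m] /=; first by rewrite !mul0r oppr0.
by rewrite mulrN -mulrA -exprVn -exprD addn2.
Qed.

Let s_derive i y : is_derive y 'e_i s (2 * (y 0 i - X 0 i)).
Proof.
have := is_derive_add (is_derive_sqnormB X i y) (is_derive_const e y 'e_i).
by rewrite addr0.
Qed.

Let pow_derive k i y : is_derive y 'e_i (fun y => (s y)^-1 ^+ k)
  (- (2 * k%:R) * ((y 0 i - X 0 i) * (s y)^-1 ^+ k.+1)).
Proof.
have D := is_derive_comp_real (s_derive i y) (inv_pow_derive k (lt0r_neq0 (s_gt0 y))).
by apply: is_derive_eq D _; ring.
Qed.

Lemma is_derive_newton i y : is_derive y 'e_i newton (dnewton i y).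
Proof. exact: pow_derive. Qed.

Lemma is_derive_dnewton i y : is_derive y 'e_i (dnewton i) (ddnewton i y).
Proof.
have D1 := is_derive_sub (is_derive_coord i i y) (is_derive_const (X 0 i) y 'e_i).
have D := is_derive_mul (is_derive_const (- (2 * lam%:R)) y 'e_i)
                        (is_derive_mul D1 (pow_derive lam.+1 i y)).
apply: is_derive_eq D _; rewrite eqxx /= /ddnewton /s; ring.
Qed.

(* The dimension is N = 2 lam + 2, so that |y|^(-2 lam) is harmonic away from 0. *)
Lemma laplacian_newton y :
  \sum_i ddnewton i y = - (4 * lam%:R * lam.+1%:R) * poisson_kernel y.
Proof.
rewrite /ddnewton big_split /= sumr_const card_ord -mulr_sumr -mulr_suml.
have -> : \sum_i (y 0 i - X 0 i) ^+ 2 = s y - e.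
  by rewrite /s addrK; apply: eq_bigr => i _; rewrite !mxE.
have sE : s y * (s y)^-1 = 1 by rewrite divff // gt_eqF.
rewrite /poisson_kernel -/(s y) -[X in X + _]mulr_natl /N !exprS.
have -> : (2 * lam).+2%:R = 2 * lam.+1%:R :> R by rewrite -natrM; congr _%:R; lia.
set v := (s y)^-1 in sE *.
have -> : (s y - e) * (v * (v * v ^+ lam)) = s y * v * (v * v ^+ lam) - e * (v * (v * v ^+ lam)).
  by ring.
by rewrite sE; ring.
Qed.

End NewtonKernel.

Let c0 : R := 4 * lam%:R * lam.+1%:R.

Let rmul_supported (F G : rvec -> R) : unit_supported G -> unit_supported (fun y => F y * G y).
Proof. by move=> sG y i h; rewrite (sG y i h) mulr0. Qed.

Let rmul_bounded (F G : rvec -> R) : continuous F -> continuous G -> unit_supported G ->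
  bounded_fun (fun y => F y * G y).
Proof.
move=> cF cG sG; apply: continuous_bounded; last exact: rmul_supported.
by move=> y; apply: cont_mul; [exact: cF | exact: cG].
Qed.

Lemma newton_identity U dU ddU X e : harmonic_data U dU ddU -> 0 < e ->
  grid_int (fun y => newton X e y * laploc U dU ddU y) =
  - c0 * grid_int (fun y => poisson_kernel X e y * loc U y).
Proof.
move=> HU e0; rewrite (green HU (newton_continuous (X := X) e0) (dnewton_continuous (X := X) e0)
  (ddnewton_continuous (X := X) e0) (is_derive_newton X e0) (is_derive_dnewton X e0)).
rewrite -grid_intZ; last first.
  apply: rmul_bounded (loc_supported _); first exact: poisson_kernel_continuous.
  exact: loc_continuous HU.
congr grid_int; apply/funext => y; rewrite laplacian_newton // /c0; ring.
Qed.

Lemma far_lower X : sqnorm X < a -> exists2 d : R, 0 < d &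
  forall y, a <= sqnorm y -> d <= sqnorm (y - X).
Proof.
move=> Xa; have X0 := sqnorm_ge0 X.
exists ((Num.sqrt a - Num.sqrt (sqnorm X)) ^+ 2).
  by rewrite exprn_gt0 // subr_gt0 ltr_sqrt.
move=> y ya; apply: sqnormB_ge.
- exact: sqrtr_ge0.
- by rewrite ler_wsqrtr // ltW.
- by rewrite sqr_sqrtr.
- by rewrite sqr_sqrtr // ltW.
Qed.

Let pow_lip k (x z M : R) : 0 <= z -> z <= x -> x <= M ->
  0 <= x ^+ k - z ^+ k /\ x ^+ k - z ^+ k <= (x - z) * (k%:R * (M + 1) ^+ k).
Proof.
move=> z0 zx xM; have x0 : 0 <= x by lra.
split; first by rewrite subr_ge0 lerXn2r ?nnegrE.
elim: k => [|k IH]; first by rewrite !expr0 subrr mul0r mulr0.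
have -> : x ^+ k.+1 - z ^+ k.+1 = x * (x ^+ k - z ^+ k) + (x - z) * z ^+ k.
  by rewrite !exprS; ring.
have Mk : 0 <= (M + 1) ^+ k by rewrite exprn_ge0 //; lra.
have h1 : x * (x ^+ k - z ^+ k) <= (M + 1) * ((x - z) * (k%:R * (M + 1) ^+ k)).
  apply: ler_pM => //; last by lra.
  by rewrite subr_ge0 lerXn2r ?nnegrE.
have h2 : z ^+ k <= (M + 1) * (M + 1) ^+ k.
  apply: (@le_trans _ _ ((M + 1) ^+ k)); first by rewrite lerXn2r ?nnegrE //; lra.
  by rewrite ler_peMl //; lra.
have h3 : (x - z) * z ^+ k <= (x - z) * ((M + 1) * (M + 1) ^+ k).
  by apply: ler_wpM2l h2; lra.
rewrite exprS -[k.+1%:R]natr1; lra.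
Qed.

Definition potential (g : rvec -> R) X := grid_int (fun y => (sqnorm (y - X))^-1 ^+ lam * g y).

Let kernel_annulus_bounded (g : rvec -> R) X : sqnorm X < a -> bounded_fun g ->
  (forall y, g y != 0 -> a <= sqnorm y) ->
  bounded_fun (fun y => (sqnorm (y - X))^-1 ^+ lam * g y).
Proof.
move=> Xa [B HB] ga; have [d d0 Hd] := far_lower Xa.
exists ((d^-1) ^+ lam * B) => y.
have B0 : 0 <= B by apply: le_trans (HB 0).
have [->|gn] := eqVneq (g y) 0.
  by rewrite mulr0 normr0 mulr_ge0 // exprn_ge0 // invr_ge0 ltW.
have t0 := Hd y (ga y gn); have tp : 0 < sqnorm (y - X) by lra.
rewrite normrM; apply: ler_pM => //.
rewrite ger0_norm; last by rewrite exprn_ge0 // invr_ge0 ltW.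
apply: lerXn2r; rewrite ?nnegrE ?invr_ge0; [exact: ltW | exact: ltW |].
by rewrite lef_pV2 ?posrE.
Qed.

(** The support of [g] keeps a positive distance from [X], where the regularization changes the
    kernel only by O([e]), uniformly. *)
Lemma newton_limit (g : rvec -> R) X : sqnorm X < a -> continuous g -> unit_supported g ->
  (forall y, g y != 0 -> a <= sqnorm y) ->
  exists C : R, forall e, 0 < e ->
    `|grid_int (fun y => newton X e y * g y) - potential g X| <= C * e.
Proof.
move=> Xa cg sg ga; have bg := continuous_bounded cg sg.
have [B HB] := bg; have [d d0 Hd] := far_lower Xa.
have B0 : 0 <= B by apply: le_trans (HB 0).
pose M := d^-1; have M0 : 0 < M by rewrite invr_gt0.
pose L := lam%:R * (M + 1) ^+ lam.
have L0 : 0 <= L by rewrite mulr_ge0 // exprn_ge0 //; lra.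
exists (6 ^+ N * (M ^+ 2 * L * B)) => e e0.
rewrite /potential -grid_intB; last first.
- exact: kernel_annulus_bounded.
- by apply: rmul_bounded => //; exact: newton_continuous.
rewrite -[_ * _ * e]mulrA; apply: grid_int_norm => y.
have [->|gn] := eqVneq (g y) 0.
  rewrite !mulr0 subrr normr0; apply: mulr_ge0; last exact: ltW.
  by rewrite mulr_ge0 // mulr_ge0 // sqr_ge0.
have t0 := Hd y (ga y gn); set t := sqnorm (y - X) in t0 *.
have tp : 0 < t by lra.
rewrite /newton -/t -mulrBl normrM.
have tM : t^-1 <= M by rewrite /M lef_pV2 ?posrE.
have te : 0 <= (t + e)^-1 by rewrite invr_ge0; lra.
have tte : (t + e)^-1 <= t^-1 by rewrite lef_pV2 ?posrE; lra.
have [p1 p2] := pow_lip lam te tte tM.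
rewrite distrC (ger0_norm p1) mulrAC; apply: ler_pM => //.
apply: (le_trans p2); rewrite -/L mulrAC; apply: ler_wpM2r => //.
have -> : t^-1 - (t + e)^-1 = t^-1 * (t + e)^-1 * e.
  by field; rewrite !gt_eqF //; lra.
rewrite expr2; apply: ler_wpM2r; first exact: ltW.
by apply: ler_pM => //; [rewrite invr_ge0 ltW | exact: le_trans tM].
Qed.

Let one_data : harmonic_data (fun=> 1) (fun _ _ => 0) (fun _ _ => 0).
Proof.
move=> y _; split.
- exact: cont_const.
- by move=> i; split; exact: cont_const.
- by move=> i; split; exact: is_derive_const.
- by rewrite big1.
Qed.

Let chi : rvec -> R := loc (fun=> 1).

(** Density attached to [U = 1]. Its potential plays the role of the normalizing constant of
    Newton's kernel. *)
Definition cutoff_laplacian : rvec -> R := laploc (fun=> 1) (fun _ _ => 0) (fun _ _ => 0).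

Let kappa X := potential cutoff_laplacian X.

Let small_eq0 (z C : R) : (forall e, 0 < e -> e <= 1 -> `|z| <= C * e) -> z = 0.
Proof.
move=> H; apply/eqP; rewrite -normr_le0; apply/ler_addgt0Pr => r r0; rewrite add0r.
have C1 : 0 < `|C| + 1 by rewrite ltr_wpDl.
pose e := Num.min 1 (r / (`|C| + 1)).
have e0 : 0 < e by rewrite lt_min ltr01 divr_gt0.
apply: (le_trans (H e e0 _)); first by rewrite ge_min lexx.
have : e * (`|C| + 1) <= r by rewrite -ler_pdivlMr // ge_min lexx orbT.
by have := ler_norm C; nra.
Qed.

Lemma potential_limit U dU ddU X : harmonic_data U dU ddU -> sqnorm X < a ->
  exists C : R, forall e, 0 < e ->
    `|potential (laploc U dU ddU) X + c0 * grid_int (fun y => poisson_kernel X e y * loc U y)|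
      <= C * e.
Proof.
move=> HU Xa; have [|C HC] := newton_limit Xa (laploc_continuous HU) (@laploc_supported _ _ _).
  by move=> y /(laploc_annulus HU) [].
exists C => e e0; have := HC e e0; rewrite newton_identity // distrC.
by rewrite mulNr opprK.
Qed.

Let poisson_far X d e y : 0 < e -> 0 < d -> d <= sqnorm (y - X) ->
  poisson_kernel X e y <= e * (d^-1) ^+ lam.+2.
Proof.
move=> e0 d0 dy; apply: ler_wpM2l; first exact: ltW.
rewrite lerXn2r ?nnegrE ?invr_ge0 //; try lra.
by rewrite lef_pV2 ?posrE; lra.
Qed.

Let chi_cont : continuous chi. Proof. exact: loc_continuous one_data. Qed.
Let chi_supp : unit_supported chi. Proof. exact: loc_supported. Qed.
Let chi01 y : 0 <= chi y <= 1.
Proof. by rewrite /chi /loc mulr1 cutoff_ge0 cutoff_le1. Qed.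
Let chi1 y : sqnorm y <= a -> chi y = 1.
Proof. by move=> /(cutoff_left ab) [h _ _]; rewrite /chi /loc /c h mulr1. Qed.

Let pchi_bounded X e : 0 < e -> bounded_fun (fun y => poisson_kernel X e y * chi y).
Proof. by move=> e0; apply: rmul_bounded => //; exact: poisson_kernel_continuous. Qed.

Let shiftK (y X v : rvec) : y + v - (X + v) = y - X.
Proof. by rewrite opprD addrACA subrr addr0. Qed.

(** A translation of the mean moves the shift from the kernel to [chi]. Near [X] both [chi] and its
    shift are 1, and elsewhere [poisson_kernel] is O([e]), so the two potentials differ by O([e])
    for every [e]. *)
Let kappa_shift X i (h : R) : sqnorm X < a -> sqnorm (X + h *: 'e_i) < a -> 0 <= h -> h <= 1 ->
  kappa (X + h *: 'e_i) = kappa X.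
Proof.
move=> Xa Xha h0 h1; set X' := X + h *: 'e_i in Xha *.
have [C1 H1] := potential_limit one_data Xa; have [C2 H2] := potential_limit one_data Xha.
have [d d0 Hd] := far_lower Xa; have [d' d'0 Hd'] := far_lower Xha.
pose m := Num.min d d'; have m0 : 0 < m by rewrite lt_min d0.
apply/eqP; rewrite -subr_eq0; apply/eqP.
have c00 : 0 <= c0 by rewrite /c0 !mulr_ge0.
apply: (@small_eq0 _ (C1 + C2 + c0 * (6 ^+ N * (m^-1) ^+ lam.+2))) => e e0 _.
pose P Z := grid_int (fun y => poisson_kernel Z e y * chi y).
have E : P X' = grid_int (fun y => poisson_kernel X e y * chi (y + h *: 'e_i)).
  rewrite /P -(@grid_int_shift _ _ i _ h) //.
  - congr grid_int; apply/funext => y; congr (_ * _); rewrite /poisson_kernel /X'.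
    by congr (_ * (sqnorm _ + _)^-1 ^+ _); rewrite shiftK.
  - exact: pchi_bounded.
  - exact: rmul_supported.
  - apply: continuous_line_unif; last exact: rmul_supported.
    by move=> y; apply: cont_mul; [exact: poisson_kernel_continuous | exact: chi_cont].
have bS : bounded_fun (fun y => poisson_kernel X e y * chi (y + h *: 'e_i)).
  have [B HB] := pchi_bounded X' e0; exists B => y; have := HB (y + h *: 'e_i).
  congr (_ <= _); congr `|_ * _|; rewrite /poisson_kernel /X'.
  by congr (_ * (sqnorm _ + _)^-1 ^+ _); rewrite shiftK.
have D : `|P X' - P X| <= 6 ^+ N * (e * (m^-1) ^+ lam.+2).
  rewrite E /P -grid_intB //; last exact: pchi_bounded.
  apply: grid_int_norm => y; rewrite -mulrBr normrM (ger0_norm (poisson_kernel_ge0 X e0 y)).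
  have k0 := poisson_kernel_ge0 X e0 y.
  have [ym|ym] := leP m (sqnorm (y - X)).
    rewrite -[leRHS]mulr1; apply: ler_pM => //; first exact: poisson_far.
    by have /andP[] := chi01 (y + h *: 'e_i); have /andP[] := chi01 y; rewrite ler_norml; lra.
  have -> : chi y = 1.
    apply: chi1; rewrite leNgt; apply/negP => ya; have := Hd y (ltW ya).
    by apply/negP; rewrite -ltNge (lt_le_trans ym) // ge_min lexx.
  have -> : chi (y + h *: 'e_i) = 1.
    apply: chi1; rewrite leNgt; apply/negP => ya; have := Hd' _ (ltW ya).
    by apply/negP; rewrite -ltNge /X' shiftK (lt_le_trans ym) // ge_min lexx orbT.
  rewrite subrr normr0 mulr0; apply: mulr_ge0; first exact: ltW.
  by rewrite exprn_ge0 // invr_ge0 ltW.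
have := H1 e e0; have := H2 e e0; rewrite -/(P X) -/(P X') -/(kappa X) -/(kappa X') => h2 h3.
have -> : kappa X' - kappa X = (kappa X' + c0 * P X') - (kappa X + c0 * P X) - c0 * (P X' - P X).
  by ring.
have h4 : `|c0 * (P X' - P X)| <= c0 * (6 ^+ N * (e * (m^-1) ^+ lam.+2)).
  by rewrite normrM ger0_norm // ler_wpM2l.
apply: (le_trans (ler_normB _ _)); apply: (le_trans (lerD (ler_normB _ _) h4)).
by lra.
Qed.

Let kappa_const X : sqnorm X < a -> kappa X = kappa 0.
Proof.
(* Coordinates are set to 0 one by one, which never increases [sqnorm]; a negative coordinate is
   handled by shifting in the opposite direction. *)
move=> Xa; pose T k : rvec := \row_i (if (i < k)%N then 0 else X 0 i).
have TX k : sqnorm (T k) < a.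
  apply: le_lt_trans Xa; apply: ler_sum => i _; rewrite mxE.
  by case: ifP => // _; rewrite expr0n /= sqr_ge0.
have T0 : T 0%N = X by apply/rowP => i; rewrite mxE.
have TN : T N = 0 by apply/rowP => i; rewrite !mxE ltn_ord.
rewrite -{1}T0 -TN.
have step k : (k < N)%N -> kappa (T k) = kappa (T k.+1).
  move=> kN; pose i := Ordinal kN; pose h := X 0 i.
  have E : T k = T k.+1 + h *: 'e_i.
    apply/rowP => j; rewrite !mxE [(j < k.+1)%N]ltnS [(j <= k)%N]leq_eqVlt.
    case: (eqVneq j i) => [->|ji]; first by rewrite /= ltnn eqxx /= add0r mulr1.
    have -> : (nat_of_ord j == k) = false.
      by apply/negP => /eqP jk; move/eqP: ji; apply; apply: val_inj.
    by rewrite /= mulr0 addr0.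
  have h1 : `|h| <= 1.
    rewrite leNgt; apply/negP => hh; have := coord_ge1_sqnorm (ltW hh).
    by apply/negP; rewrite -ltNge (lt_trans Xa) // (lt_trans ab).
  have [h0|h0] := leP 0 h.
    rewrite E; apply: kappa_shift; first exact: TX.
    - by rewrite -E; exact: TX.
    - by [].
    - by rewrite ger0_norm in h1.
  have E' : T k.+1 = T k + (- h) *: 'e_i by rewrite E scaleNr addrK.
  rewrite E'; apply: esym; apply: kappa_shift; first exact: TX.
  - by rewrite -E'; exact: TX.
  - by rewrite oppr_ge0 ltW.
  - by move: h1; rewrite ltr0_norm.
have : forall k, (k <= N)%N -> kappa (T 0%N) = kappa (T k).
  elim=> [_|k IH kN]; first exact: erefl.
  exact: etrans (IH (ltnW kN)) (step k kN).
move=> H; exact: H N (leqnn N).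
Qed.

Hypothesis lam0 : (0 < lam)%N.

(** The mean of [poisson_kernel 0 e * chi] stays above [q] as [e] tends to 0, while a vanishing
    potential would force [c0] times this mean to be O([e]). *)
Lemma cutoff_potential_neq0 : potential cutoff_laplacian 0 != 0.
Proof.
have c00 : 0 < c0 by rewrite /c0 !mulr_gt0 // ltr0n.
have z0 : sqnorm (0 : rvec) = 0 by rewrite /sqnorm big1 // => i _; rewrite mxE expr0n.
have [|C HC] := potential_limit (X := 0) one_data; first by rewrite z0.
have Np : 0 < (N%:R : R) by rewrite ltr0n.
pose q : R := (2^-1) ^+ lam.+2 * ((4 * N%:R)^-1) ^+ lam.+1.
have q0 : 0 < q by rewrite mulr_gt0 // exprn_gt0 // invr_gt0 ?mulr_gt0.
have low e : 0 < e -> e <= a -> q <= grid_int (fun y => poisson_kernel 0 e y * chi y).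
  (* The cube [[0, d]^N] lies in the ball [|y|^2 <= e], where the kernel is at least [k] below. As
     [N = 2 (lam + 1)], the powers of [e] in [k (d / 2)^N] cancel and leave [q]. *)
  move=> e0 ea; pose d := Num.sqrt (e / N%:R).
  have eN : 0 < e / N%:R by rewrite divr_gt0.
  have d0 : 0 < d by rewrite sqrtr_gt0.
  have d2 : d ^+ 2 = e / N%:R by rewrite sqr_sqrtr // ltW.
  have d1 : d <= 1.
    rewrite -[leRHS]sqrtr1 ler_wsqrtr // ler_pdivrMr // mul1r.
    have : 1 <= N%:R :> R by rewrite ler1n.
    by have := lt_trans ab b1; lra.
  pose k : R := e * ((2 * e)^-1) ^+ lam.+2.
  have e2 : 0 < 2 * e by rewrite mulr_gt0.
  have k0 : 0 < k by rewrite mulr_gt0 // exprn_gt0 // invr_gt0.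
  have := @grid_int_cube R N d (fun y => k^-1 * (poisson_kernel 0 e y * chi y)) d0 d1.
  rewrite grid_intZ; last exact: pchi_bounded.
  move=> H; have {}H : (d / 2) ^+ N <= k^-1 * grid_int (fun y => poisson_kernel 0 e y * chi y).
    apply: H; first by apply: bounded_funZ; exact: pchi_bounded.
      move=> y; apply: mulr_ge0; first by rewrite invr_ge0 ltW.
      rewrite mulr_ge0 ?poisson_kernel_ge0 //.
      by have /andP[] := chi01 y.
    move=> y Hy; have ye : sqnorm y <= e.
      apply: (@le_trans _ _ (\sum_(i < N) d ^+ 2)).
        by apply: ler_sum => i _; have /andP[y1 y2] := Hy i; apply: lerXn2r; rewrite ?nnegrE // ltW.
      by rewrite sumr_const card_ord -mulr_natr d2 divfK // gt_eqF.
    rewrite chi1 ?mulr1; last exact: le_trans ea.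
    rewrite mulrC ler_pdivlMr // mul1r /k /poisson_kernel subr0.
    apply: ler_wpM2l; first exact: ltW.
    have y0 := sqnorm_ge0 y.
    by rewrite lerXn2r ?nnegrE ?invr_ge0 //; [lra|lra|rewrite lef_pV2 ?posrE; lra].
  move: H; rewrite -ler_pdivrMl ?invr_gt0 // invrK; apply: le_trans.
  have -> : (d / 2) ^+ N = (e / (4 * N%:R)) ^+ lam.+1.
    have NE : N = (2 * lam.+1)%N by rewrite mulnS.
    rewrite {1}NE exprM expr_div_n d2; congr (_ ^+ _); rewrite -/N.
    by field; rewrite gt_eqF.
  rewrite /q /k le_eqVlt; apply/orP; left; apply/eqP.
  have en : e != 0 by rewrite gt_eqF.
  rewrite (invfM 2 e) exprMn [(e / _) ^+ _]exprMn [e^-1 ^+ lam.+2]exprS.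
  have E : e ^+ lam.+1 * e^-1 ^+ lam.+1 = 1 by rewrite -exprMn divff // expr1n.
  have Ee : e * e^-1 = 1 by rewrite divff.
  set u := e ^+ lam.+1 in E *; set v := e^-1 ^+ lam.+1 in E *; set w := e^-1 in Ee *.
  have -> : e * (2^-1 ^+ lam.+2 * (w * v)) * (u * (4 * N%:R)^-1 ^+ lam.+1) =
     (e * w) * (u * v) * (2^-1 ^+ lam.+2 * (4 * N%:R)^-1 ^+ lam.+1) by ring.
  by rewrite E Ee !mul1r.
apply/eqP => k0; pose e := Num.min a (c0 * q / (2 * (`|C| + 1))).
have C1 : 0 < `|C| + 1 by rewrite ltr_wpDl.
have e0 : 0 < e by rewrite lt_min a0 divr_gt0 // mulr_gt0.
have ea : e <= a by rewrite ge_min lexx.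
have eC : e * (2 * (`|C| + 1)) <= c0 * q.
  by rewrite -ler_pdivlMr ?mulr_gt0 // ge_min lexx orbT.
have := HC e e0; rewrite -/(cutoff_laplacian) k0 add0r -/chi.
have l := low e e0 ea; set I := grid_int _ in l *.
have Ic : c0 * q <= c0 * I by rewrite ler_pM2l.
have cq : 0 < c0 * q by exact: mulr_gt0.
rewrite ger0_norm; last by lra.
by have := ler_norm C; nra.
Qed.

(** [V = loc U - U X * chi] vanishes at [X], where [poisson_kernel] concentrates: its mean against
    the kernel is at most [eta] times that of [chi], up to O([e]). Both potentials are [- c0] times
    such means up to O([e]), so the first is [U X] times the one of the constant 1. *)
Theorem newton_representation U dU ddU X : harmonic_data U dU ddU -> sqnorm X < a ->
  potential (laploc U dU ddU) X = U X * potential cutoff_laplacian 0.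
Proof.
move=> HU Xa; rewrite -/(kappa 0) -(kappa_const Xa).
have [C1 H1] := potential_limit HU Xa; have [C2 H2] := potential_limit one_data Xa.
have c00 : 0 <= c0 by rewrite /c0 !mulr_ge0.
pose P e := grid_int (fun y => poisson_kernel X e y * chi y).
pose Q e := grid_int (fun y => poisson_kernel X e y * loc U y).
pose V y := loc U y - U X * chi y.
have cV : continuous V.
  move=> y; apply: cont_sub; first exact: (loc_continuous HU).
  by apply: cont_mul; [exact: cont_const | exact: chi_cont].
have sV : unit_supported V.
  by move=> y i h; rewrite /V (@loc_supported U y i h) (chi_supp h) mulr0 subr0.
have [B HB] := continuous_bounded cV sV.
have B0 : 0 <= B by apply: le_trans (HB 0).
have QE e : 0 < e -> Q e - U X * P e = grid_int (fun y => poisson_kernel X e y * V y).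
  move=> e0; rewrite /Q /P -(grid_intZ (U X) (pchi_bounded X e0)) -grid_intB.
  - by congr grid_int; apply/funext => y; rewrite /V; ring.
  - apply: rmul_bounded (loc_supported _); first exact: poisson_kernel_continuous.
    exact: loc_continuous HU.
  - by apply: bounded_funZ; exact: pchi_bounded.
have X1 : sqnorm X < 1 by exact: lt_trans Xa (lt_trans ab b1).
have VX : V X = 0.
  by rewrite /V chi1 ?(ltW Xa) // /loc (_ : c _ = 1) ?mul1r ?mulr1 ?subrr //;
     have [] := cutoff_left ab (ltW Xa).
apply/eqP; rewrite -subr_eq0 -normr_le0; apply/ler_addgt0Pr => r r0; rewrite add0r.
(* Bounds [c0 * P e] for all [e <= 1], so that [eta] can be fixed before [e]. *)
pose k := `|kappa X| + `|C2| + 1.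
have k0 : 0 < k by rewrite ltr_wpDl // addr_ge0.
pose eta := r / 2 / k.
have eta0 : 0 < eta by rewrite !divr_gt0.
have [d d0 Hd] : exists2 d : R, 0 < d &
    forall y, sqnorm (y - X) < d -> `|V y| <= eta /\ sqnorm y <= a.
  have n1 : \forall y \near X, `|V y| < eta.
    by move/cvgrPdist_lt : (cV X) => /(_ _ eta0); apply: filterS => y; rewrite VX sub0r normrN.
  have n2 : \forall y \near X, 0 < a - sqnorm y.
    apply: cont_near_gt; last by rewrite subr_gt0.
    by apply: cont_sub; [exact: cont_const | exact: sqnorm_continuous].
  have [t /= t0 Ht] := proj1 (nbhs_ballP _ _) (filterI n1 n2).
  exists (t ^+ 2); first by rewrite exprn_gt0.
  move=> y yt; have yb : ball X t y.
    split=> [//|i j]; rewrite ord1 /ball /= distrC -(ltr_pXn2r (n := 2)) ?nnegrE ?(ltW t0) //.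
    rewrite real_normK ?num_real //; apply: le_lt_trans yt.
    by have := sqr_coord_le (y - X) j; rewrite !mxE.
  have [h1 h2] := Ht y yb; split; first exact: ltW.
  by rewrite -subr_ge0 ltW.
pose D := (d^-1) ^+ lam.+2.
have D0 : 0 <= D by rewrite exprn_ge0 // invr_ge0 ltW.
have PV e y : 0 < e -> `|poisson_kernel X e y * V y| <=
    eta * (poisson_kernel X e y * chi y) + B * (e * D).
  move=> e0; have p0 := poisson_kernel_ge0 X e0 y; rewrite normrM (ger0_norm p0).
  have /andP[c1 _] := chi01 y.
  have [dy|dy] := leP d (sqnorm (y - X)).
    have h1 := poisson_far e0 d0 dy.
    have h2 : poisson_kernel X e y * `|V y| <= e * D * B by exact: ler_pM.
    have : 0 <= eta * (poisson_kernel X e y * chi y).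
      by rewrite mulr_ge0 ?(ltW eta0) // mulr_ge0.
    by rewrite [B * _]mulrC; lra.
  have [Vy ya] := Hd y dy; rewrite chi1 // mulr1.
  have : 0 <= B * (e * D) by rewrite mulr_ge0 // mulr_ge0 // ltW.
  have := ler_wpM2l p0 Vy; rewrite [eta * _]mulrC; lra.
have bPV e : 0 < e -> bounded_fun (fun y => poisson_kernel X e y * V y).
  by move=> e0; apply: rmul_bounded => //; exact: poisson_kernel_continuous.
have IPV e : 0 < e -> `|grid_int (fun y => poisson_kernel X e y * V y)| <=
    eta * P e + 6 ^+ N * (B * (e * D)).
  move=> e0.
  have bP : bounded_fun (fun y => eta * (poisson_kernel X e y * chi y)).
    by apply: bounded_funZ; exact: pchi_bounded.
  have bR := bounded_funD bP (bounded_fun_cst _ (B * (e * D))).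
  have IR : grid_int (fun y => eta * (poisson_kernel X e y * chi y) + B * (e * D)) <=
      eta * P e + 6 ^+ N * (B * (e * D)).
    rewrite grid_intD //; last exact: bounded_fun_cst.
    have EZ : grid_int (fun y => eta * (poisson_kernel X e y * chi y)) = eta * P e.
      exact: grid_intZ (pchi_bounded X e0).
    rewrite EZ; apply: lerD; first exact: lexx.
    apply: le_trans (ler_norm _) _; apply: grid_int_norm => y.
    by rewrite ger0_norm // mulr_ge0 // mulr_ge0 // ltW.
  have up y := PV e y e0.
  rewrite ler_norml; apply/andP; split.
    rewrite lerNl; apply: le_trans IR; have bV := bPV e e0.
    rewrite -(grid_intN bV).
    apply: grid_int_le => //; first exact: bounded_funN (bPV e e0).
    by move=> y; have := up y; rewrite ler_norml => /andP[]; lra.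
  apply: le_trans IR; apply: grid_int_le => //; first exact: bPV.
  by move=> y; have := up y; rewrite ler_norml => /andP[].
pose L := `|C1| + `|U X| * `|C2| + c0 * (6 ^+ N * (B * D)) + 1.
have BD0 : 0 <= c0 * (6 ^+ N * (B * D)) by rewrite mulr_ge0 // mulr_ge0 ?exprn_ge0 // mulr_ge0.
have L0 : 0 < L by rewrite ltr_wpDl // !addr_ge0 // mulr_ge0.
pose e := Num.min 1 (r / 2 / L).
have e0 : 0 < e by rewrite lt_min ltr01 !divr_gt0.
have e1 : e <= 1 by rewrite ge_min lexx.
have eL : e * L <= r / 2 by rewrite -ler_pdivlMr // ge_min lexx orbT.
have h1 := H1 e e0; have h2 := H2 e e0.
rewrite -/(Q e) in h1; rewrite -/(P e) -/(kappa X) in h2.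
have -> : potential (laploc U dU ddU) X - U X * kappa X =
  (potential (laploc U dU ddU) X + c0 * Q e) - U X * (kappa X + c0 * P e) - c0 * (Q e - U X * P e).
  by ring.
have h3 : c0 * P e <= k.
  have : `|c0 * P e| <= `|kappa X| + `|kappa X + c0 * P e|.
    by have := ler_normB (kappa X + c0 * P e) (kappa X); rewrite [_ - kappa X]addrC addKr addrC.
  have := ler_norm (c0 * P e); have := ler_norm C2.
  have : C2 * e <= `|C2|.
    apply: (@le_trans _ _ (`|C2| * e)); first by rewrite ler_wpM2r ?ler_norm // ltW.
    by rewrite -[leRHS]mulr1 ler_wpM2l.
  by rewrite /k; lra.
have h4 : `|c0 * (Q e - U X * P e)| <= eta * k + e * (c0 * (6 ^+ N * (B * D))).
  rewrite normrM (ger0_norm c00) QE //; apply: (le_trans (ler_wpM2l c00 (IPV e e0))).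
  have := ler_wpM2l (ltW eta0) h3.
  have -> : c0 * (eta * P e + 6 ^+ N * (B * (e * D))) =
     eta * (c0 * P e) + e * (c0 * (6 ^+ N * (B * D))) by ring.
  by lra.
have h5 : `|U X * (kappa X + c0 * P e)| <= e * (`|U X| * `|C2|).
  rewrite normrM mulrCA; apply: ler_wpM2l => //; apply: (le_trans h2).
  by rewrite mulrC; apply: ler_wpM2l; [exact: ltW | exact: ler_norm].
have h6 : C1 * e <= e * `|C1| by rewrite mulrC; apply: ler_wpM2l; [exact: ltW | exact: ler_norm].
have h7 : eta * k = r / 2 by rewrite /eta divfK // gt_eqF.
apply: (le_trans (ler_normB _ _)); apply: (le_trans (lerD (ler_normB _ _) h4)).
by rewrite h7; move: eL; rewrite /L; lra.
Qed.

End HarmonicRepresentation.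

(** * Lifting polyharmonic functions to harmonic ones *)

Section HarmonicLift.
Variables (R : realType) (n : nat).
Let N := (2 * n).+2.
Local Notation rvec := 'rV[R]_n.
Local Notation Rvec := 'rV[R]_N.

Let nN : (n <= N)%N. Proof. by rewrite /N; lia. Qed.
Let nN' : (n < N)%N. Proof. by rewrite /N; lia. Qed.

Definition lift_index (i : 'I_n) : 'I_N := widen_ord nN i.
(** The first coordinate after those of [x]; it carries the harmonic variable [t]. *)
Definition extra_index : 'I_N := Ordinal nN'.
Definition lift_proj (Y : Rvec) : rvec := \row_i Y 0 (lift_index i).
Definition lift_point (x : rvec) : Rvec :=
  \row_k (if insub (k : nat) is Some i then x 0 i else 0).

Lemma insub_lift_index (i : 'I_n) : insub (lift_index i : nat) = Some i.
Proof. by rewrite (_ : (lift_index i : nat) = val i) // valK. Qed.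

Lemma sum_insub (F : 'I_n -> R) :
  \sum_(k < N) (if insub (k : nat) is Some i then F i else 0) = \sum_(i < n) F i.
Proof.
rewrite -(big_mkord xpredT (fun k => if insub k is Some i then F i else 0)).
rewrite (@big_cat_nat _ _ _ n) //= [X in _ + X]big_nat_cond [X in _ + X]big1 ?addr0.
  by rewrite big_mkord; apply: eq_bigr => i _; rewrite valK.
by move=> k /andP[/andP[nk _] _]; rewrite insubF // ltnNge nk.
Qed.

Lemma sqnorm_lift_point x : sqnorm (lift_point x) = sqnorm x.
Proof.
rewrite /sqnorm -sum_insub; apply: eq_bigr => k _; rewrite mxE.
by case: insub => [i|//]; rewrite ?expr0n.
Qed.

Lemma sum_lift_index (Y : Rvec) :
  sqnorm (lift_proj Y) = \sum_(k < N) (if (insub (k : nat) : option 'I_n) is Some _ then Y 0 k ^+ 2 else 0).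
Proof.
transitivity (\sum_(i < n) Y 0 (lift_index i) ^+ 2).
  by apply: eq_bigr => i _; rewrite mxE.
rewrite -sum_insub; apply: eq_bigr => k _.
case: insubP => // i _ ik; congr (Y 0 _ ^+ 2); exact: val_inj.
Qed.

Lemma sqnorm_lift_proj_le Y : sqnorm (lift_proj Y) <= sqnorm Y.
Proof.
rewrite sum_lift_index; apply: ler_sum => k _.
by case: insub => [i|]; rewrite ?sqr_ge0 ?lexx.
Qed.

Lemma lift_pointK x : lift_proj (lift_point x) = x.
Proof. by apply/rowP => i; rewrite !mxE insub_lift_index. Qed.

Lemma lift_proj_line (k : 'I_N) (h : R) Y : lift_proj (h *: 'e_k + Y) =
  (if insub (k : nat) is Some i then h *: 'e_i else 0) + lift_proj Y.
Proof.
apply/rowP => j; rewrite !mxE; congr (_ + _).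
case: insubP => [i _ ik|hk]; rewrite !mxE /=.
  congr (_ * (nat_of_bool _)%:R); apply/eqP/eqP => [h1|->]; apply: val_inj => /=.
    by rewrite ik -h1.
  by rewrite -ik.
rewrite (_ : lift_index j == k = false) ?mulr0 //.
by apply/eqP => h1; move: hk; rewrite -h1 /= ltn_ord.
Qed.

Lemma lift_proj_continuous : continuous lift_proj.
Proof.
move=> Y A /nbhs_ballP[e e0 H]; apply/nbhs_ballP; exists e => // Z [_ HZ].
by apply: H; split=> // i j; rewrite !mxE; exact: HZ.
Qed.

(** [v j] stands for the [j]-th iterated Laplacian of a real function, [d] and [dd] for its first
    and pure second derivatives. *)
Definition polyharmonic_data (p : nat) (v : nat -> rvec -> R) (d dd : 'I_n -> nat -> rvec -> R) :=
  forall x, sqnorm x < 1 -> [/\ forall j, continuous_at x (v j),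
    forall i j, continuous_at x (d i j) /\ continuous_at x (dd i j),
    forall i j, is_derive x 'e_i (v j) (d i j x) /\ is_derive x 'e_i (d i j) (dd i j x),
    forall j, \sum_i dd i j x = v j.+1 x & v p x = 0].

Variables (p : nat) (v : nat -> rvec -> R) (d dd : 'I_n -> nat -> rvec -> R).
Hypothesis Hv : polyharmonic_data p v d dd.

Definition even_coef (j : nat) (t : R) : R := (-1) ^+ j * (t ^+ j.*2 / (j.*2)`!%:R).
Definition even_coef' (j : nat) (t : R) : R :=
  if j is j'.+1 then (-1) ^+ j * (t ^+ (j'.*2).+1 / ((j'.*2).+1)`!%:R) else 0.
Definition even_coef'' (j : nat) (t : R) : R := if j is j'.+1 then - even_coef j' t else 0.

Let is_derive_pow k (t : R) : is_derive t 1 (fun t => t ^+ k.+1 / (k.+1)`!%:R) (t ^+ k / k`!%:R).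
Proof.
have Dp := @is_deriveX R R^o id k.+1 t 1 1 (is_derive_id _ _).
have D := is_derive_mul Dp (is_derive_const ((k.+1)`!%:R^-1) t 1).
have -> : (fun t : R => t ^+ k.+1 / (k.+1)`!%:R) =
          (fun t : R => (@id R ^+ k.+1) t / (k.+1)`!%:R).
  by apply/funext => u; rewrite exprfctE.
apply: is_derive_eq D _; rewrite /= mulr0 addr0 -[_ *: _]/(_ * _) mulr1 factS natrM.
have k0 : (k.+1%:R : R) != 0 by rewrite pnatr_eq0.
have f0 : (k`!%:R : R) != 0 by rewrite pnatr_eq0 -lt0n fact_gt0.
by field; rewrite f0 addrC natr1.
Qed.

Let is_derive_even j (t : R) : is_derive t 1 (even_coef j) (even_coef' j t).
Proof.
case: j => [|j].
  rewrite (_ : even_coef 0 = fun=> 1); first exact: is_derive_const.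
  by apply/funext => u; rewrite /even_coef /= !expr0 fact0 mul1r divr1.
have := is_derive_mul (is_derive_const ((-1) ^+ j.+1) t 1) (is_derive_pow (j.*2).+1 t).
by rewrite mul0r add0r.
Qed.

Let is_derive_even' j (t : R) : is_derive t 1 (even_coef' j) (even_coef'' j t).
Proof.
case: j => [|j]; first exact: is_derive_const.
have := is_derive_mul (is_derive_const ((-1) ^+ j.+1) t 1) (is_derive_pow (j.*2) t).
by move=> D; apply: is_derive_eq D _; rewrite /= /even_coef [(-1) ^+ j.+1]exprS mul0r add0r mulN1r mulNr.
Qed.

Let even_cont j (t : R) : continuous_at t (even_coef j).
Proof.
by apply: differentiable_continuous; apply/derivable1_diffP; have [] := is_derive_even j t.
Qed.

Let even_cont' j (t : R) : continuous_at t (even_coef' j).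
Proof.
by apply: differentiable_continuous; apply/derivable1_diffP; have [] := is_derive_even' j t.
Qed.

Let even_cont'' j (t : R) : continuous_at t (even_coef'' j).
Proof.
case: j => [|j]; first exact: cont_const.
rewrite (_ : even_coef'' j.+1 = fun t => 0 - even_coef j t).
  by apply: cont_sub; [exact: cont_const | exact: even_cont].
by apply/funext => u; rewrite sub0r.
Qed.

Let t_ (Y : Rvec) : R := Y 0 extra_index.
Let sel (k : 'I_N) : R := (extra_index == k)%:R.
Let D (w : 'I_n -> nat -> rvec -> R) (k : 'I_N) j (x : rvec) : R :=
  if insub (k : nat) is Some i then w i j x else 0.

Let selD w k j x : sel k * D w k j x = 0.
Proof.
rewrite /sel /D; case: eqP => [<-|_]; last by rewrite mul0r.
by rewrite insubF ?mulr0 //= ltnn.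
Qed.

(* The Cauchy-Kovalevskaya solution of (Laplacian + d^2/dt^2) U = 0 with U = v 0
   and dU/dt = 0 at t = 0; it is a finite sum because Laplacian^p (v 0) = 0. *)
Definition lift_harmonic (Y : Rvec) : R :=
  \sum_(j < p) even_coef j (t_ Y) * v j (lift_proj Y).
Definition lift_harmonic' (k : 'I_N) (Y : Rvec) : R :=
  \sum_(j < p) (even_coef' j (t_ Y) * sel k * v j (lift_proj Y)
                + even_coef j (t_ Y) * D d k j (lift_proj Y)).
Definition lift_harmonic'' (k : 'I_N) (Y : Rvec) : R :=
  \sum_(j < p) (even_coef'' j (t_ Y) * sel k * v j (lift_proj Y)
                + even_coef j (t_ Y) * D dd k j (lift_proj Y)).

Let comp_cont (F : rvec -> R) Y : continuous_at (lift_proj Y) F ->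
  continuous_at Y (fun Y => F (lift_proj Y)).
Proof. by move=> cF; apply: (@continuous_comp _ _ _ lift_proj F) => //; exact: lift_proj_continuous. Qed.

Let coef_cont (g : R -> R) Y : (forall t, continuous_at t g) -> continuous_at Y (fun Y => g (t_ Y)).
Proof. by move=> cg; apply: (@cont_comp _ _ t_ g); [exact: coord_continuous_at | exact: cg]. Qed.

Let D_cont w k j x : (forall i, continuous_at x (w i j)) -> continuous_at x (D w k j).
Proof. by rewrite /D => cw; case: insub => [i|]; [exact: cw | exact: cont_const]. Qed.

Let comp_derive (F : rvec -> R) (w : 'I_n -> R) (k : 'I_N) Y :
  (forall i, is_derive (lift_proj Y) 'e_i F (w i)) ->
  is_derive Y 'e_k (fun Y => F (lift_proj Y)) (if insub (k : nat) is Some i then w i else 0).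
Proof.
move=> H; apply/is_derive_line.
have -> : (fun h : R => F (lift_proj (h *: 'e_k + Y))) =
  (fun h : R => F ((if insub (k : nat) is Some i then h *: 'e_i else 0) + lift_proj Y)).
  by apply/funext => h; rewrite lift_proj_line.
case: insub => [i|]; first exact: (proj1 (is_derive_line _ _ _ _) (H i)).
exact: is_derive_const.
Qed.

Let coef_derive (g g' : R -> R) (k : 'I_N) Y : (forall t : R, is_derive t 1 g (g' t)) ->
  is_derive Y 'e_k (fun Y => g (t_ Y)) (g' (t_ Y) * sel k).
Proof. by move=> H; exact: is_derive_comp_real (is_derive_coord k extra_index Y) (H _). Qed.

Let sum_derive (F : 'I_p -> Rvec -> R) (dF : 'I_p -> R) Y (k : 'I_N) :
  (forall j, is_derive Y 'e_k (F j) (dF j)) ->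
  is_derive Y 'e_k (fun Y => \sum_j F j Y) (\sum_j dF j).
Proof.
move=> H; elim: (index_enum 'I_p) => [|j s IH].
  rewrite big_nil (_ : (fun Y => _) = fun=> 0); first exact: is_derive_const.
  by apply/funext => Z; rewrite big_nil.
rewrite big_cons (_ : (fun Y => _) = fun Y => F j Y + \sum_(j <- s) F j Y).
  exact: is_derive_add.
by apply/funext => Z; rewrite big_cons.
Qed.

(* The Laplacian of the sum over j telescopes. *)
Lemma lift_harmonic_data : harmonic_data lift_harmonic lift_harmonic' lift_harmonic''.
Proof.
move=> Y Y1; have x1 := le_lt_trans (sqnorm_lift_proj_le Y) Y1.
have [cv cd Dv Sdd vp] := Hv x1; split.
- apply: cont_sum => j; apply: cont_mul; first by apply: coef_cont; exact: even_cont.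
  exact: comp_cont.
- move=> k; split; apply: cont_sum => j; apply: cont_add; apply: cont_mul.
  + by apply: cont_mul; [apply: coef_cont; exact: even_cont' | exact: cont_const].
  + exact: comp_cont.
  + by apply: coef_cont; exact: even_cont.
  + by apply: comp_cont; apply: D_cont => i; have [] := cd i j.
  + by apply: cont_mul; [apply: coef_cont; exact: even_cont'' | exact: cont_const].
  + exact: comp_cont.
  + by apply: coef_cont; exact: even_cont.
  + by apply: comp_cont; apply: D_cont => i; have [] := cd i j.
- move=> k; split; apply: sum_derive => j.
    have D1 := coef_derive k Y (is_derive_even j).
    have D2 := @comp_derive (v j) (fun i => d i j (lift_proj Y)) k Y (fun i => proj1 (Dv i j)).
    exact: is_derive_mul D1 D2.
  have D1 := coef_derive k Y (is_derive_even j).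
  have D1' := is_derive_mul (coef_derive k Y (is_derive_even' j)) (is_derive_const (sel k) Y 'e_k).
  have D2 := @comp_derive (v j) (fun i => d i j (lift_proj Y)) k Y (fun i => proj1 (Dv i j)).
  have D3 : is_derive Y 'e_k (fun Y => D d k j (lift_proj Y)) (D dd k j (lift_proj Y)).
    rewrite /D; case E: (insub (k : nat)) => [i|]; last exact: is_derive_const.
    apply/is_derive_line.
    have -> : (fun h : R => d i j (lift_proj (h *: 'e_k + Y))) =
              (fun h : R => d i j (h *: 'e_i + lift_proj Y)).
      by apply/funext => h; rewrite lift_proj_line E.
    have [_ Dd] := Dv i j; exact: (proj1 (is_derive_line _ _ _ _) Dd).
  have := is_derive_add (is_derive_mul D1' D2) (is_derive_mul D1 D3).
  move=> DD; apply: is_derive_eq DD _; rewrite -/(D d k j (lift_proj Y)) mulr0 addr0.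
  (* [t] is not among the coordinates of [x], so the mixed terms [sel * D] of the product rule
     vanish. *)
  have s2 : sel k * sel k = sel k by rewrite /sel -natrM mulnb andbb.
  have z := selD d k j (lift_proj Y).
  set a := even_coef'' j _; set b := even_coef' j _; set e := even_coef j _.
  set w := v j _; set u := D dd k j _; set q := D d k j _ in z *.
  have -> : a * sel k * sel k * w + b * sel k * q + (b * sel k * q + e * u) =
     a * (sel k * sel k) * w + 2 * b * (sel k * q) + e * u by ring.
  by rewrite s2 z; ring.
rewrite /lift_harmonic'' exchange_big /=.
have sumsel : \sum_k sel k = 1.
  by rewrite (bigD1 extra_index) //= /sel eqxx big1 ?addr0 // => k /negPf; rewrite eq_sym => ->.
rewrite (eq_bigr (fun j : 'I_p => even_coef'' j (t_ Y) * v j (lift_proj Y) +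
   even_coef j (t_ Y) * v j.+1 (lift_proj Y))); last first.
  move=> j _; rewrite big_split /= -mulr_sumr -Sdd /D sum_insub; congr (_ + _).
  rewrite (eq_bigr (fun k => even_coef'' j (t_ Y) * v j (lift_proj Y) * sel k)).
    by rewrite -mulr_sumr sumsel mulr1.
  by move=> k _; rewrite mulrAC.
(* Since [even_coef'' j.+1] is minus [even_coef j], a partial sum leaves only its last term, a
   multiple of [v q]; this is 0 for [q = p]. *)
have tele q : \sum_(j < q) (even_coef'' j (t_ Y) * v j (lift_proj Y) +
   even_coef j (t_ Y) * v j.+1 (lift_proj Y)) = - even_coef'' q (t_ Y) * v q (lift_proj Y).
  elim: q => [|q IH]; first by rewrite big_ord0 oppr0 mul0r.
  rewrite big_ord_recr /= IH opprK; ring.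
by rewrite tele vp mulr0.
Qed.

Lemma lift_harmonic_point x : (0 < p)%N -> lift_harmonic (lift_point x) = v 0 x.
Proof.
move=> p0; have t0 : t_ (lift_point x) = 0.
  by rewrite /t_ mxE insubF //= ltnn.
rewrite /lift_harmonic t0 lift_pointK; case: p p0 => // q _.
rewrite big_ord_recl big1 ?addr0 /even_coef.
  by rewrite /= !expr0 fact0 divr1 !mul1r.
by move=> j _; rewrite /= doubleS expr0n /= mul0r mulr0 mul0r.
Qed.

(** The factor [k] stays abstract: what matters is that it is a nonzero constant, by which the
    functional will be divided. *)
Theorem polyharmonic_representation (r : R) : (0 < n)%N -> (0 < p)%N -> 0 < r -> r < 1 ->
  exists (g : Rvec -> R) (k : R), [/\ bounded_fun g, k != 0,
    forall Y, g Y != 0 -> r ^+ 2 <= sqnorm Y /\ sqnorm Y <= 1 &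
    forall x, sqnorm x < r ^+ 2 ->
      grid_int (fun Y => (sqnorm (Y - lift_point x))^-1 ^+ n * g Y) = v 0 x * k].
Proof.
move=> n0 p0 r0 r1; pose a := r ^+ 2; pose b := (a + 1) / 2.
have a0 : 0 < a by rewrite exprn_gt0.
have a1 : a < 1 by rewrite exprn_ilt1 // ltW.
have ab : a < b by rewrite /b; lra.
have b1 : b < 1 by rewrite /b; lra.
exists (@laploc R n a b lift_harmonic lift_harmonic' lift_harmonic''), (potential (cutoff_laplacian (lam := n) a b) 0).
split.
- exact: laploc_bounded lift_harmonic_data.
- exact: cutoff_potential_neq0.
- move=> Y /(laploc_annulus ab b1 lift_harmonic_data) [h1 h2]; split=> //.
  exact: le_trans h2 (ltW b1).
move=> x xr; rewrite -(lift_harmonic_point _ p0).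
by apply: newton_representation => //; [exact: lift_harmonic_data | rewrite sqnorm_lift_point].
Qed.

End HarmonicLift.

(** * The complexified kernel *)

Section ComplexFunctional.
Variables (R : realType) (N : nat).
Local Notation Rvec := 'rV[R]_N.

Definition weighted_functional (g : Rvec -> R) (k : Rvec -> Cplx R) : Cplx R :=
  (grid_int (fun Y => g Y * complex.Re (k Y)) +i* grid_int (fun Y => g Y * complex.Im (k Y)))%C.

Variables (S : set Rvec) (g : Rvec -> R).
Hypothesis gB : bounded_fun g.
Hypothesis gS : forall Y, g Y != 0 -> S Y.
Hypothesis S0 : S !=set0.

Let weight_bound (h : Rvec -> R) (C : R) Y : (forall Y, S Y -> `|h Y| <= C) ->
  `|g Y * h Y| <= `|g Y| * C.
Proof.
move=> H; rewrite normrM; have [->|g0] := eqVneq (g Y) 0; first by rewrite normr0 !mul0r.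
by rewrite ler_wpM2l // H //; exact: gS.
Qed.

Let weight_bounded (h : Rvec -> R) (C : R) : (forall Y, S Y -> `|h Y| <= C) ->
  bounded_fun (fun Y => g Y * h Y).
Proof.
move=> H; have [B HB] := gB; exists (B * `|C|) => Y.
apply: le_trans (weight_bound Y H) _; apply: le_trans (ler_wpM2l _ (ler_norm C)) _ => //.
by rewrite ler_wpM2r.
Qed.

Lemma weighted_functional_bounded : exists2 K : R, 0 <= K & bounded_functional S (weighted_functional g) K.
Proof.
have [B HB] := gB; have B0 : 0 <= B by apply: le_trans (HB 0).
have p6 : 0 <= 6 ^+ N :> R by rewrite exprn_ge0.
exists (6 ^+ N * B * 2); first by rewrite !mulr_ge0.
split.
  move=> k1 k2 [a1 a2] [C1 H1] [C2 H2].
  have bR k C : (forall y, S y -> modulus (k y) <= C) ->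
      bounded_fun (fun Y => g Y * complex.Re (k Y)).
    by move=> H; apply: (@weight_bounded _ C) => y /H; apply: le_trans; exact: Re_le_modulus.
  have bI k C : (forall y, S y -> modulus (k y) <= C) ->
      bounded_fun (fun Y => g Y * complex.Im (k Y)).
    by move=> H; apply: (@weight_bounded _ C) => y /H; apply: le_trans; exact: Im_le_modulus.
  have R1 := bR _ _ H1; have I1 := bI _ _ H1; have R2 := bR _ _ H2; have I2 := bI _ _ H2.
  rewrite /weighted_functional; apply/eqP; rewrite eq_complex; apply/andP; split; apply/eqP => /=.
    rewrite -!grid_intZ // -grid_intB; [|exact: bounded_funZ|exact: bounded_funZ].
    rewrite -grid_intD //; last by apply: bounded_funB; exact: bounded_funZ.
    by congr grid_int; apply/funext => Y; case: (k1 Y) (k2 Y) => [x1 y1] [x2 y2] /=; ring.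
  rewrite -!grid_intZ // -grid_intD; [|exact: bounded_funZ|exact: bounded_funZ].
  rewrite -grid_intD //; last by apply: bounded_funD; exact: bounded_funZ.
  by congr grid_int; apply/funext => Y; case: (k1 Y) (k2 Y) => [x1 y1] [x2 y2] /=; ring.
(* A point of [S] makes [C] nonnegative, which the bound of [|g Y| * C] by [B * C] requires. *)
move=> k C H; have [Y0 SY0] := S0; have C0 : 0 <= C := le_trans (modulus_ge0 _) (H _ SY0).
have est (h : Rvec -> R) : (forall Y, S Y -> `|h Y| <= C) ->
    `|grid_int (fun Y => g Y * h Y)| <= 6 ^+ N * (B * C).
  move=> Hh; apply: grid_int_norm => Y; apply: le_trans (weight_bound Y Hh) _.
  by rewrite ler_wpM2r.
apply: le_trans (modulus_le_ReIm _) _.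
have -> : 6 ^+ N * B * 2 * C = 6 ^+ N * (B * C) + 6 ^+ N * (B * C) by ring.
apply: lerD; apply: est => Y SY; apply: le_trans (H Y SY).
  exact: Re_le_modulus.
exact: Im_le_modulus.
Qed.

End ComplexFunctional.

Lemma bounded_functional_comb (R : realType) (T : Type) (S : set T)
    (J1 J2 : (T -> Cplx R) -> Cplx R) (K1 K2 : R) (a1 a2 : Cplx R) :
  bounded_functional S J1 K1 -> bounded_functional S J2 K2 ->
  bounded_functional S (fun k => a1 * J1 k + a2 * J2 k) (modulus a1 * K1 + modulus a2 * K2).
Proof.
move=> [L1 B1] [L2 B2]; split.
  by move=> k1 k2 a H1 H2; rewrite L1 // L2 //; ring.
move=> k C H; apply: le_trans (modulusD _ _) _; rewrite !modulusM mulrDl -!mulrA.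
by apply: lerD; apply: ler_wpM2l (modulus_ge0 _) _ _ _; [exact: B1 | exact: B2].
Qed.

(** * The extension as a potential over an annulus *)

Section PolyharmonicPotential.
Variables (R : realType) (n p : nat).
Let N := (2 * n).+2.
Local Notation Rvec := 'rV[R]_N.

Definition annulus (r : R) : set Rvec := [set Y | r ^+ 2 <= sqnorm Y /\ sqnorm Y <= 1].
Definition proj_point (Y : Rvec) (i : 'I_n) : Cplx R := ((lift_proj Y 0 i)%:C)%C.
(** The part of [|Y|^2] coming from the coordinates beyond [n], where [lift_point x] is 0. With it,
    [point_quad z Y] is the complexification in [x] of [|Y - lift_point x|^2]. *)
Definition extra_sqnorm (Y : Rvec) : Cplx R := ((sqnorm Y - sqnorm (lift_proj Y))%:C)%C.
Definition point_quad := kernel_quad proj_point extra_sqnorm.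

Lemma sqnorm_sub_lift_point Y (x : 'rV[R]_n) :
  sqnorm (Y - lift_point x) = sqnorm (x - lift_proj Y) + (sqnorm Y - sqnorm (lift_proj Y)).
Proof.
have -> : sqnorm (Y - lift_point x) = sqnorm Y + \sum_(k < N)
    (if insub (k : nat) is Some i then x 0 i ^+ 2 - 2 * x 0 i * Y 0 (lift_index i) else 0).
  rewrite /sqnorm -big_split; apply: eq_bigr => k _; rewrite !mxE.
  case: insubP => [i _ ik|_] /=; last by rewrite subr0 addr0.
  by rewrite (_ : lift_index i = k); [ring | exact: val_inj].
rewrite sum_insub [RHS]addrCA; congr (_ + _); rewrite /sqnorm -sumrB.
by apply: eq_bigr => i _; rewrite !mxE; ring.
Qed.

Lemma point_quad_real (x : 'rV[R]_n) Y :
  point_quad (toC x) Y = ((sqnorm (Y - lift_point x))%:C)%C.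
Proof.
rewrite /point_quad /kernel_quad sqnorm_sub_lift_point rmorphD; congr (_ + _).
rewrite /sqnorm rmorph_sum; apply: eq_bigr => i _.
rewrite /proj_point !mxE; apply/eqP; rewrite eq_complex /=.
by apply/andP; split; apply/eqP; ring.
Qed.

Lemma polyharmonic_potential (v d dd vI dI ddI : _) (r : R) :
  polyharmonic_data p v d dd -> polyharmonic_data p vI dI ddI ->
  (0 < n)%N -> (0 < p)%N -> 0 < r -> r < 1 ->
  exists (J : (Rvec -> Cplx R) -> Cplx R) (K : R),
    [/\ bounded_functional (annulus r) J K, 0 <= K &
    forall x : 'rV[R]_n, sqnorm x < r ^+ 2 ->
      J (fun Y => (point_quad (toC x) Y)^-1 ^+ n) = (v 0%N x +i* vI 0%N x)%C].
Proof.
move=> H HI n0 p0 r0 r1.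
have [g [k [gB k0 gS Hg]]] := polyharmonic_representation H n0 p0 r0 r1.
have [gI [kI [gIB kI0 gIS HgI]]] := polyharmonic_representation HI n0 p0 r0 r1.
have A0 : annulus r !=set0.
  exists ('e_ord0); have -> : annulus r 'e_ord0 = (r ^+ 2 <= 1 /\ 1 <= 1 :> R).
    rewrite /annulus /= (_ : sqnorm _ = 1) // /sqnorm (bigD1 ord0) //= !mxE eqxx expr1n.
    by rewrite big1 ?addr0 // => i /negPf i0; rewrite mxE i0 andbF expr0n.
  by split=> //; rewrite exprn_ile1 // ltW.
have [K K0 HK] := weighted_functional_bounded gB gS A0.
have [KI KI0 HKI] := weighted_functional_bounded gIB gIS A0.
(* The densities are real, so [u] is represented through its real and imaginary parts, each with its
   own constant; the second enters with a factor [i]. *)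
pose a1 : Cplx R := ((k^-1)%:C)%C; pose a2 : Cplx R := (0 +i* kI^-1)%C.
exists (fun F => a1 * weighted_functional g F + a2 * weighted_functional gI F).
exists (modulus a1 * K + modulus a2 * KI); split.
- exact: bounded_functional_comb.
- by rewrite addr_ge0 // mulr_ge0 // modulus_ge0.
move=> x xr.
have E Y : (point_quad (toC x) Y)^-1 ^+ n = (((sqnorm (Y - lift_point x))^-1 ^+ n)%:C)%C.
  by rewrite point_quad_real rmorphXn fmorphV.
have W (g' : Rvec -> R) : weighted_functional g' (fun Y => (point_quad (toC x) Y)^-1 ^+ n) =
    ((grid_int (fun Y => (sqnorm (Y - lift_point x))^-1 ^+ n * g' Y))%:C)%C.
  rewrite /weighted_functional; apply/eqP; rewrite eq_complex; apply/andP; split; apply/eqP => /=.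
    by congr grid_int; apply/funext => Y; rewrite E /= mulrC.
  have Z := grid_intZ 0 (bounded_fun_cst N (0 : R)); rewrite !mul0r in Z; rewrite -[RHS]Z.
  by congr grid_int; apply/funext => Y; rewrite E /= !mulr0.
rewrite !W Hg // HgI // /a1 /a2; apply/eqP; rewrite eq_complex; apply/andP; split; apply/eqP => /=.
  by rewrite !(mul0r, mulr0) !subr0 addr0 mulrC mulfK.
by rewrite !(mul0r, mulr0) !add0r mulrC mulfK.
Qed.

End PolyharmonicPotential.

(** * Rotated points of the ball avoid the zeros of the kernel *)

Section RotatedBall.
Variables (R : realType) (n : nat).
Local Notation rvec := 'rV[R]_n.

(* With z = e^{i psi} x, a = |x|, b = |Y|, s = x . Y and c = cos psi, the right
   hand side is the squared modulus of z^2 - 2 z Y + |Y|^2. *)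
Lemma rotation_lower_bound (c s a b : R) : 0 <= a -> 0 <= b -> s ^+ 2 <= (a * b) ^+ 2 ->
  c ^+ 2 <= 1 ->
  (b - a) ^+ 4 <= ((2 * c ^+ 2 - 1) * a ^+ 2 - 2 * c * s + b ^+ 2) ^+ 2
                  + 4 * (1 - c ^+ 2) * (c * a ^+ 2 - s) ^+ 2.
Proof.
move=> a0 b0 sab c1; pose P := a ^+ 2 + b ^+ 2; pose Q := 2 * (a * b); pose t := 2 * s.
(* Here [P - Q = (a - b)^2], and [|s c| <= a b] gives [Q - t c >= 0], so both summands are
   nonnegative. *)
rewrite -subr_ge0; have -> : ((2 * c ^+ 2 - 1) * a ^+ 2 - 2 * c * s + b ^+ 2) ^+ 2
   + 4 * (1 - c ^+ 2) * (c * a ^+ 2 - s) ^+ 2 - (b - a) ^+ 4 =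
   (t - c * Q) ^+ 2 + 2 * (P - Q) * (Q - t * c).
  by rewrite /P /Q /t; ring.
have PQ : 0 <= P - Q.
  by rewrite (_ : P - Q = (a - b) ^+ 2) ?sqr_ge0 // /P /Q; ring.
have ab0 : 0 <= a * b by exact: mulr_ge0.
have tQ : `|s * c| <= a * b.
  rewrite -(ler_pXn2r (n := 2)) ?nnegrE // -normrX ger0_norm ?sqr_ge0 // exprMn.
  apply: le_trans sab; by rewrite -[leRHS]mulr1 ler_wpM2l ?sqr_ge0.
rewrite addr_ge0 ?sqr_ge0 // mulr_ge0 ?mulr_ge0 //.
have := ler_norm (s * c); rewrite /Q /t; lra.
Qed.

Lemma sqr_modulus (z : Cplx R) : modulus z ^+ 2 = complex.Re z ^+ 2 + complex.Im z ^+ 2.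
Proof.
case: z => x y; rewrite /modulus /normc /= sqr_sqrtr //.
by rewrite addr_ge0 ?sqr_ge0.
Qed.

(** The segment from 0 to [e^{i psi} x] consists of the points [e^{i psi} (t x)], so one estimate
    with [a = t |x|] covers it; [(r - |x|)^2] is a lower bound uniform in [t] and [Y]. *)
Lemma rotate_kernel_domain psi (x : rvec) (r : R) : 0 < r -> sqnorm x < r ^+ 2 ->
  kernel_domain (annulus r) (@proj_point R n) (@extra_sqnorm R n) (expi psi *: toC x).
Proof.
move=> r0 xr; pose rho := Num.sqrt (sqnorm x).
have rr : rho < r.
  rewrite -(ltr_pXn2r (n := 2)) ?nnegrE ?sqrtr_ge0 ?(ltW r0) // sqr_sqrtr ?sqnorm_ge0 //.
exists ((r - rho) ^+ 2); first by rewrite exprn_gt0 // subr_gt0.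
move=> t Y t0 t1 [rY Y1].
pose a := t * rho; pose b := Num.sqrt (sqnorm Y); pose s := t * \sum_i x 0 i * Y 0 (lift_index i).
pose c := cos psi.
have a0 : 0 <= a by rewrite mulr_ge0 // sqrtr_ge0.
have b0 : 0 <= b by rewrite sqrtr_ge0.
have a2 : a ^+ 2 = t ^+ 2 * sqnorm x by rewrite exprMn sqr_sqrtr // sqnorm_ge0.
have b2 : b ^+ 2 = sqnorm Y by rewrite sqr_sqrtr // sqnorm_ge0.
have rb : r <= b.
  by rewrite -(ler_pXn2r (n := 2)) ?nnegrE ?(ltW r0) // b2.
have ar : a <= rho by rewrite -[leRHS]mul1r ler_wpM2r // sqrtr_ge0.
have cS : cos psi ^+ 2 + sin psi ^+ 2 = 1 := cos2Dsin2 psi.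
have c1 : c ^+ 2 <= 1.
  by rewrite -cS lerDl sqr_ge0.
have sab : s ^+ 2 <= (a * b) ^+ 2.
  rewrite [(a * b) ^+ 2]exprMn a2 b2 [s ^+ 2]exprMn -[leRHS]mulrA.
  apply: ler_wpM2l; first exact: sqr_ge0.
  have -> : \sum_i x 0 i * Y 0 (lift_index i) = \sum_i lift_proj Y 0 i * x 0 i.
    by apply: eq_bigr => i _; rewrite mxE mulrC.
  apply: le_trans (cauchy_schwarz _ _) _.
  by rewrite ler_wpM2l ?sqnorm_ge0 // sqnorm_lift_proj_le.
have E : kernel_quad (@proj_point R n) (@extra_sqnorm R n) ((t%:C)%C *: (expi psi *: toC x)) Y =
  (((2 * c ^+ 2 - 1) * a ^+ 2 - 2 * c * s + b ^+ 2) +i* (2 * sin psi * (c * a ^+ 2 - s)))%C.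
  apply/eqP; rewrite eq_complex; apply/andP; split; apply/eqP; rewrite /kernel_quad.
    rewrite ReD Re_sum a2 b2 /s /extra_sqnorm /= /sqnorm !mulr_sumr.
    set A := \sum_i (2 * c ^+ 2 - 1) * _; set B := \sum_(i < n) 2 * c * _.
    set L := \sum_i lift_proj Y 0 i ^+ 2.
    rewrite (_ : \sum_(j < n) complex.Re _ = A - B + L); first by ring.
    rewrite /A /B /L -sumrB -big_split; apply: eq_bigr => i _ /=.
    rewrite /proj_point !mxE /expi expr2 /= /c.
    have -> : 2 * cos psi ^+ 2 - 1 = cos psi ^+ 2 - sin psi ^+ 2 by have := cS; lra.
    by ring.
  rewrite ImD Im_sum a2 /s /= addr0 /sqnorm mulr_sumr [c * _]mulr_sumr mulr_sumr -sumrB mulr_sumr.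
  apply: eq_bigr => i _; rewrite /proj_point !mxE /expi expr2 /= /c.
  by ring.
rewrite -(ler_pXn2r (n := 2)) ?nnegrE ?modulus_ge0 ?sqr_ge0 // sqr_modulus E /=.
have S2 : sin psi ^+ 2 = 1 - c ^+ 2 by rewrite /c -cS addrAC subrr add0r.
have -> : (2 * sin psi * (c * a ^+ 2 - s)) ^+ 2 = 4 * (1 - c ^+ 2) * (c * a ^+ 2 - s) ^+ 2.
  by rewrite -S2; ring.
apply: le_trans (rotation_lower_bound a0 b0 sab c1).
rewrite -exprM; apply: lerXn2r; rewrite ?nnegrE; lra.
Qed.

End RotatedBall.

(** * Real analytic functions and Laplacians *)

Section RealExpansions.
Variables (R : realType) (n : nat).
Local Notation mi := {ffun 'I_n -> nat}.
Local Notation rvec := 'rV[R]_n.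
Local Notation cvec := 'rV[Cplx R]_n.
Implicit Types (x a : rvec) (c : mi -> Cplx R) (u : rvec -> Cplx R) (f g : cvec -> Cplx R) (V : set cvec).

Lemma coef_bound_comb c1 c2 (k : Cplx R) (C1 C2 M1 M2 : R) : 0 <= C1 -> 0 <= C2 ->
  0 <= M1 -> 0 <= M2 -> coef_bound c1 C1 M1 -> coef_bound c2 C2 M2 ->
  coef_bound (fun al => c1 al + k * c2 al) (C1 + modulus k * C2) (M1 + M2).
Proof.
move=> C10 C20 M10 M20 H1 H2 al; apply: le_trans (modulusD _ _) _; rewrite modulusM mulrDl.
have k0 := modulus_ge0 k.
apply: lerD.
  apply: le_trans (H1 al) _; apply: ler_wpM2l => //.
  by apply: lerXn2r; rewrite ?nnegrE ?addr_ge0 // lerDl.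
rewrite -mulrA; apply: ler_wpM2l => //; apply: le_trans (H2 al) _; apply: ler_wpM2l => //.
by apply: lerXn2r; rewrite ?nnegrE ?addr_ge0 // lerDr.
Qed.

Lemma psum_comb c1 c2 (k : Cplx R) w v1 v2 : psum c1 w v1 -> psum c2 w v2 ->
  psum (fun al => c1 al + k * c2 al) w (v1 + k * v2).
Proof.
move=> H1 H2; have H := has_sumD H1 (has_sumZ k H2).
by apply: eq_has_sum H => al; rewrite mulrDl mulrA.
Qed.

Lemma expansion_comb f g z c1 c2 (k : Cplx R) : expansion f z c1 -> expansion g z c2 ->
  expansion (fun z => f z + k * g z) z (fun al => c1 al + k * c2 al).
Proof.
move=> [C1 [M1 [d1 [C10 M10 d10 B1 H1]]]] [C2 [M2 [d2 [C20 M20 d20 B2 H2]]]].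
exists (C1 + modulus k * C2), (M1 + M2), (Num.min d1 d2); split.
- by rewrite addr_ge0 // mulr_ge0 // modulus_ge0.
- exact: addr_ge0.
- by rewrite lt_min d10.
- exact: coef_bound_comb.
move=> w hw; apply: psum_comb; [apply: H1 | apply: H2] => i;
  by have := hw i; rewrite lt_min => /andP[].
Qed.

Lemma analytic_comb V f g (k : Cplx R) : analytic V f -> analytic V g ->
  analytic V (fun z => f z + k * g z).
Proof.
move=> H1 H2 z Vz; have [c1 E1] := H1 z Vz; have [c2 E2] := H2 z Vz.
by eexists; exact: expansion_comb E1 E2.
Qed.

Lemma psum_zero (w : cvec) : psum (fun=> 0 : Cplx R) w 0.
Proof.
have := has_sumZ 0 (psum0 (n := n) (fun=> 0 : Cplx R)); rewrite mul0r.
by apply: eq_has_sum => al; rewrite !mul0r.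
Qed.

Lemma expansion0 (z : cvec) : expansion (fun=> 0) z (fun=> 0 : Cplx R).
Proof.
exists 0, 0, 1; split=> //; first by move=> al; rewrite modulus0 mul0r.
by move=> w _; exact: psum_zero.
Qed.

Lemma analytic_sum V (g : 'I_n -> cvec -> Cplx R) : (forall i, analytic V (g i)) ->
  analytic V (fun z => \sum_i g i z).
Proof.
move=> H; elim: (index_enum 'I_n) => [|i s IH].
  move=> z _; exists (fun=> 0); rewrite (_ : (fun z => _) = fun=> 0); first exact: expansion0.
  by apply/funext => w; rewrite big_nil.
rewrite (_ : (fun z => _) = fun z => g i z + 1 * \sum_(i <- s) g i z); first exact: analytic_comb.
by apply/funext => w; rewrite big_cons mul1r.
Qed.

Lemma toCD (x y : rvec) : toC (x + y) = toC x + toC y.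
Proof. by apply/rowP => i; rewrite !mxE rmorphD. Qed.

Lemma toCZ (h : R) (x : rvec) : toC (h *: x) = ((h%:C)%C : Cplx R) *: toC x.
Proof. by apply/rowP => i; rewrite !mxE rmorphM. Qed.

Lemma toC_delta i : toC ('e_i : rvec) = 'e_i.
Proof. by apply/rowP => j; rewrite !mxE; case: (_ && _). Qed.

Lemma toC0 : toC (0 : rvec) = 0.
Proof. by apply/rowP => j; rewrite !mxE. Qed.

Definition small_row x (d : R) := forall i, `|x 0 i| < d.

Lemma small_toC (x : rvec) (d : R) : small_row x d -> small_vec (toC x) d.
Proof. by move=> H i; rewrite mxE modulus_real. Qed.

Lemma cmono_toC (al : mi) (x : rvec) : cmono al (toC x) = ((monomial al x)%:C)%C.
Proof.
by rewrite /cmono /monomial rmorph_prod; apply: eq_bigr => i _; rewrite mxE rmorphXn.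
Qed.

Definition real_expansion u a c := exists C M d : R,
  [/\ 0 <= C, 0 <= M, 0 < d, coef_bound c C M &
      forall x, small_row x d -> psum c (toC x) (u (a + x))].

Lemma psum_toC c (x : rvec) v : psum c (toC x) v <->
  summability.partial_sum (fun al => c al * (monomial al x)%:C%C)
    @ summability.totally --> v.
Proof.
rewrite -has_sum_totally /psum; split; apply: eq_has_sum => al; by rewrite cmono_toC.
Qed.

Lemma near_row (a : rvec) (P : rvec -> Prop) : (\forall x \near a, P x) <->
  exists2 d : R, 0 < d & forall x, small_row x d -> P (a + x).
Proof.
split.
  move=> /nbhs_ballP[d d0 H]; exists d => // x hx; apply: H; split=> // i j.
  by rewrite ord1 /ball /= mxE opprD addNKr normrN.
move=> [d d0 H]; apply/nbhs_ballP; exists d => // y [_ hy].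
rewrite -(subrK a y) addrC; apply: H => i; rewrite !mxE distrC; exact: hy.
Qed.

(** Abel's lemma: convergence at the one point with all coordinates [t = d / 2] bounds
    [|c al| t^|al|], which is the geometric bound with [M = 1 / t]. *)
Lemma real_analytic_expansion (G : set rvec) u a : real_analytic_on G u -> G a ->
  exists c, real_expansion u a c.
Proof.
move=> H Ga; have [c /near_row [d d0 Hc]] := H a Ga; exists c.
have Hc' x : small_row x d -> psum c (toC x) (u (a + x)).
  by move=> hx; apply/psum_toC; have := Hc x hx; rewrite [a + x]addrC addrK addrC.
pose t := d / 2; have t0 : 0 < t by rewrite divr_gt0.
have [|K HK] := has_sum_bounded (Hc' (const_mx t) _).
  by move=> i; rewrite mxE gtr0_norm // /t; lra.
exists K, t^-1, d; split=> //; first exact: le_trans (modulus_ge0 _) (HK [ffun=> 0%N]).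
  by rewrite invr_ge0 ltW.
move=> al; have := HK al; rewrite modulusM cmono_toC modulus_real /monomial.
rewrite (eq_bigr (fun i => t ^+ al i)); last by move=> i _; rewrite mxE.
rewrite -expr_sum -/(mdeg al) ger0_norm ?exprn_ge0 ?(ltW t0) // exprVn.
by rewrite ler_pdivlMr // exprn_gt0.
Qed.

Lemma real_expansion_analytic (G : set rvec) u :
  (forall a, G a -> exists c, real_expansion u a c) -> real_analytic_on G u.
Proof.
move=> H a Ga; have [c [C [M [d [C0 M0 d0 _ Hc]]]]] := H a Ga; exists c; apply/near_row.
by exists d => // x hx; rewrite [a + x]addrC addrK -[x + a]addrC; apply/psum_toC; exact: Hc.
Qed.

(** The series is summed at complex arguments as well; through it, continuity and derivatives of
    real analytic functions are read off from the complex expansions. *)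
Lemma real_expansion_complex u a c : real_expansion u a c -> exists2 f, expansion f 0 c &
  exists2 d : R, 0 < d & forall x : rvec, small_row x d -> f (toC x) = u (a + x).
Proof.
move=> [C [M [d [C0 M0 d0 Hc H]]]].
(* Where the series has no sum, [f] takes the default value 0. *)
pose f w := xget 0 [set v | psum c w v].
have fP w v : psum c w v -> psum c w (f w) by move=> Hv; exact: (xgetPex 0 (ex_intro _ v Hv)).
exists f; last first.
  by exists d => // x hx; have Hx := H x hx; exact: has_sum_uniq (fP _ _ Hx) Hx.
pose e := (2 * (M + 1))^-1; have M1 : 0 < M + 1 by rewrite ltr_wpDl.
have e0 : 0 < e by rewrite invr_gt0 mulr_gt0.
exists C, M, e; split=> // w hw; rewrite add0r.
have [v Hv] : exists v, psum c w v.
  apply: (@psum_exists _ _ c C M e) => //; first exact: ltW.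
    by rewrite -ltr_pdivlMr // /e invrK; lra.
  by move=> i; exact: ltW.
exact: fP Hv.
Qed.

Definition quad_deriv u (i : 'I_n) a v := exists K e : R, 0 < e /\
  forall h : R, `|h| <= e -> modulus (u (a + h *: 'e_i) - u a - (h%:C)%C * v) <= K * h ^+ 2.

Lemma quad_deriv_is_derive u i a v : quad_deriv u i a v ->
  is_derive a 'e_i (fun x => complex.Re (u x)) (complex.Re v) /\
  is_derive a 'e_i (fun x => complex.Im (u x)) (complex.Im v).
Proof.
move=> [K [e [e0 H]]]; split; apply: (@is_derive_quadratic _ _ _ _ _ _ K e) => // h he.
  apply: le_trans (H h he); rewrite -ReM_real -!ReN -!ReD [h *: _ + a]addrC.
  exact: Re_le_modulus.
apply: le_trans (H h he); rewrite -ImM_real -!ImN -!ImD [h *: _ + a]addrC.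
exact: Im_le_modulus.
Qed.

Lemma quad_deriv_partial u i a v : quad_deriv u i a v -> partial i u a = v.
Proof.
move=> /quad_deriv_is_derive [D1 D2]; rewrite /partial.
have -> := @derive_val _ _ _ _ _ _ _ D1; have -> := @derive_val _ _ _ _ _ _ _ D2.
by case: v {D1 D2}.
Qed.

Lemma real_expansion_partial u a c i : real_expansion u a c ->
  real_expansion (partial i u) a (mderiv i c) /\ quad_deriv u i a (partial i u a).
Proof.
move=> /real_expansion_complex [f Ef [d d0 Hf]].
have [C [M [e [C0 M0 e0 Hc He]]]] := expansion_deriv i Ef.
have key x : (forall j, `|x 0 j| < d / 2) -> (forall j, `|x 0 j| < e) -> exists v,
    psum (mderiv i c) (toC x) v /\ quad_deriv u i (a + x) v.
  move=> xd xe; have [v Hv] := He _ (small_toC xe); rewrite add0r => -[K [e' [e'0 HK]]].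
  (* Since [d / 2 + d / 3 < d], the shifted point stays where [f] agrees with [u]. *)
  exists v; split=> //; exists K, (Num.min e' (d / 3)); split.
    by rewrite lt_min e'0 divr_gt0.
  move=> h; rewrite le_min => /andP[h1 h2].
  have hx : forall j, `|(x + h *: 'e_i) 0 j| < d.
    move=> j; rewrite !mxE; apply: le_lt_trans (ler_normD _ _) _; rewrite normrM.
    have := xd j; have : `|h| * `|((0 == 0 :> 'I_1) && (j == i))%:R| <= d / 3 :> R.
      case: (_ && _); first by rewrite normr1 mulr1.
      by rewrite normr0 mulr0; lra.
    by lra.
  have hx0 : forall j, `|x 0 j| < d by move=> j; apply: lt_trans (xd j) _; lra.
  rewrite -[a + x + _]addrA -(Hf _ hx) -(Hf _ hx0) toCD toCZ toC_delta.
  have := HK (h%:C)%C; rewrite modulus_real => /(_ h1).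
  by rewrite real_normK ?num_real // [h ^+ 2 * K]mulrC.
have keyp x : (forall j, `|x 0 j| < d / 2) -> (forall j, `|x 0 j| < e) ->
    psum (mderiv i c) (toC x) (partial i u (a + x)) /\
    quad_deriv u i (a + x) (partial i u (a + x)).
  by move=> h1 h2; have [v [Hv Dv]] := key x h1 h2; rewrite (quad_deriv_partial Dv).
split.
  exists C, M, (Num.min (d / 2) e); split=> //.
    by rewrite lt_min e0 divr_gt0.
  by move=> x hx; apply: (proj1 (keyp x _ _)) => j; have := hx j; rewrite lt_min => /andP[].
have [||_ D] := keyp 0; last by rewrite addr0 in D.
  by move=> j; rewrite mxE normr0 divr_gt0.
by move=> j; rewrite mxE normr0.
Qed.

Lemma real_expansion_continuous u a c : real_expansion u a c ->
  continuous_at a (fun x => complex.Re (u x)) /\ continuous_at a (fun x => complex.Im (u x)).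
Proof.
move=> /real_expansion_complex [f Ef [d d0 Hf]].
have u0 : u a = f 0 by rewrite -toC0 Hf ?addr0 // => i; rewrite mxE normr0.
have key e : 0 < e -> \forall y \near a, modulus (u y - u a) < e.
  move=> e0; have [e' e'0 He] := expansion_continuous Ef e0; apply/near_row.
  exists (Num.min d e'); first by rewrite lt_min d0.
  move=> x hx; rewrite u0 -Hf; last by move=> i; have := hx i; rewrite lt_min => /andP[].
  rewrite -[toC x]add0r; apply: He; apply: small_toC => i.
  by have := hx i; rewrite lt_min => /andP[].
split=> A /nbhs_ballP[e e0 H]; apply: filterS (key e e0) => y hy; apply: H.
  rewrite /ball /= distrC -ReN -ReD; exact: le_lt_trans (Re_le_modulus _) hy.
rewrite /ball /= distrC -ImN -ImD; exact: le_lt_trans (Im_le_modulus _) hy.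
Qed.

Lemma real_expansion_laplacian u a c : real_expansion u a c ->
  exists c', real_expansion (laplacian u) a c'.
Proof.
move=> E.
have : forall s : seq 'I_n, exists c', real_expansion (fun x => \sum_(i <- s) partial i (partial i u) x) a c'.
  elim=> [|i s [c' IH]].
    exists (fun=> 0); exists 0, 0, 1; split=> //; first by move=> al; rewrite modulus0 mul0r.
    by move=> w _; rewrite big_nil; exact: psum_zero.
  have [E1 _] := real_expansion_partial i E; have [E2 _] := real_expansion_partial i E1.
  have [C1 [M1 [d1 [C10 M10 d10 B1 H1]]]] := E2; have [C2 [M2 [d2 [C20 M20 d20 B2 H2]]]] := IH.
  exists (fun al => mderiv i (mderiv i c) al + 1 * c' al).
  exists (C1 + modulus 1 * C2), (M1 + M2), (Num.min d1 d2); split.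
  - by rewrite addr_ge0 // mulr_ge0 // modulus_ge0.
  - exact: addr_ge0.
  - by rewrite lt_min d10.
  - exact: coef_bound_comb.
  move=> w hw; rewrite big_cons -[X in _ + X]mul1r; apply: psum_comb; [apply: H1 | apply: H2] => j;
    by have := hw j; rewrite lt_min => /andP[].
by move=> /(_ (index_enum 'I_n)).
Qed.

Lemma real_expansion_iter u a j : (exists c, real_expansion u a c) ->
  exists c', real_expansion (iter j (@laplacian R n) u) a c'.
Proof. by move=> E; elim: j => [//|j [c' IH]]; exact: real_expansion_laplacian IH. Qed.

Lemma real_expansion_rotate f (om : Cplx R) (a : rvec) c : expansion f (om *: toC a) c ->
  real_expansion (fun x => f (om *: toC x)) a (fun al => c al * om ^+ mdeg al).
Proof.
move=> [C [M [d [C0 M0 d0 Hc H]]]]; have m0 := modulus_ge0 om.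
have m1 : 0 < modulus om + 1 by lra.
exists C, (M * modulus om), (d / (modulus om + 1)); split=> //.
- exact: mulr_ge0.
- exact: divr_gt0.
- move=> al; rewrite modulusM modulusX exprMn mulrA; apply: ler_wpM2r (Hc al).
  exact: exprn_ge0.
move=> x hx; rewrite toCD scalerDr.
have /H : small_vec (om *: toC x) d.
  move=> i; rewrite !mxE modulusM modulus_real.
  have := hx i; rewrite ltr_pdivlMr // => h; have := normr_ge0 (x 0 i); lra.
apply: eq_has_sum => al; rewrite -mulrA; congr (_ * _).
rewrite /cmono /mdeg expr_sum -big_split; apply: eq_bigr => i _.
by rewrite mxE exprMn.
Qed.

Definition real_open (G : set rvec) := forall a, G a ->
  exists2 d : R, 0 < d & forall x, small_row x d -> G (a + x).

(** Each derivative of [f (om x)] in [x] brings out a factor [om]; the scalar [k] collects these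
    factors when the lemma is iterated. *)
Lemma partial_rotate V f g i (om k : Cplx R) u (G : set rvec) : cpartial V i f g ->
  real_open G -> (forall x, G x -> V (om *: toC x)) ->
  (forall x, G x -> u x = k * f (om *: toC x)) ->
  forall x, G x -> partial i u x = k * om * g (om *: toC x).
Proof.
move=> [_ D] oG GV Hu x Gx; apply: quad_deriv_partial.
have [K [e [e0 HK]]] := D _ (GV x Gx); have [d d0 Hd] := oG x Gx.
have m0 := modulus_ge0 om; have m1 : 0 < modulus om + 1 by lra.
exists (modulus k * (modulus om ^+ 2 * K)), (Num.min (e / (modulus om + 1)) (d / 2)); split.
  by rewrite lt_min !divr_gt0.
move=> h; rewrite le_min => /andP[]; rewrite ler_pdivlMr // => h1 h2.
have Gh : G (x + h *: 'e_i).
  apply: Hd => j; rewrite !mxE normrM; case: (_ && _); rewrite ?normr1 ?normr0; lra.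
have e1 : modulus ((h%:C)%C * om) <= e.
  rewrite modulusM modulus_real; have := normr_ge0 h; lra.
have {HK} := HK _ e1; rewrite !Hu // toCD toCZ toC_delta scalerDr scalerA [om * _]mulrC => HK.
set z := f _; set z0 := f _; rewrite -/z -/z0 in HK.
have -> : k * z - k * z0 - (h%:C)%C * (k * om * g (om *: toC x)) =
    k * (z - z0 - (h%:C)%C * om * g (om *: toC x)) by ring.
rewrite modulusM -[leRHS]mulrA; apply: ler_wpM2l; first exact: modulus_ge0.
apply: le_trans HK _; rewrite modulusM modulus_real exprMn real_normK ?num_real //.
by rewrite le_eqVlt; apply/orP; left; apply/eqP; ring.
Qed.

Lemma analytic_laplacian V f : coord_open V -> analytic V f -> exists2 F, analytic V F &
  forall (om k : Cplx R) u (G : set rvec), real_open G -> (forall x, G x -> V (om *: toC x)) ->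
    (forall x, G x -> u x = k * f (om *: toC x)) ->
    forall x, G x -> laplacian u x = k * om ^+ 2 * F (om *: toC x).
Proof.
move=> oV aV.
have [g Hg] : {g : 'I_n -> cvec -> Cplx R & forall i, cpartial V i f (g i)}.
  by apply: (@choice _ _ (fun i g => cpartial V i f g)) => i; exact: analytic_cpartial.
have ag i := cpartial_analytic aV (Hg i).
have [gg Hgg] : {gg : 'I_n -> cvec -> Cplx R & forall i, cpartial V i (g i) (gg i)}.
  by apply: (@choice _ _ (fun i g' => cpartial V i (g i) g')) => i; exact: analytic_cpartial.
exists (fun z => \sum_i gg i z).
  by apply: analytic_sum => i; exact: cpartial_analytic (ag i) (Hgg i).
move=> om k u G oG GV Hu x Gx; rewrite /laplacian mulr_sumr; apply: eq_bigr => i _.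
have P1 := partial_rotate (Hg i) oG GV Hu.
by rewrite (partial_rotate (Hgg i) oG GV P1 Gx) expr2 !mulrA.
Qed.

(** [F] is chosen before [om], since the same function serves for the real points, where [om = 1]
    will show it to vanish, and for the rotated ones. In the induction [k] stores the factor
    [om ^+ 2] of each Laplacian. *)
Lemma analytic_iter_laplacian V f p : coord_open V -> analytic V f -> exists2 F, analytic V F &
  forall (om k : Cplx R) u (G : set rvec), real_open G -> (forall x, G x -> V (om *: toC x)) ->
    (forall x, G x -> u x = k * f (om *: toC x)) ->
    forall x, G x -> iter p (@laplacian R n) u x = k * om ^+ (2 * p) * F (om *: toC x).
Proof.
move=> oV; elim: p f => [|p IH] f aV.
  by exists f => // om k u G _ _ Hu x Gx; rewrite /= (Hu x Gx) muln0 expr0 mulr1.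
have [F aF HF] := analytic_laplacian oV aV; have [F' aF' HF'] := IH F aF.
exists F' => // om k u G oG GV Hu x Gx; rewrite iterSr.
rewrite (HF' om (k * om ^+ 2) _ G) //; last exact: HF.
by rewrite mulnS exprD mulrA.
Qed.

End RealExpansions.

Lemma linear_approx_differentiable (K : numFieldType) (V W : normedModType K) (f : V -> W)
    (L : {linear V -> W}) z : continuous L -> f \o shift z = cst (f z) + L +o_ 0 id ->
  differentiable f z.
Proof. by move=> cL E; apply/diff_locallyP; rewrite (diff_unique cL E). Qed.

(** * Complex differentiability from Taylor expansions *)

Section ComplexDifferentiability.
Variables (R : realType) (n : nat).
Local Notation cvec := 'rV[Cplx R]_n.
Implicit Types (w z : cvec) (f : cvec -> Cplx R).

Lemma complex_gt0 (e : Cplx R) : 0 < e -> 0 < complex.Re e /\ e = ((complex.Re e)%:C)%C.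
Proof. by case: e => x y; rewrite ltcE /= => /andP[/eqP -> x0]. Qed.

Lemma complex_ge0 (e : Cplx R) : 0 <= e -> e = ((complex.Re e)%:C)%C.
Proof. by case: e => x y; rewrite lecE /= => /andP[/eqP -> x0]. Qed.

Lemma near_cvec z (P : cvec -> Prop) :
  (exists2 d : R, 0 < d & forall w, small_vec w d -> P (z + w)) -> \forall y \near z, P y.
Proof.
move=> [d d0 H]; apply/nbhs_ballP; exists (d%:C)%C; first by rewrite /= ltcR.
move=> y [_ hy]; rewrite -(subrK z y) addrC; apply: H => i; rewrite !mxE modulusB.
by have := hy 0 i; rewrite /ball /= norm_modulus ltcR.
Qed.

(** The norm of a row is an element of [R[i]]; it is compared with the coordinates through balls,
    whose membership is a coordinatewise condition. *)
Lemma coord_le_norm w i : modulus (w 0 i) <= complex.Re `|w|.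
Proof.
have wr := complex_ge0 (normr_ge0 w).
apply/ler_addgt0Pr => e e0.
have : ball (0 : cvec) (`|w| + (e%:C)%C) w.
  by rewrite mx_norm_ball /ball_ /= sub0r normrN ltrDl ltcR.
move=> [_ /(_ 0 i)]; rewrite /ball /= mxE sub0r normrN norm_modulus wr -rmorphD ltcR => /ltW.
by [].
Qed.

Definition row_form (b : 'I_n -> Cplx R) w : Cplx R := \sum_i b i * w 0 i.

Lemma row_form_is_linear b : linear (row_form b).
Proof.
move=> k x y; rewrite /row_form scaler_sumr -big_split; apply: eq_bigr => i _ /=.
by rewrite !mxE mulrDr mulrCA.
Qed.

HB.instance Definition _ b :=
  GRing.isLinear.Build (Cplx R) cvec (Cplx R) _ (row_form b) (row_form_is_linear b).

Lemma row_form_le b w (r : R) : (forall i, modulus (w 0 i) <= r) ->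
  modulus (row_form b w) <= (\sum_i modulus (b i)) * r.
Proof.
move=> H; apply: le_trans (modulus_sum _ _ _) _; rewrite mulr_suml; apply: ler_sum => i _.
by rewrite modulusM; apply: ler_wpM2l; first exact: modulus_ge0.
Qed.

Lemma row_form_continuous b : continuous (row_form b).
Proof.
move=> z A /nbhs_ballP[e /= /complex_gt0 [e0 ->] H]; apply: near_cvec.
pose S := \sum_i modulus (b i) + 1.
have S0 : 0 < S by rewrite ltr_wpDl // sumr_ge0 // => i _; exact: modulus_ge0.
exists (complex.Re e / S); first exact: divr_gt0.
move=> w hw; apply: H; rewrite /ball /= linearD opprD addNKr normrN norm_modulus ltcR.
have hw' i : modulus (w 0 i) <= complex.Re e / S by exact: ltW.
apply: le_lt_trans (row_form_le b hw') _.
by rewrite mulrA ltr_pdivrMr // mulrC ltr_pM2l // /S ltrDl.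
Qed.

(** The differential is the linear form given by the coefficients of degree one; the quadratic
    remainder of [expansion_frechet], taken with [r = |w|], is negligible against [|w|]. *)
Lemma expansion_differentiable f z c : expansion f z c -> differentiable f z.
Proof.
move=> /expansion_frechet [K [d [d0 H]]].
pose L : {linear cvec -> Cplx R} := row_form (fun i => c (munit i)).
have cL : continuous L by exact: row_form_continuous.
apply: (linear_approx_differentiable cL); apply/eqaddoP => e e0; have [re0 er] := complex_gt0 e0; apply: near_cvec.
have K1 : 0 < `|K| + 1 by rewrite ltr_wpDl.
pose m := Num.min d (complex.Re e / (`|K| + 1)).
exists m; first by rewrite lt_min d0 divr_gt0.
move=> w hw; rewrite add0r.
have -> : (f \o shift z - (cst (f z) + L)) w = f (z + w) - f z - L w.
  by rewrite !fctE /= opprD addrA [w + z]addrC.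
have cw i := coord_le_norm w i; set r := complex.Re `|w| in cw.
have rm : r <= m.
  have : ball (0 : cvec) ((m%:C)%C : Cplx R) w.
    split=> [|i j]; first by rewrite ltcR lt_min d0 divr_gt0.
    by rewrite ord1 /ball /= mxE sub0r normrN norm_modulus ltcR.
  by rewrite mx_norm_ball /ball_ /= sub0r normrN (complex_ge0 (normr_ge0 w)) ltcR => /ltW.
have r0 : 0 <= r.
  by have := normr_ge0 w; rewrite (complex_ge0 (normr_ge0 w)) lecR.
have := H w r cw; rewrite le_min in rm; case/andP: rm => rd rK /(_ rd) Hw.
rewrite er (complex_ge0 (normr_ge0 w)) norm_modulus -rmorphM lecR -/r.
apply: le_trans Hw _.
rewrite expr2 mulrA; apply: ler_wpM2r => //; apply: le_trans (ler_wpM2r r0 (ler_norm K)) _.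
move: rK; rewrite ler_pdivlMr // => h; have := normr_ge0 K; lra.
Qed.

Lemma coord_open_open (V : set cvec) : coord_open V -> open V.
Proof. by move=> H; rewrite openE => z Vz; apply: near_cvec; exact: H. Qed.

End ComplexDifferentiability.

(** * The holomorphic extension *)

Section Extension.
Variables (R : realType) (n p : nat).
Local Notation rvec := 'rV[R]_n.
Local Notation cvec := 'rV[Cplx R]_n.

Lemma unit_ballE (x : rvec) : unit_ball R n x <-> sqnorm x < 1.
Proof.
have s0 : 0 <= \sum_(i < n) x 0 i ^+ 2 := sqnorm_ge0 x.
rewrite /unit_ball /= -(ltr_pXn2r (n := 2)) ?nnegrE ?sqrtr_ge0 // expr1n sqr_sqrtr //.
Qed.

Lemma unit_ball_open : real_open (unit_ball R n).
Proof.
move=> a /unit_ballE a1.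
have /near_row [d d0 H] : \forall x \near a, 0 < 1 - sqnorm x.
  apply: cont_near_gt; last by rewrite subr_gt0.
  by apply: cont_sub; [exact: cont_const | exact: sqnorm_continuous].
by exists d => // x hx; apply/unit_ballE; rewrite -subr_gt0; exact: H.
Qed.

Variable u : rvec -> Cplx R.
Hypothesis hu : polyharmonic_on p (unit_ball R n) u.
Local Notation lap j := (iter j (@laplacian R n) u).

Lemma polyharmonic_on_data :
  polyharmonic_data p (fun j x => complex.Re (lap j x))
    (fun i j x => complex.Re (partial i (lap j) x))
    (fun i j x => complex.Re (partial i (partial i (lap j)) x)) /\
  polyharmonic_data p (fun j x => complex.Im (lap j x))
    (fun i j x => complex.Im (partial i (lap j) x))
    (fun i j x => complex.Im (partial i (partial i (lap j)) x)).
Proof.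
have [au pu] := hu.
pose cont (v : rvec -> Cplx R) (x : rvec) := continuous_at x (fun x => complex.Re (v x)) /\
  continuous_at x (fun x => complex.Im (v x)).
have H x j : sqnorm x < 1 -> cont (lap j) x /\ forall i,
    [/\ cont (partial i (lap j)) x, cont (partial i (partial i (lap j))) x,
        quad_deriv (lap j) i x (partial i (lap j) x) &
        quad_deriv (partial i (lap j)) i x (partial i (partial i (lap j)) x)].
  move=> /unit_ballE xB; have [c0 E0] := real_analytic_expansion au xB.
  have [c E] : exists c, real_expansion (lap j) x c by apply: real_expansion_iter; exists c0.
  split=> [|i]; first exact: real_expansion_continuous E.
  have [E1 D1] := real_expansion_partial i E; have [E2 D2] := real_expansion_partial i E1.
  by split=> //; [exact: real_expansion_continuous E1 | exact: real_expansion_continuous E2].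
split=> x x1; split.
- by move=> j; have [[]] := H x j x1.
- by move=> i j; have [_ /(_ i) [[h1 _] [h2 _] _ _]] := H x j x1.
- move=> i j; have [_ /(_ i) [_ _ /quad_deriv_is_derive[h1 _] /quad_deriv_is_derive[h2 _]]] :=
    H x j x1.
  by split.
- by move=> j; rewrite /= /laplacian Re_sum.
- by rewrite pu //; exact/unit_ballE.
- by move=> j; have [[]] := H x j x1.
- by move=> i j; have [_ /(_ i) [[_ h1] [_ h2] _ _]] := H x j x1.
- move=> i j; have [_ /(_ i) [_ _ /quad_deriv_is_derive[_ h1] /quad_deriv_is_derive[_ h2]]] :=
    H x j x1.
  by split.
- by move=> j; rewrite /= /laplacian Im_sum.
- by rewrite pu //; exact/unit_ballE.
Qed.

Definition point_domain (r : R) : set cvec :=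
  kernel_domain (annulus r) (@proj_point R n) (@extra_sqnorm R n).

Lemma proj_point_le1 (r : R) Y (i : 'I_n) : annulus r Y -> modulus (proj_point Y i) <= 1.
Proof.
move=> [_ Y1]; rewrite /proj_point modulus_real -(ler_pXn2r (n := 2)) ?nnegrE // expr1n.
rewrite real_normK ?num_real //; apply: le_trans Y1; apply: le_trans (sqnorm_lift_proj_le Y).
exact: sqr_coord_le.
Qed.

Lemma point_domain_open r : coord_open (point_domain r).
Proof. by apply: kernel_domain_open => Y i; exact: proj_point_le1. Qed.

(** A larger inner radius shrinks the annulus, so fewer [Y] constrain [z]. *)
Lemma point_domain_mono r s : 0 < r -> r <= s -> point_domain r `<=` point_domain s.
Proof.
move=> r0 rs z [d d0 H]; exists d => // t Y t0 t1 [sY Y1]; apply: H => //; split=> //.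
by apply: le_trans sY; apply: lerXn2r; rewrite ?nnegrE ?(ltW r0) // (le_trans (ltW r0)).
Qed.

Lemma local_extension r : (0 < n)%N -> (0 < p)%N -> 0 < r -> r < 1 ->
  exists2 f, analytic (point_domain r) f & forall x, sqnorm x < r ^+ 2 -> f (toC x) = u x.
Proof.
move=> n0 p0 r0 r1; have [DR DI] := polyharmonic_on_data.
have [J [K [HJ K0 Hf]]] := polyharmonic_potential DR DI n0 p0 r0 r1.
exists (fun z => J (fun Y => (point_quad z Y)^-1 ^+ n)).
  by apply: (kernel_potential_analytic HJ K0) => Y i; exact: proj_point_le1.
by move=> x xr; rewrite Hf //=; case: (u x).
Qed.

Theorem global_extension : (0 < n)%N -> (0 < p)%N -> exists (V : set cvec) f,
  [/\ coord_open V, forall z (t : R), V z -> 0 <= t -> t <= 1 -> V ((t%:C)%C *: z),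
      forall psi x, unit_ball R n x -> V (expi psi *: toC x),
      analytic V f & forall x, unit_ball R n x -> f (toC x) = u x].
Proof.
move=> n0 p0.
have [F HF] : {F : R -> cvec -> Cplx R & forall r, 0 < r -> r < 1 ->
    analytic (point_domain r) (F r) /\ forall x, sqnorm x < r ^+ 2 -> F r (toC x) = u x}.
  apply: (@choice _ _ (fun r f => 0 < r -> r < 1 -> analytic (point_domain r) f /\
    forall x, sqnorm x < r ^+ 2 -> f (toC x) = u x)) => r.
  have [/andP[r0 r1]|h] := boolP ((0 < r) && (r < 1)); last first.
    by exists (fun=> 0) => r0 r1; rewrite r0 r1 in h.
  by have [f af uf] := local_extension n0 p0 r0 r1; exists f.
have glue_le r s z : 0 < r -> r <= s -> s < 1 -> point_domain r z -> F r z = F s z.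
  move=> r0 rs s1; have s0 := lt_le_trans r0 rs; have r1 := le_lt_trans rs s1.
  have [ar ur] := HF r r0 r1; have [as_ us] := HF s s0 s1.
  have as' : analytic (point_domain r) (F s) by move=> w /(point_domain_mono r0 rs); exact: as_.
  move=> Vz; apply/eqP; rewrite -subr_eq0; apply/eqP.
  have := @identity_principle _ _ (point_domain r) (fun z => F r z + (-1) * F s z)
    (@point_domain_open r) _ (analytic_comb (-1) ar as') _ z Vz.
  rewrite mulN1r; apply.
    by move=> w t; exact: kernel_domain_star.
  have /near_row [d d0 H] : \forall x \near (0 : rvec), 0 < r ^+ 2 - sqnorm x.
    apply: cont_near_gt; last by rewrite subr_gt0 /sqnorm big1 ?exprn_gt0 // => i _; rewrite mxE expr0n.
    by apply: cont_sub; [exact: cont_const | exact: sqnorm_continuous].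
  exists d => // x /H; rewrite add0r subr_gt0 => xr.
  by rewrite ur // us ?mulN1r ?subrr //; apply: lt_le_trans xr _; apply: lerXn2r; rewrite ?nnegrE // ltW.
have glue r s z : 0 < r -> r < 1 -> 0 < s -> s < 1 -> point_domain r z -> point_domain s z ->
    F r z = F s z.
  move=> r0 r1 s0 s1 Vr Vs; have [rs|sr] := leP r s; first exact: glue_le.
  by apply/esym; apply: glue_le => //; exact: ltW.
pose ok z r := [/\ 0 < r, r < 1 & point_domain r z].
(* By [glue] the value does not depend on the admissible radius that [xget] picks; off the union of
   the domains the radius defaults to 0. *)
pose f z := F (xget 0 [set r | ok z r]) z.
have fE z r : ok z r -> f z = F r z.
  move=> [r0 r1 Vz]; have [s0 s1 Vs] : ok z (xget 0 [set r | ok z r]).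
    exact: (xgetPex 0 (ex_intro _ r (And3 r0 r1 Vz))).
  exact: glue.
have ball_ok psi x : unit_ball R n x -> exists2 r, ok (expi psi *: toC x) r & sqnorm x < r ^+ 2.
  (* [r ^+ 2] is the midpoint between [|x|^2] and 1. *)
  move=> /unit_ballE x1; pose r := Num.sqrt ((sqnorm x + 1) / 2).
  have s0 := sqnorm_ge0 x.
  have h0 : 0 <= (sqnorm x + 1) / 2 by rewrite divr_ge0 // addr_ge0.
  have rr : r ^+ 2 = (sqnorm x + 1) / 2 by rewrite sqr_sqrtr.
  have r0 : 0 < r by rewrite sqrtr_gt0; lra.
  have xr : sqnorm x < r ^+ 2 by rewrite rr; lra.
  exists r => //; split=> //; last exact: rotate_kernel_domain.
  by rewrite -(ltr_pXn2r (n := 2)) ?nnegrE ?(ltW r0) // rr expr1n; lra.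
exists [set z | exists r, ok z r], f; split.
- move=> z [r [r0 r1 Vz]]; have [d d0 H] := point_domain_open Vz.
  by exists d => // w /H Vw; exists r.
- move=> z t [r [r0 r1 Vz]] t0 t1; exists r; split=> //; exact: kernel_domain_star.
- by move=> psi x /(ball_ok psi) [r okr _]; exists r.
- move=> z [r [r0 r1 Vz]]; have [aF _] := HF r r0 r1.
  have [c [C [M [d [C0 M0 d0 Hc H]]]]] := aF z Vz; have [e e0 He] := point_domain_open Vz.
  exists c, C, M, (Num.min d e); split=> //; first by rewrite lt_min d0.
  move=> w hw; rewrite (fE _ r); first by apply: H => i; have := hw i; rewrite lt_min => /andP[].
  by split=> //; apply: He => i; have := hw i; rewrite lt_min => /andP[].
move=> x xB; have [r okr xr] := ball_ok 0 x xB.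
have e0 : expi 0 *: toC x = toC x.
  by rewrite /expi cos0 sin0 -[X in X *: _]/(1 : Cplx R) scale1r.
rewrite e0 in okr; rewrite (fE _ _ okr); have [r0 r1 _] := okr.
by have [_ ->] := HF r r0 r1.
Qed.

End Extension.

Theorem lemma1 (R : realType) (n p : nat) (hn : (0 < n)%N) (hp : (0 < p)%N)
    (phi : R) (u : 'rV[R]_n -> Cplx R)
    (hu : polyharmonic_on p (unit_ball R n) u) :
  exists f : 'rV[Cplx R]_n -> Cplx R,
    holomorphic_extension (unit_ball R n) u
      (\bigcup_(psi in [set: R]) rotate psi (unit_ball R n)) f /\
    polyharmonic_on_rotate p phi (unit_ball R n) f.
Proof.
have [V [f [oV starV BV aV fu]]] := global_extension hu hn hp.
have [F aF HF] := analytic_iter_laplacian p oV aV.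
have e0 : expi 0 = 1 :> Cplx R by rewrite /expi cos0 sin0.
(* With [om = 1] and [k = 1] the identity for [F] equates it, at real points of the ball, with the
   [p]-th iterated Laplacian of [u]. *)
have F0 : forall z, V z -> F z = 0.
  apply: identity_principle => //.
  have B0 : unit_ball R n 0.
    by apply/unit_ballE; rewrite /sqnorm big1 // => i _; rewrite mxE expr0n.
  have [d d0 H] := unit_ball_open B0.
  exists d => // x /H; rewrite add0r => xB.
  have B1 y : unit_ball R n y -> V (1 *: toC y) by rewrite -e0; exact: BV.
  have := HF 1 1 u (unit_ball R n) (@unit_ball_open R n) B1 _ x xB.
  rewrite (proj2 hu) // expr1n !mul1r scale1r => -> // y yB.
  by rewrite mul1r scale1r fu.
exists f; split.
  split=> //; exists V; split; last split.
  - by move=> z [psi _ [x xB <-]]; exact: BV.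
  - exact: coord_open_open.
  - by move=> z Vz; have [c Ec] := aV z Vz; exact: expansion_differentiable Ec.
split.
  apply: real_expansion_analytic => a aB.
  have [c Ec] := aV _ (BV phi a aB).
  by exists (fun al => c al * expi phi ^+ mdeg al); exact: real_expansion_rotate.
move=> x xB; rewrite (HF (expi phi) 1 _ (unit_ball R n)) //.
- by rewrite F0 ?mulr0 //; exact: BV.
- exact: unit_ball_open.
- exact: BV.
- by move=> y _; rewrite mul1r.
Qed.
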